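(* Let $k$ be a positive integer and let $f(n,m)$ denote the time sufficient for checking whether $\mathrm{ola}^+(G)\le k$ for a connected graph $G$ with $n$ vertices and $m$ edges. Then $f(n,m)=O(m+n+f(5k+2,6k+1))$; that is, whether $\mathrm{ola}^+(G)\le k$ for a connected graph $G$ with $n$ vertices and $m$ edges can be decided in time $O(n+m)$ plus the time needed to decide the same question for a connected graph with at most $5k+2$ vertices and at most $6k+1$ edges.
   Context: All graphs are finite, without loops or parallel edges. A linear arrangement of $G=(V,E)$ is a bijection $\alpha:V\to\{1,\dots,|V|\}$; net cost $\mathrm{nc}(\alpha,G)=\sum_{uv\in E}(|\alpha(u)-\alpha(v)|-1)$; $\mathrm{ola}^+(G)$ is the minimum net cost over all linear arrangements of $G$. Graphs are given by adjacency lists. *)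

(* Defs.v *)
From mathcomp Require Import all_boot all_fingroup.
Set Implicit Arguments.
Unset Strict Implicit.
Unset Printing Implicit Defensive.

Record sgraph (n : nat) := SGraph {
  adjacent :> rel 'I_n;
  adjacent_sym : symmetric adjacent;
  adjacent_irr : irreflexive adjacent }.

(* Each edge uv is represented once, by the ordered pair with u < v. *)
Definition edges n (G : sgraph n) : {set 'I_n * 'I_n} :=
  [set p : 'I_n * 'I_n | (p.1 < p.2) && G p.1 p.2].

Definition connected n (G : sgraph n) : Prop :=
  0 < n /\ forall u v : 'I_n, connect G u v.

Definition dist (a b : nat) : nat := (a - b) + (b - a).

(* A linear arrangement is a permutation of 'I_n: positions are numbered from
   0 instead of 1, which does not change distances.  Distinct vertices are at
   distance at least 1, so the subtraction below is never truncated. *)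
Definition net_cost n (G : sgraph n) (alpha : 'S_n) : nat :=
  \sum_(p in edges G) (dist (alpha p.1) (alpha p.2) - 1).

Definition ola_plus n (G : sgraph n) : nat :=
  net_cost G [arg min_(alpha < (1%g : 'S_n)) net_cost G alpha].

(* A random access machine with unit-cost addition and truncated subtraction,
   presented as a structured language.  The memory consists of scalar
   registers and of arrays, all named by numbers; a program mentions finitely
   many names, and only array cells can be addressed indirectly. *)
Inductive expr :=
  | Const of nat
  | Reg of nat
  | Read of nat & expr          (* array name, index *)
  | Add of expr & expr
  | Sub of expr & expr.

Inductive cmd :=
  | Skip
  | Assign of nat & expr
  | Write of nat & expr & expr  (* array name, index, value *)
  | Seq of cmd & cmd
  | If of expr & cmd & cmd      (* a nonzero value means true *)
  | While of expr & cmd.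

Record state := State { regs : nat -> nat; arrays : nat -> nat -> nat }.

Definition set_reg (s : state) (x v : nat) : state :=
  State (fun y => if y == x then v else regs s y) (arrays s).

Definition set_cell (s : state) (a i v : nat) : state :=
  State (regs s)
    (fun b j => if (b == a) && (j == i) then v else arrays s b j).

Fixpoint eval (s : state) (e : expr) : nat :=
  match e with
  | Const c => c
  | Reg x => regs s x
  | Read a i => arrays s a (eval s i)
  | Add e1 e2 => eval s e1 + eval s e2
  | Sub e1 e2 => eval s e1 - eval s e2
  end.

Fixpoint expr_cost (e : expr) : nat :=
  match e with
  | Const _ | Reg _ => 1
  | Read _ i => (expr_cost i).+1
  | Add e1 e2 | Sub e1 e2 => (expr_cost e1 + expr_cost e2).+1
  end.

(* [exec c s t s']: started in [s], [c] halts in [s'] after [t] steps. *)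
Inductive exec : cmd -> state -> nat -> state -> Prop :=
  | ExecSkip s :
      exec Skip s 1 s
  | ExecAssign x e s :
      exec (Assign x e) s (expr_cost e).+1 (set_reg s x (eval s e))
  | ExecWrite a i e s :
      exec (Write a i e) s (expr_cost i + expr_cost e).+1
        (set_cell s a (eval s i) (eval s e))
  | ExecSeq c1 c2 s s1 s2 t1 t2 :
      exec c1 s t1 s1 -> exec c2 s1 t2 s2 ->
      exec (Seq c1 c2) s (t1 + t2) s2
  | ExecIfTrue e c1 c2 s s' t :
      eval s e != 0 -> exec c1 s t s' ->
      exec (If e c1 c2) s (expr_cost e + t).+1 s'
  | ExecIfFalse e c1 c2 s s' t :
      eval s e = 0 -> exec c2 s t s' ->
      exec (If e c1 c2) s (expr_cost e + t).+1 s'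
  | ExecWhileTrue e c s s1 s2 t1 t2 :
      eval s e != 0 -> exec c s t1 s1 -> exec (While e c) s1 t2 s2 ->
      exec (While e c) s (expr_cost e + t1 + t2).+1 s2
  | ExecWhileFalse e c s :
      eval s e = 0 -> exec (While e c) s (expr_cost e).+1 s.

Definition adjacency_lists n (G : sgraph n) (L : 'I_n -> seq 'I_n) : Prop :=
  forall v, uniq (L v) /\ forall u, (u \in L v) = G v u.

Definition list_table n (L : 'I_n -> seq 'I_n) : seq (seq nat) :=
  [seq [seq val u | u <- L v] | v <- enum 'I_n].

(* Register 0 holds the number of vertices and register 1 the parameter.
   Array 1 holds the concatenation of the adjacency lists; the list of v
   occupies the cells from [array 0 at v] (included) to [array 0 at v.+1]
   (excluded).  The rest of the memory is zero. *)
Definition input_state (k n : nat) (L : 'I_n -> seq 'I_n) : state :=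
  State
    (fun x => match x with 0 => n | 1 => k | _ => 0 end)
    (fun a i => match a with
       | 0 => if i <= n then sumn (take i (shape (list_table L))) else 0
       | 1 => nth 0 (flatten (list_table L)) i
       | _ => 0
       end).

(* The answer is read from register 0, a nonzero value meaning "yes".  Correct
   termination is required for every order of the adjacency lists. *)
Definition decides_within (P : cmd) (k n m t : nat) : Prop :=
  forall (G : sgraph n) (L : 'I_n -> seq 'I_n),
    connected G -> #|edges G| = m -> adjacency_lists G L ->
    exists t' s', [/\ exec P (input_state k L) t' s', t' <= t
                    & (regs s' 0 != 0) = (ola_plus G <= k)].

(* Main.v *)
(* The net cost of an arrangement is the number of pairs (edge, vertex strictly
   between its ends).  Let [v] have degree two, with both edges bridges that have
   more than [k] vertices beyond them.  An arrangement of cost at most [k] can be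
   rearranged so that all vertices on one side of [v] come before those on the
   other side, and then [v] can be inserted between the sides at no cost; so
   suppressing [v] does not change the answer.  All such vertices of the input
   graph can be suppressed, since a minimal side with more than [k] vertices
   contains none of them.  When none is left and the cost is at most [k], every
   vertex is among the first or last [k + 1], is passed over by an edge (at most
   [k] vertices), or has two neighbours on one side, the nearer of which is
   passed over (at most [2 k] vertices); and there are at most [n - 1 + k] edges.

   The machine finds these vertices with a breadth-first tree.  The tree edge
   above [c] is a bridge iff no other edge leaves the subtree of [c].  To test
   this, every direction of every non-tree edge gets its own power of two (the
   numbers are unbounded and addition has unit cost), and one compares the sums
   of the weights leaving and entering the vertices of the subtree.  A table
   indexed by [v * n + w] gives the position of [w] in the list of [v], so that
   a suppression takes constant time.  Finally [P] runs on a part of the memory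
   which has not been touched. *)
Require Import Defs.
From mathcomp Require Import all_boot all_fingroup.
From mathcomp Require Import zify.
Set Implicit Arguments.
Unset Strict Implicit.
Unset Printing Implicit Defensive.

(** * Suppression of vertices *)

(** The set [S] of suppressible vertices is computed once, on the input graph, and its members are
    then removed one after the other without a new test. Three facts justify this. A suppression
    keeps the degrees of the two neighbours, so the other members of [S] still split the graph in
    two. The sides are measured outside [S], by [k < #|X :\: S|], hence by vertices that no
    suppression deletes. And a vertex suppressible after a suppression was already suppressible
    before it, so nothing is left to suppress once [S] is exhausted. The preservation of degrees
    also lets the machine edit the adjacency lists in place: entries change, offsets do not. The
    counting arguments are written as injections between sets of triples (end, vertex passed over,
    end) rather than as manipulations of sums of lengths. *)

Section Passings.
Variable T : finType.
Implicit Types (e : rel T) (A X L : {set T}) (p : T -> nat) (k : nat).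

(* Only the order of the positions [p] matters, so they need not be consecutive. *)
Definition passings e A p : {set T * T * T} :=
  [set t | [&& e t.1.1 t.2, t.1.2 \in A, p t.1.1 < p t.1.2 & p t.1.2 < p t.2]].

Definition arrangeable e A k :=
  exists2 p, {in A &, injective p} & #|passings e A p| <= k.

Definition graph_on e A :=
  [/\ symmetric e, irreflexive e & forall a b, e a b -> a \in A].

(** Connectedness in terms of closed sets suits most arguments below: they exhibit a closed set that
    misses a vertex, and need no path. *)
Definition connected_on e A :=
  forall L a, L \subset A -> a \in L -> (forall b c, b \in L -> e b c -> c \in L) -> L = A.

(** The conditions on edges make [v x] and [v y] bridges: [X] is the side of [x], and
    [A :\: (v |: X)] is the side of [y]. *)
Definition splits e A v X x y :=
  [/\ v \in A :\: X, X \subset A, x \in X /\ y \in A :\: X,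
      forall b, e v b = (b == x) || (b == y)
    & forall a b, a \in X -> e a b -> (b \in X) || (b == v)].

Definition suppressible e A k v :=
  exists X x y, [/\ splits e A v X x y, k < #|X| & k < #|A :\: (v |: X)|].

Definition suppress e v x y : rel T := fun a b =>
  [&& a != v, b != v & [|| e a b, (a == x) && (b == y) | (a == y) && (b == x)]].

Lemma in_passings e A p a z b :
  ((a, z, b) \in passings e A p) = [&& e a b, z \in A, p a < p z & p z < p b].
Proof. by rewrite inE. Qed.

Lemma suppressC e v x y : suppress e v x y =2 suppress e v y x.
Proof. by move=> a b; rewrite /suppress [X in e a b || X]orbC. Qed.

Lemma passings_ext e e' A p : e =2 e' -> passings e A p = passings e' A p.
Proof. by move=> Ee; apply/setP=> t; rewrite !inE Ee. Qed.

Lemma splits_sym e A v X x y : graph_on e A -> splits e A v X x y ->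
  splits e A v (A :\: (v |: X)) y x.
Proof.
case=> es ei eA [vAX XA [xX yAX] ev eX].
have yv : y != v by apply: contraFneq (ei v) => E; rewrite ev E eqxx orbT.
have xv : x != v by apply: contraFneq (ei v) => E; rewrite ev E eqxx.
have xA : x \in A by apply: (subsetP XA).
move: vAX yAX; rewrite !inE => /andP[vX vA] /andP[yX yA].
split.
- by rewrite !inE eqxx vA.
- by apply: subsetDl.
- by rewrite !inE (negPf yv) yX yA xA xX orbT.
- by move=> b; rewrite ev orbC.
move=> a b; rewrite !inE negb_or => /andP[/andP[av aX] aA] eab.
have bA : b \in A by apply: (eA b a); rewrite es.
rewrite bA andbT; case: eqP => //= bv; case: (boolP (b \in X)) => //= bX.
have eba : e b a by rewrite es.
by have := eX b a bX eba; rewrite (negPf aX) (negPf av).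
Qed.

Lemma splits_facts e A v X x y : graph_on e A -> splits e A v X x y ->
  [/\ x != v, y != v, x != y, e x y = false & [/\ x \in A, y \in A & v \in A]].
Proof.
case=> es ei eA [vAX XA [xX yAX] ev eX].
have yv : y != v by apply: contraFneq (ei v) => E; rewrite ev E eqxx orbT.
have xv : x != v by apply: contraFneq (ei v) => E; rewrite ev E eqxx.
have xA : x \in A by apply: (subsetP XA).
move: vAX yAX; rewrite !inE => /andP[vX vA] /andP[yX yA].
split=> //; first by apply: contraNneq yX => <-.
by apply: contraNF yX => /(eX _ _ xX); rewrite (negPf yv) orbF.
Qed.

Lemma suppress_graph e A v X x y : graph_on e A -> splits e A v X x y ->
  graph_on (suppress e v x y) (A :\ v).
Proof.
move=> Ge Se; have [xv yv xy exy [xA yA vA]] := splits_facts Ge Se.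
case: Ge => es ei eA; split.
- move=> a b; rewrite /suppress es; case: (a != v); case: (b != v) => //=.
  by rewrite orbC [in RHS]orbC; congr (_ || _); rewrite orbC; congr (_ || _); rewrite andbC.
- move=> a; rewrite /suppress ei; case: (a != v) => //=.
  by case: (eqVneq a x) => [->|] /=; rewrite ?(negPf xy) ?andbF.
- move=> a b; rewrite /suppress !inE => /and3P[-> _ /or3P[/eA //|/andP[/eqP-> _]|/andP[/eqP->
    _]]] //.
Qed.

(** A set closed in the new graph contains both [x] and [y] or neither. In the first case adding [v]
    makes it closed in the old graph; in the second case it is already closed there. *)
Lemma suppress_connected e A v X x y : graph_on e A -> splits e A v X x y ->
  connected_on e A -> connected_on (suppress e v x y) (A :\ v).
Proof.
move=> Ge Se Ce; have [xv yv xy exy [xA yA vA]] := splits_facts Ge Se.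
case: (Ge) => es ei eA; case: (Se) => _ _ _ ev _ L a /subsetP LA aL Lc.
have xyL : (x \in L) = (y \in L).
  apply/idP/idP => h; [apply: (Lc _ _ h)|apply: (Lc _ _ h)];
    by rewrite /suppress xv yv !eqxx ?orbT.
have LA' b : b \in L -> (b != v) && (b \in A) by move/LA; rewrite !inE.
have step b c : b \in L -> e b c -> c != v -> c \in L.
  move=> bL ebc cv; apply: (Lc b) => //; rewrite /suppress cv ebc.
  by case/andP: (LA' _ bL) => ->.
have [xL|xL] := boolP (x \in L).
  have : v |: L = A.
    apply: (Ce _ a); last 1 first.
    - move=> b c; rewrite !inE => /orP[/eqP->|bL].
        by rewrite ev => /orP[]/eqP->; rewrite -?xyL xL orbT.
      by move=> ebc; case: eqP => //= /eqP cv; apply: step ebc cv.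
    - by apply/subsetP=> b; rewrite !inE => /orP[/eqP->//|/LA']; case/andP.
    - by rewrite !inE aL orbT.
  by move=> <-; apply/setP=> b; rewrite !inE; case: eqP => //= ->; apply/negP => /LA';
    rewrite eqxx.
have : L = A.
  apply: (Ce _ a) => //; first by apply/subsetP=> b /LA' /andP[].
  move=> b c bL ebc; case: (eqVneq c v) => [cv|]; last by apply: step ebc.
  move: ebc; rewrite cv es ev => /orP[]/eqP Eb; first by rewrite -Eb bL in xL.
  by rewrite xyL -Eb bL in xL.
by move=> LE; move: vA; rewrite -LE => /LA'; rewrite eqxx.
Qed.

(** A vertex between [x] and [y] lies between [x] and [v] or between [v] and [y], so one of the two
    old edges passes over it. The map [f] is injective because [x y] is not an old edge and each end
    of the new edge determines the other. *)
Lemma suppress_passings e A v X x y p : graph_on e A -> splits e A v X x y ->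
  {in A &, injective p} ->
  #|passings (suppress e v x y) (A :\ v) p| <= #|passings e A p|.
Proof.
move=> Ge Se pI; have [xv yv xy exy [xA yA vA]] := splits_facts Ge Se.
case: (Ge) => es ei eA; case: (Se) => _ _ _ ev _.
have exv : e x v by rewrite es ev eqxx.
have eyv : e y v by rewrite es ev eqxx orbT.
have evx : e v x by rewrite ev eqxx.
have evy : e v y by rewrite ev eqxx orbT.
pose f (t : T * T * T) : T * T * T :=
  if e t.1.1 t.2 then t else
  if p t.1.2 < p v then (t.1.1, t.1.2, v) else (v, t.1.2, t.2).
rewrite -(card_in_imset (f := f)).
  apply/subset_leq_card/subsetP=> _ /imsetP[[[a z] b] + ->].
  rewrite in_passings /suppress /f !in_setD1 /= => /and4P[/and3P[av bv E] /andP[zv zA] az zb].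
  case: ifP => [eab|eab]; first by rewrite in_passings eab zA az zb.
  move: E; rewrite eab /=.
  have pzv : p z != p v by apply: contra_neq zv => /pI ->.
  by case/orP=> /andP[/eqP Ea /eqP Eb]; subst a b; case: ifP => h;
     rewrite in_passings ?exv ?eyv ?evx ?evy zA ?az ?zb ?h //= ltn_neqAle eq_sym pzv leqNgt h.
move=> [[a z] b] [[a' z'] b']; rewrite !in_passings /suppress /f !in_setD1 /=.
move=> /and4P[/and3P[av bv E] _ _ _] /and4P[/and3P[av' bv' E'] _ _ _].
case eab: (e a b) E => /= E; case eab': (e a' b') E' => /= E'; do ?case: ifP => _ //.
- by case=> -> -> ->.
- by case=> _ _ Eb; rewrite Eb eqxx in bv.
- by case=> Ea _ _; rewrite Ea eqxx in av.
- by case=> _ _ Eb; rewrite -Eb eqxx in bv'.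
- by case=> Ea _ _; rewrite -Ea eqxx in av'.
- by case=> Ea Ez; subst; case/orP: E => /andP[/eqP Ex /eqP Ey];
    case/orP: E' => /andP[/eqP Ex' /eqP Ey']; subst => //; rewrite ?eqxx in xy.
- by case=> Ea _ _; rewrite Ea eqxx in av.
- by case=> Ea _ _; rewrite -Ea eqxx in av'.
by case=> Ez Eb; subst; case/orP: E => /andP[/eqP Ex /eqP Ey];
  case/orP: E' => /andP[/eqP Ex' /eqP Ey']; subst => //; rewrite ?eqxx in xy.
Qed.

(** [X] is connected by itself, since it is attached to the rest only by the edge from [x] to [v].
    It therefore cannot have vertices before and after [z] without an edge over [z]. Connectedness
    is applied to the part of [X] that lies beyond [z] as seen from [x]. *)
Lemma side_crossing e A v X x y p z g h : graph_on e A -> connected_on e A ->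
  splits e A v X x y -> {in A :\ v &, injective p} ->
  z \in A :\: (v |: X) -> g \in X -> h \in X -> p g < p z < p h ->
  exists a b, [/\ a \in X, b \in X, e a b & p a < p z < p b].
Proof.
move=> Ge Ce Se pI zY gX hX /andP[gz zh].
have [_ _ _ _ [xA yA vA]] := splits_facts Ge Se.
case: (Ge) => es ei eA; case: (Se) => vAX XA [xX yAX] ev eX.
move: vAX yAX zY; rewrite !inE negb_or => /andP[vX _] /andP[yX _] /andP[/andP[zv zX] zA].
have [|N] := boolP [exists a, exists b, [&& a \in X, b \in X, e a b & p a < p z < p b]].
  by case/existsP=> a /existsP[b /and4P[? ? ? ?]]; exists a, b.
have {}N a b : a \in X -> b \in X -> e a b -> p a < p z < p b -> False.
  move=> aX bX eab ab; case/negP: N; apply/existsP; exists a; apply/existsP; exists b.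
  by rewrite aX bX eab.
have pz a : a \in X -> p a != p z.
  move=> aX; apply: contraNneq zX => /pI <- //; rewrite !inE ?zv //.
  by rewrite (subsetP XA) // andbT; apply: contraNneq vX => <-.
(* Only [x] has a neighbour outside [X], so a subset of [X] that avoids [x] and is closed inside [X]
   is closed in the whole graph. *)
have clos (L : {set T}) : (forall a, a \in L -> a \in X) -> x \notin L ->
    (forall b c, b \in L -> c \in X -> e b c -> c \in L) -> forall a, a \notin L.
  move=> LX xL Lc a; apply/negP=> aL; move: vA.
  rewrite -(Ce L a) //; [by move/LX; rewrite (negPf vX)| |].
    by apply/subsetP=> b /LX; apply: subsetP.
  move=> b c bL ebc; have [cX|/eqP cv] := orP (eX _ _ (LX _ bL) ebc); first exact: Lc ebc.
  move: ebc; rewrite cv es ev => /orP[]/eqP E; first by rewrite -E bL in xL.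
  by rewrite -E LX in yX.
have [xz|xz] := boolP (p x < p z).
  exfalso; apply: (negP (clos [set a in X | p z < p a] _ _ _ h)).
  - by move=> a; rewrite inE => /andP[].
  - by rewrite inE xX; move: (pz _ xX) xz; clear; lia.
  - move=> b c; rewrite !inE => /andP[bX zb] cX ebc; rewrite cX /=.
    have := pz _ cX; have := N c b cX bX; rewrite es ebc; move: zb; clear; lia.
  by rewrite inE hX.
exfalso; apply: (negP (clos [set a in X | p a < p z] _ _ _ g)).
- by move=> a; rewrite inE => /andP[].
- by rewrite inE xX.
- move=> b c; rewrite !inE => /andP[bX zb] cX ebc; rewrite cX /=.
  have := pz _ cX; have := N b c bX cX ebc; move: zb; clear; lia.
by rewrite inE gX.
Qed.

(** The passings of edges away from [v] exist already in the old arrangement. The edge [x v] passes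
    over the [z] in [X] that come after [x]. In the old arrangement such a [z] is passed over by the
    edge [x y] if it precedes [y], and otherwise by an edge of the other side, which has [y] before
    [z] and [y1] after it. These old passings mix the two sides and disappear, so they pay for the
    new ones. The edge [v y] is symmetric, with [x1] in the role of [y1]. *)
Lemma insert_between_sides e A v X x y p : graph_on e A -> connected_on e A ->
  splits e A v X x y -> {in A :\ v &, injective p} ->
  (exists2 x1, x1 \in X & forall z, z \in A :\: (v |: X) -> p x1 < p z) ->
  (exists2 y1, y1 \in A :\: (v |: X) & forall z, z \in X -> p z < p y1) ->
  exists2 p', {in A &, injective p'} &
    #|passings e A p'| <= #|passings (suppress e v x y) (A :\ v) p|.
Proof.
move=> Ge Ce Se pI [x1 x1X x1Y] [y1 y1Y y1X].
have [xv yv xy exy [xA yA vA]] := splits_facts Ge Se.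
have Se' := splits_sym Ge Se.
case: (Ge) => es ei eA; case: (Se) => vAX XA [xX yAX] ev eX.
move: vAX yAX; rewrite !inE => /andP[vX _] /andP[yX _].
have [Y EY] : exists Y, Y = A :\: (v |: X) by exists (A :\: (v |: X)).
rewrite -EY in x1Y y1Y Se' *.
have eY a b : a \in Y -> e a b -> (b \in Y) || (b == v) by case: Se' => _ _ _ _ h /h; apply.
have inY a : (a \in Y) = [&& a != v, a \notin X & a \in A] by rewrite EY !inE negb_or andbA.
have Ycompl : A :\: (v |: Y) = X.
  apply/setP=> a; rewrite in_setD in_setU1 inY; case: (eqVneq a v) => [->|av] /=;
    first by rewrite (negPf vX).
  case: (boolP (a \in A)) => aA; rewrite ?andbT /= ?andbF ?negbK //.
  by apply/esym/negbTE; apply: contraNN aA; apply: subsetP.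
have yY : y \in Y by rewrite inY yv yX.
have [M pM] : exists M, forall a, p a < M.
  by exists (\max_a p a).+1 => a; rewrite ltnS; apply: leq_bigmax.
(* Both sides keep their internal order; [M] exceeds all old positions and becomes the position of
   [v]. *)
pose p' z := if z \in X then p z else if z == v then M else M.+1 + p z.
have p'I : {in A &, injective p'}.
  have kind c : c \in A -> [\/ [/\ c \in X, c \in A :\ v & p' c = p c], c = v /\ p' c = M
      | [/\ c \notin X, c \in A :\ v & p' c = M.+1 + p c]].
    rewrite /p' !inE => ->; case: (boolP (c \in X)) => [cX|cX].
      by apply: Or31; split=> //; rewrite andbT; apply: contraNneq vX => <-.
    by case: (eqVneq c v) => [->|cv]; [apply: Or32|apply: Or33].
  move=> a b /kind[[aX aA ->]|[-> ->]|[aX aA ->]] /kind[[bX bA ->]|[-> ->]|[bX bA ->]] //;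
    move: (pM a) (pM b) (pI a b); try (clear; lia).
    by move=> _ _; apply.
  by move=> _ _ h /addnI; apply: h.
exists p' => //.
set e' := suppress e v x y; set A' := A :\ v.
(* All three vertices on the same side. This holds for the images of passings away from [v] and
   fails for the images of those at [v], which keeps the two kinds of images apart. *)
pose right (t : T * T * T) := ((t.1.1 \in X) == (t.1.2 \in X)) && ((t.2 \in X) == (t.1.2 \in
  X)).
pose f (t : T * T * T) := if (t.1.1 == v) || (t.2 == v) then
   odflt t [pick u in passings e' A' p | (u.1.2 == t.1.2) && ~~ right u] else t.
(* For a given middle vertex there is at most one passing by an edge at [v]. Hence an image chosen
   by its middle vertex alone still gives an injection. *)
have vtype t : t \in passings e A p' -> (t.1.1 == v) || (t.2 == v) ->
    (t == (x, t.1.2, v)) && (t.1.2 \in X) && (p x < p t.1.2) || (t == (v, t.1.2, y)) &&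
      (t.1.2 \in Y) && (p t.1.2 < p y).
  case: t => [[a z] b]; rewrite in_passings /= => /and4P[eab zA az zb] /orP[]/eqP E; subst.
    move: eab; rewrite ev => /orP[]/eqP E; subst.
      by move: az zb; rewrite /p' (negPf vX) eqxx xX; case: ifP => _; have := pM x;
        have := pM z; clear; lia.
    apply/orP; right; rewrite eqxx inY zA andbT /=; move: az zb.
    rewrite /p' (negPf vX) eqxx (negPf yX) (negPf yv).
    case: ifP => zX /=; first by have := pM z; clear; lia.
    by case: ifP => zv; clear; lia.
  move: eab; rewrite es ev => /orP[]/eqP E; subst.
    apply/orP; left; rewrite eqxx /=; move: az zb; rewrite /p' (negPf vX) eqxx xX.
    by case: ifP => zX /=; [clear; lia|case: ifP => zv; clear; lia].
  by move: az zb; rewrite /p' (negPf vX) eqxx (negPf yX) (negPf yv); do ?case: ifP => _;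
    have := pM z; clear; lia.
have fv t : t \in passings e A p' -> (t.1.1 == v) || (t.2 == v) ->
    [/\ f t \in passings e' A' p, (f t).1.2 = t.1.2 & ~~ right (f t)].
  move=> tp tv; rewrite /f tv; case: pickP; last move=> no;
    first by move=> u /and3P[up /eqP Eu ru].
  exfalso.
  have xin z : z \in A' -> p x < p z < p y -> (x, z, y) \in passings e' A' p.
    by move=> zA' xzy; rewrite in_passings /e' /suppress xv yv !eqxx orbT zA'.
  have xin' z : z \in A' -> p y < p z < p x -> (y, z, x) \in passings e' A' p.
    by move=> zA' xzy; rewrite in_passings /e' /suppress xv yv !eqxx !orbT zA'.
  have sub a b : e a b -> a != v -> b != v -> e' a b by move=> eab av bv;
    rewrite /e' /suppress av bv eab.
  have zA' z : z \in A -> (z \in X) || (z \in Y) -> z \in A'.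
    by move=> zA; rewrite !inE zA andbT; case: (eqVneq z v) => [->|//];
      rewrite (negPf vX) inY eqxx.
  have Xv c : c \in X -> c != v by apply: contraTneq => ->.
  have Yv c : c \in Y -> c != v by rewrite inY; case/and3P.
  have YX c : c \in Y -> c \in X = false by rewrite inY => /and3P[_ /negbTE].
  have zA : t.1.2 \in A by move: tp; rewrite inE => /and4P[].
  have V := vtype _ tp tv.
  set z := t.1.2 in zA no V *.
  case/orP: V => [/andP[/andP[_ zX] xz]|/andP[/andP[_ zY] zy]].
  - have zA'z : z \in A' by rewrite zA' ?zX.
    have [zy|] := boolP (p z < p y).
      by have := no (x, z, y); rewrite /right /= (negPf yX) zX eqxx andbF andbT xin // xz zy.
    have pzy : p z != p y by apply: contraTneq zX => /pI -> //; rewrite !inE yv yA.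
    move=> zy; have [a [b [aY bY eab ab]]] : exists a b, [/\ a \in Y, b \in Y, e a b & p a <
      p z < p b].
      apply: (side_crossing Ge Ce Se' pI _ yY y1Y); first by rewrite Ycompl.
      by rewrite y1X // andbT; move: pzy zy; clear; lia.
    have := no (a, z, b);
      rewrite in_passings sub ?Yv // zA'z ab /right /= (YX a) // (YX b) // zX.
    by rewrite eqxx.
  - have zA'z : z \in A' by rewrite zA' ?zY ?orbT.
    have [xz|] := boolP (p x < p z).
      by have := no (x, z, y); rewrite /right /= (negPf yX) xX (YX z) // eqxx xin // xz zy.
    have pzx : p z != p x by apply: contraTneq xX => /pI <- //; rewrite ?YX // !inE xv xA.
    move=> xz; have [a [b [aX bX eab ab]]] : exists a b, [/\ a \in X, b \in X, e a b & p a <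
      p z < p b].
      apply: (side_crossing Ge Ce Se pI _ x1X xX); first by rewrite -EY.
      by rewrite x1Y //=; move: pzx xz; clear; lia.
    by have := no (a, z, b); rewrite in_passings sub ?Xv // zA'z ab /right /= aX (YX z) // eqxx.
have fnv t : t \in passings e A p' -> ~~ ((t.1.1 == v) || (t.2 == v)) ->
    f t = t /\ (t \in passings e' A' p) && right t.
  move=> tp tv; rewrite /f (negPf tv); split=> //; case: t tp tv => [[a z] b].
  rewrite !in_passings /right /= negb_or => /and4P[eab zA az zb] /andP[av bv].
  have := pM a; have := pM b; have := pM z.
  have e'ab : e' a b by rewrite /e' /suppress av bv eab.
  rewrite e'ab /A' !inE zA andbT /=.
  have aA := eA _ _ eab.
  have [aX|aX] := boolP (a \in X).
    have := eX _ _ aX eab; rewrite (negPf bv) orbF => bX; rewrite bX.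
    move: az zb; rewrite /p' aX bX; case: ifP => zX /=.
      by rewrite !(eqxx, andbT) => -> ->; rewrite !andbT => *; apply: contraTneq zX => ->.
    by case: ifP => zv; clear; lia.
  have aY : a \in Y by rewrite inY av aX.
  have := eY _ _ aY eab; rewrite (negPf bv) orbF inY => /and3P[_ bX bA].
  move: az zb; rewrite /p' (negPf aX) (negPf bX) (negPf av) (negPf bv); case: ifP => zX /=;
    first by clear; lia.
  by case: ifP => zv /=; clear; lia.
have fm t : t \in passings e A p' -> (f t).1.2 = t.1.2.
  by move=> tp; have [h|h] := boolP ((t.1.1 == v) || (t.2 == v));
    [case: (fv _ tp h)|case: (fnv _ tp h) => ->].
rewrite -(card_in_imset (f := f)).
  apply/subset_leq_card/subsetP=> _ /imsetP[t tp ->].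
  have [h|h] := boolP ((t.1.1 == v) || (t.2 == v)); first by case: (fv _ tp h).
  by case: (fnv _ tp h) => -> /andP[].
move=> t u tp up E.
have [ht|ht] := boolP ((t.1.1 == v) || (t.2 == v));
  have [hu|hu] := boolP ((u.1.1 == v) || (u.2 == v)).
- have Ez : t.1.2 = u.1.2 by rewrite -fm // E fm.
  have := vtype _ tp ht; have := vtype _ up hu; rewrite -Ez.
  case/orP=> /andP[/andP[/eqP Eu uz] _]; case/orP=> /andP[/andP[/eqP Et tz] _].
  + by rewrite Et Eu.
  + by move: tz; rewrite inY uz andbF.
  + by move: uz; rewrite inY tz andbF.
  + by rewrite Et Eu.
- by case: (fv _ tp ht) => _ _; case: (fnv _ up hu) => <- /andP[_]; rewrite E => ->.
- by case: (fv _ up hu) => _ _; case: (fnv _ tp ht) => <- /andP[_]; rewrite E => ->.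
by case: (fnv _ tp ht) => <- _; case: (fnv _ up hu) => <- _.
Qed.
End Passings.

Section Reduction.
Variable T : finType.
Implicit Types (e : rel T) (A X L S : {set T}) (p : T -> nat) (k : nat).

(** Every vertex of the enclosed side is the middle of some passing, by [side_crossing]. *)
Lemma enclosed_side_passings e A v X x y p x1 x2 : graph_on e A -> connected_on e A ->
  splits e A v X x y -> {in A :\ v &, injective p} -> x1 \in X -> x2 \in X ->
  (forall z, z \in A :\: (v |: X) -> p x1 < p z < p x2) ->
  #|A :\: (v |: X)| <= #|passings (suppress e v x y) (A :\ v) p|.
Proof.
move=> Ge Ce Se pI x1X x2X encl; have [vAX _ _ _ _] := Se.
have Xv c : c \in X -> c != v by apply: contraTneq => ->; move: vAX; rewrite inE => /andP[].
apply: leq_trans (leq_imset_card (fun t : T * T * T => t.1.2) _).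
apply/subset_leq_card/subsetP=> z zY.
have [a [b [aX bX eab ab]]] := side_crossing Ge Ce Se pI zY x1X x2X (encl z zY).
apply/imsetP; exists (a, z, b) => //; rewrite in_passings ab /suppress eab !Xv //.
by move: zY; rewrite !inE negb_or => /andP[/andP[-> _] ->].
Qed.

Lemma splits_compl e A v X x y : splits e A v X x y -> A :\: (v |: (A :\: (v |: X))) = X.
Proof.
case=> vAX XA _ _ _; apply/setP=> a; rewrite !inE; case: (eqVneq a v) => [->|av] /=.
  by move: vAX; rewrite inE => /andP[/negbTE->].
case: (boolP (a \in A)) => aA; rewrite ?andbT ?andbF ?negbK //=.
by apply/esym/negbTE; apply: contraNN aA; apply: subsetP.
Qed.

(** Compare the sides of the first vertex [l] and the last vertex [r]. If they lie on the same side,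
    it encloses the other one, whose more than [k] vertices are all passed over. If not,
    [insert_between_sides] applies to [X] or to the opposite side. *)
Lemma suppress_arrangeable e A v X x y k : graph_on e A -> connected_on e A ->
  splits e A v X x y -> k < #|X| -> k < #|A :\: (v |: X)| ->
  arrangeable (suppress e v x y) (A :\ v) k <-> arrangeable e A k.
Proof.
move=> Ge Ce Se kX kY; split; last first.
  case=> p pI pk; exists p; first by apply: sub_in2 pI => a /setD1P[].
  exact: leq_trans (suppress_passings Ge Se pI) pk.
case=> p pI pk.
have [xv yv xy exy [xA yA vA]] := splits_facts Ge Se.
have Se' := splits_sym Ge Se; have [vAX XA _ _ _] := Se.
have Ycompl := splits_compl Se.
have pk' : #|passings (suppress e v y x) (A :\ v) p| <= k.
  by rewrite (passings_ext _ _ (suppressC e v y x)).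
have xA' : x \in A :\ v by rewrite !inE xv.
have [l lA lmin] := @arg_minnP _ x [in A :\ v] p xA'.
have [r rA rmax] := @arg_maxnP _ x [in A :\ v] p xA'.
have side a : a \in A :\ v -> (a \in X) || (a \in A :\: (v |: X)).
  by rewrite !inE => /andP[/negbTE-> ->]; case: (a \in X).
have disj a : a \in A :\: (v |: X) -> a \notin X by rewrite !inE negb_or => /andP[/andP[]].
have XA' a : a \in X -> a \in A :\ v.
  move=> aX; rewrite !inE (subsetP XA) // andbT; apply: contraTneq aX => ->.
  by move: vAX; rewrite inE => /andP[].
have YA' a : a \in A :\: (v |: X) -> a \in A :\ v.
  by rewrite !inE negb_or => /andP[/andP[-> _] ->].
have lt_neq a b : a \in A :\ v -> b \in A :\ v -> p a <= p b -> a != b -> p a < p b.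
  move=> aA bA; rewrite leq_eqVlt => /orP[/eqP/pI->|] //; by rewrite ?eqxx.
have ne a b : a \in X -> b \in A :\: (v |: X) -> (a != b) * (b != a).
  by move=> aX /disj bX; rewrite (eq_sym b a); split; apply: contraNneq bX => <-.
have ltl z : z \in A :\ v -> l != z -> p l < p z by move=> zA; apply: lt_neq; rewrite ?lmin.
have ltr z : z \in A :\ v -> z != r -> p z < p r by move=> zA; apply: lt_neq => //; apply: rmax.
case/orP: (side _ lA) => lS; case/orP: (side _ rA) => rS.
- have := enclosed_side_passings Ge Ce Se pI lS rS; rewrite leqNgt (leq_ltn_trans pk kY) => H.
  suff: ~~ true by []. by apply: H => z zY;
    rewrite ltl ?ltr ?YA' ?(ne _ _ lS zY) ?(ne _ _ rS zY).
- have [||p' p'I le] := insert_between_sides Ge Ce Se pI.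
  + by exists l => // z zY; rewrite ltl ?YA' ?(ne _ _ lS zY).
  + by exists r => // z zX; rewrite ltr ?XA' ?(ne _ _ zX rS).
  + by exists p' => //; apply: leq_trans le pk.
- have [||p' p'I le] := insert_between_sides Ge Ce Se' pI.
  + by exists l => // z; rewrite Ycompl => zX; rewrite ltl ?XA' ?(ne _ _ zX lS).
  + by rewrite Ycompl; exists r => // z zY; rewrite ltr ?YA' ?(ne _ _ rS zY).
  + by exists p' => //; apply: leq_trans le pk'.
- have := enclosed_side_passings Ge Ce Se' pI lS rS;
    rewrite Ycompl leqNgt (leq_ltn_trans pk' kX) => H.
  suff: ~~ true by []. by apply: H => z zX;
    rewrite ltl ?ltr ?XA' ?(ne _ _ zX lS) ?(ne _ _ zX rS).
Qed.

(** If [w] was adjacent to [v], its neighbour [v] is replaced by the other neighbour of [v], which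
    lies on the same side of [w] as [v] did. *)
Lemma suppress_splits e A v Z x y w X x' y' : graph_on e A -> splits e A v Z x y ->
  splits e A w X x' y' -> w != v ->
  exists x'' y'', splits (suppress e v x y) (A :\ v) w (X :\ v) x'' y''.
Proof.
move=> Ge Se Sw wv; have [xv yv xy exy [xA yA vA]] := splits_facts Ge Se.
have [xw yw xy' exy' [xA' yA' wA]] := splits_facts Ge Sw.
case: (Ge) => es ei eA; case: Se => _ _ _ ev _; case: Sw => wAX XA [x'X y'AX] ew eX.
move: wAX y'AX; rewrite !inE => /andP[wX _] /andP[y'X _].
pose o := if w == x then y else x.
have wxy u : e w v -> (w != x) -> w = y by rewrite es ev => /orP[/eqP->|/eqP//]; rewrite eqxx.
have ewv : e w v = (w == x) || (w == y) by rewrite es ev.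
have evo : e v o by rewrite ev /o; case: ifP; rewrite eqxx ?orbT.
have ov : o != v by rewrite /o; case: ifP.
have ow : e w v -> o != w.
  by rewrite ewv /o; case: (eqVneq w x) => [->|wx] _; rewrite eq_sym.
have oX : e w v -> (o \in X) = (v \in X).
  move=> wv'; apply/idP/idP => h.
    have evo' : e o v by rewrite es.
    by have := eX _ _ h evo'; rewrite eq_sym (negPf wv) orbF.
  by have := eX _ _ h evo; rewrite (negPf (ow wv')) orbF.
have eo b : suppress e v x y w b = (b != v) && (e w b || (e w v && (b == o))).
  rewrite /suppress wv ewv /o /=; congr (_ && (_ || _)).
  by case: (eqVneq w x) => [->|wx] //=; rewrite (negPf xy) orbF.
have nv u : (if u == v then o else u) != v by case: (eqVneq u v).
exists (if x' == v then o else x'), (if y' == v then o else y'); split.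
- by rewrite !inE wv wA (negPf wX) andbF.
- exact: setSD.
- split.
    case: eqP => [E|/eqP x'v]; rewrite !inE ?x'v ?x'X // ov oX -?E ?x'X //.
    by rewrite ew eqxx.
  case: eqP => [E|/eqP y'v]; rewrite !inE ?y'v ?yA' ?(negPf y'X) //.
  have ewv' : e w v by rewrite ew -E eqxx orbT.
  by rewrite ov oX // -E (negPf y'X) /= /o; case: ifP.
- move=> b; rewrite eo ew [e w v]ew.
  case: (eqVneq b v) => [->|bv] /=.
    by rewrite !(eq_sym v) !(negPf (nv _)).
  case: (eqVneq v x') => [E|x'v]; case: (eqVneq v y') => [E'|y'v]; rewrite /= ?andbF ?orbF.
  + by rewrite -E -E' (negPf bv) !orbF orbb.
  + by rewrite -E (negPf bv) /= orbC.
  + by rewrite -E' (negPf bv) orbF.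
  + by [].
move=> a b; rewrite !inE => /andP[av aX] /and3P[_ bv].
rewrite bv /=; case/or3P=> [|/andP[/eqP Ea /eqP Eb]|/andP[/eqP Ea /eqP Eb]]; first exact: eX.
  have eav : e a v by rewrite es ev Ea eqxx.
  have := eX _ _ aX eav; rewrite eq_sym (negPf wv) orbF => vX.
  by apply: (eX v b vX); rewrite ev Eb eqxx orbT.
have eav : e a v by rewrite es ev Ea eqxx orbT.
have := eX _ _ aX eav; rewrite eq_sym (negPf wv) orbF => vX.
by apply: (eX v b vX); rewrite ev Eb eqxx.
Qed.

(** Put [v] back on the new edge. It joins the side [X] as soon as one end of that edge is in [X],
    and it becomes a neighbour of [w] if the new edge was one of the two edges at [w]. No side gets
    smaller. *)
Lemma suppressible_lift e A v Z x y w k : graph_on e A -> splits e A v Z x y ->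
  suppressible (suppress e v x y) (A :\ v) k w -> suppressible e A k w.
Proof.
move=> Ge Se [X [x' [y' [Sw kX kY]]]].
have [xv yv xy exy [xA yA vA]] := splits_facts Ge Se.
have [xw yw xy' exy' [xA' yA' wA']] := splits_facts (suppress_graph Ge Se) Sw.
case: (Ge) => es ei eA; case: Se => _ _ _ ev _; case: Sw => wAX XA [x'X y'AX] ew eX.
set e' := suppress e v x y in ew eX exy'.
have [wv wA] : w != v /\ w \in A by move: wA'; rewrite !inE => /andP[].
have x'v : x' != v by move: xA'; rewrite !inE => /andP[].
have y'v : y' != v by move: yA'; rewrite !inE => /andP[].
have vX : v \notin X by apply/negP=> /(subsetP XA); rewrite !inE eqxx.
move: wAX y'AX; rewrite !inE => /andP[wX _] /andP[y'X _].
have e'xy : e' x y by rewrite /e' /suppress xv yv !eqxx orbT.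
have e'yx : e' y x by rewrite /e' /suppress xv yv !eqxx !orbT.
have sub a b : e a b -> a != v -> b != v -> e' a b by move=> eab av bv;
  rewrite /e' /suppress av bv eab.
pose X' := if (x \in X) || (y \in X) then v |: X else X.
have XX' : X \subset X' by rewrite /X'; case: ifP => // _; apply: subsetUr.
have inX' a : a \in X' -> a != v -> a \in X.
  by rewrite /X'; case: ifP => // _; rewrite !inE => /orP[/eqP->|//]; rewrite eqxx.
have vX' : (v \in X') = (x \in X) || (y \in X).
  by rewrite /X'; case: ifP => h; rewrite ?inE ?eqxx // (negPf vX).
(* [new b] says that the edge from [w] to [b] is the one created by the suppression. *)
pose new b := (w == x) && (b == y) || (w == y) && (b == x).
exists X', (if new x' then v else x'), (if new y' then v else y'); split.
- split.
  + by rewrite inE wA andbT; apply: contraNN wX => /inX'; apply.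
  + apply/subsetP=> a aX'; case: (eqVneq a v) => [->//|av].
    by have := subsetP XA _ (inX' _ aX' av); rewrite !inE => /andP[].
  + split.
      case: ifP => h; last exact: (subsetP XX').
      by rewrite vX'; case/orP: h => /andP[_ /eqP E]; rewrite -E x'X ?orbT.
    case: ifP => h; rewrite inE ?vA ?andbT; last first.
      by move: yA'; rewrite !inE => /andP[_ ->]; rewrite andbT; apply: contraNN y'X => /inX';
        apply.
    by rewrite vX'; case/orP: h => /andP[/eqP E1 /eqP E2];
      rewrite -E1 -E2 (negPf wX) (negPf y'X).
  + move=> b; case: (eqVneq b v) => [->|bv].
      rewrite es ev; apply/orP/orP.
        case=> /eqP E.
          have : e' w y by rewrite E.
          by rewrite ew => /orP[]/eqP E'; [left; have -> : new x' = true|right;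
            have -> : new y' = true] => //; rewrite /new -E' E !eqxx ?orbT.
        have : e' w x by rewrite E.
        by rewrite ew => /orP[]/eqP E'; [left; have -> : new x' = true|right;
          have -> : new y' = true] => //; rewrite /new -E' E !eqxx ?orbT.
      have newP u : v == (if new u then v else u) -> u != v -> new u.
        by case: ifP => // _; rewrite eq_sym => /eqP->; rewrite eqxx.
      by case=> /newP; [move/(_ x'v)|move/(_ y'v)]; case/orP=> /andP[-> _]; auto.
    have -> : e w b = e' w b && ~~ new b.
      rewrite /e' /suppress wv bv /= -/(new b); case N: (new b); rewrite ?orbF ?andbT //= andbF.
      by case/orP: N => /andP[/eqP-> /eqP->]; rewrite // es.
    rewrite ew; case: (eqVneq b x') => [->|bx'] /=.
      case: ifP => h /=; last by rewrite eqxx.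
      rewrite [x' == v](negPf x'v) /=; apply/esym; case: ifP => _; first exact: negbTE.
      exact: negbTE.
    case: (eqVneq b y') => [->|by'] /=.
      have -> : (y' == (if new x' then v else x')) = false.
        by case: ifP => _; apply/negbTE; rewrite // eq_sym.
      by case: ifP => _; rewrite ?eqxx ?(negPf y'v).
    by case: ifP => _; case: ifP => _; rewrite ?(negPf bv) ?(negPf bx') ?(negPf by').
  + move=> a b; case: (eqVneq a v) => [->|av].
      rewrite vX' ev => xyX /orP[]/eqP->.
        case/orP: xyX => h; first by rewrite (subsetP XX').
        by case/orP: (eX _ _ h e'yx) => [/(subsetP XX')->|->] //; rewrite orbT.
      case/orP: xyX => h; last by rewrite (subsetP XX').
      by case/orP: (eX _ _ h e'xy) => [/(subsetP XX')->|->] //; rewrite orbT.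
    move=> /inX'/(_ av) aX eab; case: (eqVneq b v) => [Eb|bv].
      by rewrite Eb vX'; move: eab; rewrite Eb es ev => /orP[]/eqP <-; rewrite aX ?orbT.
    by case/orP: (eX _ _ aX (sub _ _ eab av bv)) => [/(subsetP XX')->|->] //; rewrite orbT.
- exact: leq_trans kX (subset_leq_card XX').
apply: leq_trans kY (subset_leq_card _); apply/subsetP=> a.
rewrite !inE !negb_or => /andP[/andP[aw aX] /andP[av aA]]; rewrite aw aA andbT /=.
by apply: contraNN aX => /inX'; apply.
Qed.

(* A minimal side contains no suppressible vertex: otherwise one of the sides
   of that vertex would be strictly smaller. *)
Lemma side_setD_suppressible e A S k : graph_on e A -> connected_on e A ->
  (forall v, v \in S -> suppressible e A k v) ->
  forall v X x y, splits e A v X x y -> k < #|X| -> k < #|X :\: S|.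
Proof.
move=> Ge Ce HS v X; have [m] := ubnP #|X|; elim: m v X => // m IH v X ltX x y Se kX.
have [disj|] := boolP [disjoint X & S].
  by rewrite (setDidPl disj).
case/pred0Pn=> w /andP[/= wX wS].
case: (Ge) => es ei eA; case: (Se) => vAX XA _ _ eX.
have [vX vA] : v \notin X /\ v \in A by move: vAX; rewrite inE => /andP[].
(* A side of [w] that avoids [v] is properly contained in [X], because [w] itself is in [X]; the
   induction hypothesis then applies to it. *)
suff [X' [x' [y' [Sw kX' vX']]]] : exists X' x' y',
    [/\ splits e A w X' x' y', k < #|X'| & v \notin X'].
  have [wAX' X'A _ _ eX'] := Sw.
  have wX' : w \notin X' by move: wAX'; rewrite inE => /andP[].
  have sub : X' \subset X.
    apply/subsetP=> a aX'; apply: contraT => aX.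
    (* No edge leaves [X' :\: X]: it could enter [X] only from [v], which is not in [X'], and it
       could leave [X'] only towards [w], which is in [X]. Being nonempty, this set would be all of
       [A], yet it misses [v]. *)
    have Q : X' :\: X = A.
      apply: (Ce _ a); first by apply: subset_trans X'A; apply: subsetDl.
        by rewrite inE aX.
      move=> b c; rewrite !inE => /andP[bX bX'] ebc.
      have cX : c \notin X.
        apply: contraNN bX => cX; have ecb : e c b by rewrite es.
        by case/orP: (eX _ _ cX ecb) => // /eqP E; rewrite E (negPf vX') in bX'.
      by rewrite cX; case/orP: (eX' _ _ bX' ebc) => // /eqP E; rewrite E wX in cX.
    by move: vA; rewrite -Q inE (negPf vX') andbF.
  have lt : #|X'| < #|X|.
    by apply: proper_card; apply/properP; split=> //; exists w.
  apply: leq_trans (subset_leq_card (setSD S sub)).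
  by apply: (IH w _ _ x' y') => //; apply: leq_trans lt _.
have [X' [x' [y' [Sw kX' kY']]]] := HS _ wS.
have [vX'|vX'] := boolP (v \in X'); last by exists X', x', y'.
exists (A :\: (w |: X')), y', x'; split=> //; first exact: splits_sym Ge Sw.
by rewrite !inE vX' orbT.
Qed.

Definition forward_edges e p : {set T * T} := [set t | e t.1 t.2 & p t.1 < p t.2].

Lemma handshake e p : symmetric e -> irreflexive e ->
  (forall a b, e a b -> p a = p b -> a = b) ->
  #|[set t : T * T | e t.1 t.2]| = #|forward_edges e p|.*2.
Proof.
move=> es ei pI; set E := [set _ | _].
rewrite -(cardsID [set t | p t.1 < p t.2] E) -addnn; congr (_ + _).
  by apply: eq_card => t; rewrite !inE.
have <- : #|(fun t => (t.2, t.1)) @: forward_edges e p| = #|forward_edges e p|.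
  by apply: card_imset => -[a b] [c d] /= [-> ->].
apply: eq_card => -[a b]; rewrite !inE /= -leqNgt; apply/andP/imsetP.
  case=> ba eab; exists (b, a) => //; rewrite inE /= es eab ltn_neqAle ba andbT.
  by apply/negP=> /eqP E'; move: (eab); rewrite (pI a b eab) ?ei.
by case=> -[c d]; rewrite inE /= => /andP[ecd cd] [-> ->]; rewrite es ecd ltnW.
Qed.

(** All members other than the last one precede it, and the last one has at most [k]
    predecessors. *)
Lemma card_few_below A p k : {in A &, injective p} ->
  #|[set z in A | #|[set a in A | p a < p z]| <= k]| <= k.+1.
Proof.
move=> pI; set Z := [set _ in _ | _].
have [->|[z0 z0Z]] := set_0Vmem Z; first by rewrite cards0.
have [z zZ zmax] := @arg_maxnP _ z0 [in Z] p z0Z.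
rewrite (cardsD1 z) zZ add1n ltnS; move: (zZ); rewrite inE => /andP[zA].
apply: leq_trans; apply/subset_leq_card/subsetP=> a /setD1P[az aZ].
have aA : a \in A by move: aZ; rewrite inE => /andP[].
have az' : p a <= p z by apply: zmax.
by rewrite inE aA ltn_neqAle az' andbT; apply: contra_neq az => /pI ->.
Qed.

Lemma card_few_above A p k : {in A &, injective p} ->
  #|[set z in A | #|[set a in A | p z < p a]| <= k]| <= k.+1.
Proof.
move=> pI; set Z := [set _ in _ | _].
have [->|[z0 z0Z]] := set_0Vmem Z; first by rewrite cards0.
have [z zZ zmin] := @arg_minnP _ z0 [in Z] p z0Z.
rewrite (cardsD1 z) zZ add1n ltnS; move: (zZ); rewrite inE => /andP[zA].
apply: leq_trans; apply/subset_leq_card/subsetP=> a /setD1P[az aZ].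
have aA : a \in A by move: aZ; rewrite inE => /andP[].
by rewrite inE aA ltn_neqAle (zmin _ aZ) andbT; apply: contra_neq az => /pI ->.
Qed.

(** An edge that passes over nothing is determined by its earlier end, which is never the last
    vertex [r]; so there are fewer than [#|A|] such edges. Every other edge is charged to one of its
    passings. *)
Lemma card_forward_edges e A p : graph_on e A -> {in A &, injective p} ->
  A != set0 -> #|forward_edges e p| < #|A| + #|passings e A p|.
Proof.
move=> [es ei eA] pI /set0Pn[a0 a0A].
have [r rA rmax] := @arg_maxnP _ a0 [in A] p a0A.
pose tight (t : T * T) := [forall z in A, ~~ (p t.1 < p z < p t.2)].
rewrite -(cardsID [set t | tight t] (forward_edges e p)) -addSn leq_add //.
  rewrite (cardsD1 r A) rA add1n ltnS.
  rewrite -(card_in_imset (f := fun t => t.1)).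
    apply/subset_leq_card/subsetP=> _ /imsetP[[a b] + ->]; rewrite !inE /=.
    case/andP=> /andP[eab ab] _; rewrite (eA _ _ eab) andbT.
    have bA : b \in A by rewrite (eA b a) // es.
    by apply: contraTneq ab => ->; rewrite -leqNgt; apply: rmax.
  move=> [a b] [c d]; rewrite !inE /= => /andP[/andP[eab ab] tab] /andP[/andP[ecd cd] tcd] E.
  subst c; congr (_, _).
  have bA : b \in A by rewrite (eA b a) // es.
  have dA : d \in A by rewrite (eA d a) // es.
  apply: pI => //; have := forall_inP tab d dA; have := forall_inP tcd b bA.
  by move: ab cd => /=; clear; lia.
pose f (t : T * T * T) := (t.1.1, t.2).
apply: leq_trans (leq_imset_card f _); apply/subset_leq_card/subsetP=> -[a b].
rewrite !inE /= negb_forall => /andP[/existsP[z +] /andP[eab ab]].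
rewrite negb_imply negbK => /andP[zA /= azb].
by apply/imsetP; exists (a, z, b) => //; rewrite in_passings eab zA.
Qed.

Definition dirty e A p : {set T} := (fun t : T * T * T => t.1.2) @: passings e A p.

(* Injective because the edge from an earlier [z] to the chosen neighbour would
   pass over a later [z]. *)
Lemma card_clean_before_dirty e A p : graph_on e A -> {in A &, injective p} ->
  #|[set z in A | z \notin dirty e A p & [exists b in dirty e A p, e z b && (p z < p b)]]|
    <= #|dirty e A p|.
Proof.
move=> Ge pI; set Z := [set _ in _ | _ & _].
pose f z := odflt z [pick b | [&& b \in dirty e A p, e z b & p z < p b]].
have fP z : z \in Z -> [&& f z \in dirty e A p, e z (f z) & p z < p (f z)].
  rewrite inE => /and3P[_ _ /exists_inP[b bD /andP[ezb zb]]]; rewrite /f.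
  by case: pickP => [c //|/(_ b)]; rewrite bD ezb zb.
have cross a z : a \in Z -> z \in Z -> p a < p z -> f a = f z -> False.
  move=> aZ zZ az E; have /and3P[_ ea _] := fP a aZ; have /and3P[_ _ zb] := fP z zZ.
  move: zZ; rewrite inE => /and3P[zA /negP[]]; apply/imsetP; exists (a, z, f a) => //.
  by rewrite in_passings ea zA az E.
rewrite -(card_in_imset (f := f)).
  by apply/subset_leq_card/subsetP=> _ /imsetP[z /fP/and3P[? _ _] ->].
move=> a z aZ zZ E; have [aA zA] : a \in A /\ z \in A.
  by move: aZ zZ; rewrite !inE => /andP[-> _] /andP[-> _].
apply: pI => //; case: (ltngtP (p a) (p z)) => // h; first by case: (cross a z).
by case: (cross z a).
Qed.

(** Reversal carries the bound on clean vertices with a later dirty neighbour over to those with an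
    earlier one. *)
Lemma passings_rev e A p M : symmetric e -> (forall z, p z <= M) ->
  (fun t : T * T * T => (t.2, t.1.2, t.1.1)) @: passings e A (fun z => M - p z) = passings e
    A p.
Proof.
move=> es pM; apply/setP=> -[[a z] b]; rewrite in_passings; apply/imsetP/idP.
  case=> -[[c w] d]; rewrite in_passings => /and4P[ecd wA h1 h2] [-> -> ->].
  by rewrite es ecd wA /=; move: (pM c) (pM w) (pM d) h1 h2; clear; lia.
case/and4P=> eab zA h1 h2; exists (b, z, a) => //; rewrite in_passings es eab zA.
by move: (pM a) (pM z) (pM b) h1 h2; clear; lia.
Qed.

(** A vertex [z] outside the five sets would be suppressible, with the vertices before it as one
    side. Nothing passes over it; it has a neighbour before and one after it by connectedness; and
    it has no second one on either side, since the nearer of the two would be dirty and put [z] into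
    [R] or [L]. The sizes [k + 1], [k + 1], [k], [k], [k] of [F], [B], [R], [L], [D] add up to the
    bound. *)
Lemma irreducible_small e A k : graph_on e A -> connected_on e A ->
  (forall v, ~ suppressible e A k v) -> arrangeable e A k -> #|A| <= 5 * k + 2.
Proof.
move=> Ge Ce irr [p pI pk]; case: (Ge) => es ei eA.
set D := dirty e A p; have Dk : #|D| <= k by apply: leq_trans (leq_imset_card _ _) pk.
have [M pM] : exists M, forall z, p z <= M by exists (\max_z p z) => z; apply: leq_bigmax.
pose p' z := M - p z.
have p'I : {in A &, injective p'}.
  by move=> a b aA bA E; apply: pI => //; move: E (pM a) (pM b); rewrite /p'; clear; lia.
have lt_p' a b : (p' a < p' b) = (p b < p a).
  by move: (pM a) (pM b); rewrite /p'; clear; lia.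
have DE : dirty e A p' = D.
  rewrite /D /dirty -(passings_rev A es pM) -imset_comp; exact: eq_imset.
pose F := [set z in A | #|[set a in A | p a < p z]| <= k].
pose B := [set z in A | #|[set a in A | p z < p a]| <= k].
pose R := [set z in A | z \notin D & [exists b in D, e z b && (p z < p b)]].
pose L := [set z in A | z \notin D & [exists b in D, e z b && (p b < p z)]].
have Fk : #|F| <= k.+1 by apply: card_few_below.
have Bk : #|B| <= k.+1 by apply: card_few_above.
have Rk : #|R| <= k by apply: leq_trans (card_clean_before_dirty Ge pI) Dk.
have Lk : #|L| <= k.
  apply: leq_trans Dk; rewrite -DE; apply: leq_trans (card_clean_before_dirty Ge p'I).
  apply/eq_leq/eq_card => z; rewrite !inE DE; congr [&& _, _ & _].
  by apply: eq_existsb => b; rewrite lt_p'.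
suff sub : A \subset F :|: B :|: R :|: L :|: D.
  apply: leq_trans (subset_leq_card sub) _.
  have U (P Q : {set T}) : #|P :|: Q| <= #|P| + #|Q| by rewrite leq_card_setU.
  move: (U F B) (U (F :|: B) R) (U (F :|: B :|: R) L) (U (F :|: B :|: R :|: L) D) Fk Bk Rk Lk
    Dk.
  by clear; lia.
apply/subsetP=> z zA; apply: contraT; rewrite !in_setU !negb_or.
case/andP=> /andP[/andP[/andP[zF zB] zR] zL] zD.
move: zF zB zR zL; rewrite !in_set zA zD /= -!ltnNge !negb_exists => lowk highk /forallP zR
  /forallP zL.
case: (irr z).
pose X := [set a in A | p a < p z]; pose Y := [set a in A | p z < p a].
have YE : A :\: (z |: X) = Y.
  apply/setP=> a; rewrite !inE; case: (boolP (a \in A)); rewrite ?andbF // !andbT => aA.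
  case: (eqVneq a z) => [->|az] /=; first by rewrite ltnn.
  by rewrite -leqNgt ltn_neqAle eq_sym; have -> : p a != p z by apply: contra_neq az => /pI ->.
have clean a b : e a b -> p a < p z -> p z < p b -> False.
  move=> eab az zb; case/negP: zD; apply/imsetP; exists (a, z, b) => //.
  by rewrite in_passings eab zA az.
have uniqR b c : e z b -> e z c -> p z < p b -> p b < p c -> False.
  move=> ezb ezc zb bc; have /negP[] := zR b; rewrite ezb zb !andbT.
  apply/imsetP; exists (z, b, c) => //; rewrite in_passings ezc zb bc /=.
  by rewrite (eA b z) // es.
have uniqL b c : e z b -> e z c -> p b < p z -> p c < p b -> False.
  move=> ezb ezc zb bc; have /negP[] := zL b; rewrite ezb zb !andbT.
  apply/imsetP; exists (c, b, z) => //; rewrite in_passings es ezc zb bc /=.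
  by rewrite (eA b z) // es.
(* Only [z] can be reached from [Q] by an edge leaving it; without an edge from [z] to [Q], the set
   would be closed, hence equal to [A]. *)
have escape (Q : {set T}) : Q \subset A -> z \notin Q -> 0 < #|Q| ->
   (forall b c, b \in Q -> e b c -> (c \in Q) || (c == z)) -> exists2 x, x \in Q & e z x.
  move=> QA zQ /card_gt0P[q qQ] Qc.
  case: (boolP [exists x in Q, e z x]) => [/exists_inP[x xQ ezx]|no]; first by exists x.
  have : Q = A.
    apply: (Ce _ q) => // b c bQ ebc; case/orP: (Qc _ _ bQ ebc) => // /eqP cz.
    by case/exists_inP: no; exists b; rewrite // es -cz.
  by move=> QE; rewrite QE zA in zQ.
have nbr a b : e a b -> b \in A by move=> eab; apply: (eA b a); rewrite es.
have trich b : e z b -> (p b < p z) || (p z < p b).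
  move=> ezb; have : p b != p z by apply: contraTneq (ezb) => /pI E; rewrite E ?ei // (nbr z).
  by rewrite neq_ltn.
have [x] : exists2 x, x \in X & e z x.
  apply: escape; rewrite ?inE ?ltnn ?andbF //; first by apply/subsetP=> a;
    rewrite inE => /andP[].
    exact: leq_ltn_trans lowk.
  move=> b c; rewrite !inE => /andP[bA bz] ebc; rewrite (nbr _ _ ebc) /=.
  case: (ltngtP (p c) (p z)) => // [zc|/pI->]; rewrite ?eqxx ?(nbr _ _ ebc) //.
  by case: (clean b c).
rewrite inE => /andP[xA xz] ezx.
have [y] : exists2 y, y \in Y & e z y.
  apply: escape; rewrite ?inE ?ltnn ?andbF //; first by apply/subsetP=> a;
    rewrite inE => /andP[].
    exact: leq_ltn_trans highk.
  move=> b c; rewrite !inE => /andP[bA bz] ebc; rewrite (nbr _ _ ebc) /=.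
  case: (ltngtP (p c) (p z)) => // [cz|/pI->]; rewrite ?eqxx ?(nbr _ _ ebc) //.
  by case: (clean c b) => //; rewrite es.
rewrite inE => /andP[yA zy] ezy.
exists X, x, y; rewrite YE; split=> //; split.
- by rewrite !inE ltnn zA.
- by apply/subsetP=> a; rewrite inE => /andP[].
- by rewrite !inE xA xz yA andbT -leqNgt ltnW.
- move=> b; apply/idP/orP; last by case=> /eqP->.
  move=> ezb; have bA := nbr _ _ ezb; case/orP: (trich _ ezb) => h; [left|right];
    apply/eqP/pI => //.
    by case: (ltngtP (p b) (p x)) => // h'; [case: (uniqL x b)|case: (uniqL b x)].
  by case: (ltngtP (p b) (p y)) => // h'; [case: (uniqR b y)|case: (uniqR y b)].
move=> a b; rewrite !inE => /andP[aA az] eab; rewrite (nbr _ _ eab) /=.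
case: (ltngtP (p b) (p z)) => // [zb|/pI->]; rewrite ?eqxx ?(nbr _ _ eab) //.
by case: (clean a b).
Qed.

(** Invariant of the successive suppressions, where [S] is meant to be the set of suppressible
    vertices of [e0]. Counting the sides outside [S] makes their bounds stable, and the last clause
    shows that nothing is suppressible once [A] is disjoint from [S]. *)
Definition reduct e0 k S e A :=
  [/\ graph_on e A /\ connected_on e A, ~: S \subset A,
      forall v, v \in A :&: S -> exists X x y,
        [/\ splits e A v X x y, k < #|X :\: S| & k < #|A :\: (v |: X) :\: S|],
      arrangeable e A k <-> arrangeable e0 setT k
    & forall v, suppressible e A k v -> v \in S].

Lemma reduct_init e k S : graph_on e setT -> connected_on e setT ->
  (forall v, v \in S <-> suppressible e setT k v) -> reduct e k S e setT.
Proof.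
move=> Ge Ce HS; split=> // [v|v /HS //];
  rewrite in_setI in_setT /= => /HS[X [x [y [Sv kX kY]]]].
exists X, x, y; split=> //.
  by apply: (side_setD_suppressible Ge Ce _ Sv kX) => w /HS.
by apply: (side_setD_suppressible Ge Ce _ (splits_sym Ge Sv) kY) => w /HS.
Qed.

Lemma reduct_step e0 k S e A v a b : reduct e0 k S e A -> v \in A :&: S ->
  e v a -> e v b -> a != b -> reduct e0 k S (suppress e v a b) (A :\ v).
Proof.
move=> [[Ge Ce] KA HS eqA irr] vAS eva evb ab.
(* The neighbours [a] and [b] come in the order of an adjacency list; if [a] is on the far side, the
   two sides are exchanged. *)
have [X [x [y [Se kX kY [-> ->]]]]] : exists X x y,
    [/\ splits e A v X x y, k < #|X :\: S|, k < #|A :\: (v |: X) :\: S| & a = x /\ b = y].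
  have [X [x [y [Se kX kY]]]] := HS v vAS; have [_ _ _ ev _] := Se.
  move: eva evb ab; rewrite !ev => /orP[]/eqP-> /orP[]/eqP->; rewrite ?eqxx // => _.
    by exists X, x, y.
  exists (A :\: (v |: X)), y, x; split=> //; first exact: splits_sym Ge Se.
  by rewrite (splits_compl Se).
have [vA vS] : v \in A /\ v \in S by move: vAS; rewrite inE => /andP[].
have le (Q : {set T}) : #|Q :\: S| <= #|Q| by apply/subset_leq_card/subsetDl.
split.
- by split; [apply: suppress_graph Ge Se|apply: suppress_connected Ge Se Ce].
- by apply/subsetP=> w wS; rewrite !inE (subsetP KA) // andbT; apply: contraTneq wS => ->;
    rewrite inE vS.
- move=> w; rewrite !inE => /andP[/andP[wv wA] wS].
  have [|X' [x' [y' [Sw kX' kY']]]] := HS w; first by rewrite inE wA.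
  have [x'' [y'' Sw']] := suppress_splits Ge Se Sw wv.
  exists (X' :\ v), x'', y''; split=> //.
    apply: leq_trans kX' (subset_leq_card _); apply/subsetP=> c; rewrite !inE => /andP[cS ->].
    by rewrite cS andbT; apply: contraNneq cS => ->.
  apply: leq_trans kY' (subset_leq_card _); apply/subsetP=> c.
  rewrite !inE !negb_or => /andP[cS /andP[/andP[cw cX] cA]];
    rewrite cS cw cA (negPf cX) andbF !andbT /=.
  by apply: contraNneq cS => ->.
- rewrite -eqA; apply: (suppress_arrangeable Ge Ce Se);
    [exact: leq_trans kX (le _)|exact: leq_trans kY (le _)].
by move=> w /(suppressible_lift Ge Se); apply: irr.
Qed.

Lemma reduct_small e0 k S e A : reduct e0 k S e A -> [disjoint A & S] ->
  arrangeable e A k -> #|A| <= 5 * k + 2.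
Proof.
move=> [[Ge Ce] _ _ _ irr] /disjointFr AS; apply: irreducible_small => // v Sv.
have vS := irr v Sv; case: Sv => X [x [y [[vA _ _ _ _] _ _]]].
by move: vA; rewrite inE => /andP[_ /AS]; rewrite vS.
Qed.
End Reduction.

(** * Net cost of a linear arrangement *)

Lemma card_ord_between n a b : b <= n -> #|[set i : 'I_n | a < i < b]| = b - a - 1.
Proof.
move=> bn; rewrite -sum1_card big_mkcond /=.
under eq_bigr => i _ do rewrite inE.
have -> : forall m, \sum_(i < m) (if a < i < b then 1 else 0) = minn b m - a - 1.
  elim=> [|m IH]; first by rewrite big_ord0; clear; lia.
  by rewrite big_ord_recr /= IH; case: ifP; clear; lia.
by move: bn; clear; lia.
Qed.

Lemma card_perm_between n (alpha : 'S_n) a b : b <= n ->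
  #|[set z | a < alpha z < b]| = b - a - 1.
Proof.
move=> bn; rewrite -(card_ord_between a bn) -(card_imset _ (@perm_inj _ alpha)).
apply: eq_card => i; rewrite inE; apply/imsetP/idP => [[z + ->]|ib]; first by rewrite inE.
by exists (alpha^-1%g i); rewrite ?inE permKV.
Qed.

(** [key] sends a passing to its edge, with the smaller vertex first as in [edges]. The fibre over
    an edge consists of the vertices strictly between its ends, one fewer than their distance. *)
Lemma net_cost_passings n (G : sgraph n) (alpha : 'S_n) :
  net_cost G alpha = #|passings G setT (fun z => alpha z)|.
Proof.
pose key (t : 'I_n * 'I_n * 'I_n) := if t.1.1 < t.2 then (t.1.1, t.2) else (t.2, t.1.1).
rewrite -sum1_card (partition_big key (mem (edges G))) /=; last first.
  move=> [[a z] b]; rewrite in_passings /key /= !inE => /and3P[Gab _ _].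
  case: (ltngtP a b) => /= [->|->|/ord_inj E] //; first by rewrite adjacent_sym.
  by rewrite E adjacent_irr in Gab.
apply: eq_bigr => -[u v]; rewrite inE /= => /andP[uv Guv].
rewrite sum1_card; set p := fun z => val (alpha z).
have puv : p u != p v.
  by apply: contraTneq uv => /ord_inj/perm_inj->; rewrite ltnn.
pose f (z : 'I_n) : 'I_n * 'I_n * 'I_n := if p u < p v then (u, z, v) else (v, z, u).
have fI : injective f by move=> z z'; rewrite /f; case: ifP => _ [].
have keyE a z b : (key (a, z, b) == (u, v)) = ((a, b) == (u, v)) || ((a, b) == (v, u)).
  rewrite /key /=; move: uv; case: ifP; rewrite !xpair_eqE -!val_eqE /=; clear; lia.
have -> : dist (alpha u) (alpha v) - 1 =
    #|[set z | minn (p u) (p v) < alpha z < maxn (p u) (p v)]|.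
  rewrite card_perm_between; last by rewrite geq_max !(ltnW (ltn_ord _)).
  by rewrite /dist /p /=; clear; lia.
rewrite -(card_imset _ fI); apply/esym/eq_card => -[[a z] b]; 
transitivity (((a, z, b) \in passings G setT p) && (key (a, z, b) == (u, v))); first by [].
rewrite keyE in_passings in_setT /=.
apply/idP/imsetP => [|[w]].
  case/andP=> /and3P[Gab h1 h2] /orP[]/eqP[Ea Eb]; subst; exists z; rewrite ?inE /f -!/(p _);
  move: h1 h2; rewrite -!/(p _) => h1 h2; have h := ltn_trans h1 h2.
  - by rewrite (minn_idPl (ltnW h)) (maxn_idPr (ltnW h)) h1.
  - by rewrite h.
  - by rewrite (minn_idPr (ltnW h)) (maxn_idPl (ltnW h)) h1.
  - by rewrite ltnNge (ltnW h).
rewrite inE -/(p w) /f; case: (ltngtP (p u) (p v)) puv => // h _ /andP[h1 h2] [-> -> ->];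
  by rewrite ?[G v u]adjacent_sym Guv eqxx ?orbT andbT -!/(p _) h1 h2.
Qed.

(** Replacing each position by its rank, the number of vertices below it, turns an injective [p]
    into a permutation with the same order and hence the same passings. *)
Lemma ola_plus_arrangeable n (G : sgraph n) k :
  (ola_plus G <= k) <-> arrangeable G setT k.
Proof.
rewrite /ola_plus; case: arg_minnP => // alpha _ min; split.
  rewrite net_cost_passings => h; exists (fun z => val (alpha z)) => // a b _ _.
  by move/ord_inj/perm_inj.
case=> p pI pk.
have rlt z : #|[set a | p a < p z]| < n.
  rewrite -[n in _ < n]card_ord -cardsT; apply: proper_card; apply/properP; split=> //.
  by exists z; rewrite ?inE ?ltnn.
pose r z := Ordinal (rlt z).
have rE a b : (r a < r b) = (p a < p b).
  rewrite /r /=; apply/idP/idP => h.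
    rewrite ltnNge; apply: contraTN h => h; rewrite -leqNgt; apply/subset_leq_card.
    by apply/subsetP=> c; rewrite !inE => h'; apply: leq_trans h' h.
  apply: proper_card; apply/properP; split; last by exists a; rewrite ?inE ?ltnn.
  by apply/subsetP=> c; rewrite !inE => h'; apply: ltn_trans h' h.
have rI : injective r.
  move=> a b E; apply: pI; rewrite ?inE //.
  have := rE a b; have := rE b a; rewrite E ltnn; case: ltngtP => //.
apply: leq_trans (min (perm rI) isT) _; rewrite net_cost_passings.
apply: leq_trans pk; apply/eq_leq/eq_card => t.
by rewrite !inE !permE !rE.
Qed.

Lemma arrangeable_imset (T T' : finType) (g : T' -> T) (e : rel T) A k :
  injective g -> graph_on e A -> A = g @: setT ->
  arrangeable (fun u v => e (g u) (g v)) setT k <-> arrangeable e A k.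
Proof.
move=> gI [es _ eA] AE.
have inA a : a \in A -> exists u, a = g u by rewrite AE => /imsetP[u _ ->]; exists u.
have gA u : g u \in A by rewrite AE; apply: imset_f.
have card p : #|passings e A p| = #|passings (fun u v => e (g u) (g v)) setT (p \o g)|.
  pose f (t : T' * T' * T') := (g t.1.1, g t.1.2, g t.2).
  have fI : injective f by move=> [[a b] c] [[a' b'] c'] [/gI-> /gI-> /gI->].
  rewrite -[RHS](card_imset _ fI); apply: eq_card => -[[a z] b].
  apply/idP/imsetP => [|[[[u w] v]]].
    rewrite in_passings => /and4P[eab zA az zb].
    have [u Ea] := inA _ (eA _ _ eab); have [w Ez] := inA _ zA.
    have [|v Eb] := inA b; first by apply: (eA b a); rewrite es.
    by exists (u, w, v); rewrite ?in_passings /f /= -?Ea -?Ez -?Eb ?eab ?inE ?az.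
  by rewrite !in_passings /= => /and4P[euv _ h1 h2] [-> -> ->]; rewrite euv gA h1.
split=> -[p pI pk]; last first.
  exists (p \o g); first by move=> u v _ _ /= /pI/gI->.
  by rewrite -card.
pose q a := odflt 0 (omap p [pick u | g u == a]).
have qg : q \o g =1 p.
  move=> u; rewrite /q /=; case: pickP => [v /eqP/gI-> //|/(_ u)]; by rewrite eqxx.
exists q.
  move=> a b /inA[u ->] /inA[v ->] E; congr g; apply: pI; rewrite ?inE //.
  by rewrite -!qg.
rewrite card; apply: leq_trans pk; apply/eq_leq/eq_card => t.
by rewrite !inE !qg.
Qed.

Lemma card_edges n (G : sgraph n) :
  #|[set t : 'I_n * 'I_n | G t.1 t.2]| = #|edges G|.*2.
Proof.
rewrite (@handshake _ G val (@adjacent_sym _ G) (@adjacent_irr _ G)).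
  by congr _.*2; apply: eq_card => t; rewrite !inE andbC.
by move=> a b _ /ord_inj.
Qed.

Lemma connected_onP n (G : sgraph n) : connected G -> connected_on G setT.
Proof.
case=> _ C L a _ aL Lc; apply/setP=> b; rewrite inE; have/connectP[q Gq ->] := C a b.
elim: q a aL Gq => //= c q IH a aL /andP[Gac Gq]; apply: IH Gq.
exact: Lc Gac.
Qed.

Lemma sgraph_graph_on n (G : sgraph n) : graph_on G setT.
Proof. by split; [apply: adjacent_sym|apply: adjacent_irr|]. Qed.

(** * Bridges and rooted trees *)

(** Expresses the bound on the far side through the near one, a quantity the machine knows as a
    subtree size. *)
Lemma ltn_card_side n (v : 'I_n) (X : {set 'I_n}) k : v \notin X ->
  (k < #|setT :\: (v |: X)|) = (#|X| + k + 1 < n).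
Proof.
move=> vX; have := cardsC (v |: X); rewrite cardsU1 vX card_ord setTD.
by move: #|~: _| #|X| => P Q <-; rewrite add1n; clear; lia.
Qed.

Section RootedTree.
Variables (n : nat) (G : sgraph n) (r : 'I_n) (par : 'I_n -> 'I_n) (pos : 'I_n -> nat).
Hypothesis par_root : par r = r.
Hypothesis par_adj : forall v, v != r -> G v (par v).
Hypothesis par_pos : forall v, v != r -> pos (par v) < pos v.
Implicit Types (c v x : 'I_n) (k : nat).

(** The subtree below [c]: as [par] fixes the root, iterating it from [x] runs through the ancestors
    of [x]. *)
Definition desc c : {set 'I_n} := [set x | fconnect par x c].

Lemma descE c x : (x \in desc c) = (x == c) || (x != r) && (par x \in desc c).
Proof.
rewrite !inE; apply/idP/orP.
  move=> xc; rewrite -(iter_findex xc); case: (findex _ _ _) => [|i]; first by left.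
  case: (eqVneq x r) => [->|xr]; last by right; rewrite iterSr fconnect_iter.
  by left; elim: (i.+1) => //= m /eqP<-; rewrite par_root.
case=> [/eqP->|/andP[_]]; first exact: connect0.
by apply: connect_trans; apply: fconnect1.
Qed.

Lemma desc_self c : c \in desc c. Proof. by rewrite descE eqxx. Qed.

Lemma desc_pos c x : x \in desc c -> x != c -> pos c < pos x.
Proof.
have [m] := ubnP (pos x); elim: m x => // m IH x lt.
rewrite descE => /orP[/eqP->|/andP[xr xc] _]; first by rewrite eqxx.
have px := par_pos xr; case: (eqVneq (par x) c) => [<-//|pc].
by apply: ltn_trans (px); apply: IH => //; apply: leq_trans px _.
Qed.

Lemma parent_notin_desc v : v != r -> par v \notin desc v.
Proof.
move=> vr; apply/negP=> /desc_pos h; have := par_pos vr.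
case: (eqVneq (par v) v) => [->|/h h']; first by rewrite ltnn.
by rewrite ltnNge ltnW.
Qed.

Lemma child_neq_root v c : G v c -> par c = v -> c != r.
Proof. by move=> Gvc pc; apply: contraTneq Gvc => E; rewrite -pc E par_root adjacent_irr. Qed.

(** Each proper descendant of [v] lies below exactly one child of [v]; this is [count], by induction
    on the position. The rest is an exchange of sums. *)
Lemma sum_desc (f : 'I_n -> nat) v :
  \sum_(x in desc v) f x = f v + \sum_(u | (u != r) && (par u == v)) \sum_(x in desc u) f x.
Proof.
have count x : \sum_(u | (u != r) && (par u == v)) (x \in desc u) = (x \in desc v) && (x != v).
  have [m] := ubnP (pos x); elim: m x => // m IH x lt.
  have [->|xr] := eqVneq x r.
    rewrite descE eqxx /= orbF andbN big1 // => u /andP[ur _].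
    by rewrite descE eq_sym (negPf ur) eqxx.
  transitivity (\sum_(u | (u != r) && (par u == v)) ((x == u) + (par x \in desc u))).
    apply: eq_bigr => u _; rewrite descE xr /=; case: eqP => //= xu.
    by rewrite -xu (negPf (parent_notin_desc xr)).
  rewrite big_split /= IH; last by apply: leq_trans (par_pos xr) _.
  have -> : \sum_(u | (u != r) && (par u == v)) (x == u) = (par x == v).
    rewrite (big_mkcond) /= (bigD1 x) //= xr eqxx /= big1 ?addn0; first by case: eqP.
    by move=> u ux; rewrite (eq_sym x u) (negPf ux) if_same.
  rewrite [in RHS]descE xr /=; case: (eqVneq x v) => [<-|xv] /=.
    by rewrite (negPf (parent_notin_desc xr)) addn0; case: eqP (par_pos xr) => // ->;
      rewrite ltnn.
  by rewrite andbT; case: eqP => [->|] /=; rewrite ?desc_self ?andbT.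
under [in RHS]eq_bigr => u _ do rewrite big_mkcond /=.
rewrite exchange_big /= (bigD1 v) ?desc_self //=; congr (_ + _).
rewrite big_mkcond /=; apply: eq_bigr => x _.
transitivity (((x \in desc v) && (x != v)) * f x); first by case: (_ && _); rewrite ?mul1n.
rewrite -count big_distrl /=; apply: eq_bigr => u _; by case: (_ \in _); rewrite ?mul1n.
Qed.

Definition nontree v w := [&& G v w, par v != w & par w != v].

(** The edge from [c] to its parent is the only tree edge leaving the subtree, so any other edge
    that leaves it is a non-tree edge. *)
Lemma nontree_uncrossed c : c != r ->
  (forall a b, nontree a b -> (a \in desc c) = (b \in desc c)) <->
  (forall a b, a \in desc c -> b \notin desc c -> G a b -> a = c /\ b = par c).
Proof.
move=> cr; split=> h a b; last first.
  case/and3P=> Gab pa pb; have Gba : G b a by rewrite adjacent_sym.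
  apply/idP/idP => [ac|bc]; apply: contraT => nc.
    by have [E E'] := h a b ac nc Gab; rewrite E E' eqxx in pa.
  by have [E E'] := h b a bc nc Gba; rewrite E E' eqxx in pb.
move=> ac bc Gab.
have ab : a != b by apply: contraTneq Gab => ->; rewrite adjacent_irr.
have [pa|pa] := eqVneq (par a) b.
  have ar : a != r by apply: contraNneq ab => E; rewrite -pa E par_root.
  by move: (ac); rewrite descE ar pa (negPf bc) /= orbF => /eqP E; rewrite -E.
have [pb|pb] := eqVneq (par b) a.
  have br : b != r by apply: contraNneq ab => E; rewrite -pb E par_root.
  by move: bc; rewrite descE br pb ac orbT.
by move: bc; rewrite -(h a b) ?ac // /nontree Gab pa.
Qed.

(** Of the two sides of [v], take the one without the root. A parent can leave it only by being [v],
    and only the neighbour [x] of [v] in this side can have [v] as parent. So the side is the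
    subtree below [x], and [x] is a child of [v]. *)
Lemma suppressible_child k v : suppressible G setT k v <->
  exists c d, [/\ forall b, G v b = (b == c) || (b == d), c != d, par c = v,
    forall a b, nontree a b -> (a \in desc c) = (b \in desc c)
    & k < #|desc c| /\ #|desc c| + k + 1 < n].
Proof.
have GG := sgraph_graph_on G; split; last first.
  case=> c [d [Gv cd pc uncr [kc cn]]].
  have Gvc : G v c by rewrite Gv eqxx.
  have cr := child_neq_root Gvc pc; move/(nontree_uncrossed cr): uncr; rewrite pc => uncr.
  have vD : v \notin desc c by rewrite -pc; apply: parent_notin_desc.
  have dD : d \notin desc c.
    apply: contraNN cd => dD; have [] := uncr d v dD vD; last by move=> ->.
    by rewrite adjacent_sym Gv eqxx orbT.
  exists (desc c), c, d; split=> //.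
    split; rewrite ?in_setD ?in_setT ?vD ?desc_self //.
    + by rewrite dD.
    + move=> a b aD Gab; case: (boolP (b \in desc c)) => //= bD.
      by have [_ ->] := uncr a b aD bD Gab; rewrite eqxx.
  by rewrite ltn_card_side.
case=> X0 [x0 [y0 [Sv0 kX0 kY0]]].
have [X [x [y [Sv kX kY rX]]]] : exists X x y,
   [/\ splits G setT v X x y, k < #|X|, k < #|setT :\: (v |: X)| & r \notin X].
  have [rX|rX] := boolP (r \in X0); last by exists X0, x0, y0.
  exists (setT :\: (v |: X0)), y0, x0; split=> //; first exact: splits_sym GG Sv0.
    by rewrite (splits_compl Sv0).
  by rewrite !inE rX orbT.
have [xv yv xy _ _] := splits_facts GG Sv.
case: Sv => vAX _ [xX yAX] ev eX.
move: vAX yAX; rewrite !inE !andbT => vX yX.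
have ne_r z : z \in X -> z != r by apply: contraTneq => ->.
have parX z : z \in X -> (par z \in X) || (par z == v).
  by move=> zX; apply: (eX z) => //; apply: par_adj; apply: ne_r.
have parv z : z \in X -> par z = v -> z = x.
  move=> zX pz; have : G v z by rewrite -pz adjacent_sym par_adj ?ne_r.
  by rewrite ev => /orP[]/eqP // E; rewrite -E zX in yX.
(* The parent of the vertex of least position in [X] is not in [X], so it is [v], and that vertex is
   [x]. *)
have px : par x = v.
  have [z zX zmin] := @arg_minnP _ x [in X] pos xX.
  have := parX z zX; case: (boolP (par z \in X)) => [pX|_ /eqP pz]; last by rewrite -(parv z).
  by have := zmin _ pX; rewrite leqNgt par_pos ?ne_r.
have xr : x != r := ne_r _ xX.
have XD : X = desc x.
  apply/setP=> z; have [m] := ubnP (pos z); elim: m z => // m IH z lt.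
  rewrite descE; apply/idP/orP => [zX|[/eqP->//|/andP[zr pz]]].
    case/orP: (parX z zX) => [pX|/eqP/parv->//]; [right|by left].
    by rewrite ne_r //= -IH //; apply: leq_trans (par_pos (ne_r _ zX)) _.
  rewrite -IH in pz; last by apply: leq_trans (par_pos zr) _.
  have := eX _ z pz; rewrite adjacent_sym par_adj // => /(_ isT)/orP[//|/eqP zv].
  have : G v (par v) by rewrite par_adj // -zv.
  rewrite ev -zv => /orP[]/eqP E; last by rewrite E (negPf yX) in pz.
  have := par_pos zr; have := par_pos xr; rewrite E px zv => h /(ltn_trans h); by rewrite ltnn.
exists x, y; split=> //.
  apply/(nontree_uncrossed xr); rewrite -XD => a b aX bX Gab.
  have := eX a b aX Gab; rewrite (negPf bX) /= => /eqP bv; rewrite px bv; split=> //.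
  have : G v a by rewrite -bv adjacent_sym.
  by rewrite ev => /orP[]/eqP // E; rewrite -E aX in yX.
by rewrite -XD -(ltn_card_side k vX).
Qed.
End RootedTree.

(** * Running times *)

(* The name [Sub] is also used by MathComp. *)
Local Notation Sub := Defs.Sub.

Definition wp (c : cmd) (t : nat) (s : state) (Q : state -> Prop) : Prop :=
  exists t' s', [/\ exec c s t' s', t' <= t & Q s'].

Fixpoint written_regs (c : cmd) : seq nat :=
  match c with
  | Skip | Write _ _ _ => [::]
  | Assign x _ => [:: x]
  | Seq c1 c2 | If _ c1 c2 => written_regs c1 ++ written_regs c2
  | While _ c => written_regs c
  end.

Fixpoint written_arrays (c : cmd) : seq nat :=
  match c with
  | Skip | Assign _ _ => [::]
  | Write a _ _ => [:: a]
  | Seq c1 c2 | If _ c1 c2 => written_arrays c1 ++ written_arrays c2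
  | While _ c => written_arrays c
  end.

Definition frame (rs aas : seq nat) (s s' : state) : Prop :=
  (forall x, x \notin rs -> regs s' x = regs s x) /\
  (forall a, a \notin aas -> forall i, arrays s' a i = arrays s a i).

Lemma frame_refl rs aas s : frame rs aas s s.
Proof. by []. Qed.

Lemma frame_trans rs aas s1 s2 s3 : frame rs aas s1 s2 -> frame rs aas s2 s3 ->
  frame rs aas s1 s3.
Proof.
case=> hr ha [hr' ha']; split=> [x xr|a aa i]; first by rewrite hr' ?hr.
by rewrite ha' ?ha.
Qed.

Lemma frame_sub rs rs' aas aas' s s' : {subset rs <= rs'} -> {subset aas <= aas'} ->
  frame rs aas s s' -> frame rs' aas' s s'.
Proof.
move=> sr sa [hr ha]; split=> [x xr|a aa]; first by apply: hr; apply: contra (sr x) xr.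
by apply: ha; apply: contra (sa a) aa.
Qed.

Lemma exec_frame c s t s' : exec c s t s' -> frame (written_regs c) (written_arrays c) s s'.
Proof.
have catl (T : eqType) (u v : seq T) : {subset u <= u ++ v}.
  by move=> x xu; rewrite mem_cat xu.
have catr (T : eqType) (u v : seq T) : {subset v <= u ++ v}.
  by move=> x xu; rewrite mem_cat xu orbT.
elim=> {c s t s'} //=.
- by move=> x e s; split=> // y; rewrite inE => /negbTE /= ->.
- by move=> a i e s; split=> // b; rewrite inE => /negbTE /= ->.
- move=> c1 c2 s s1 s2 _ _ _ f1 _ f2; apply: frame_trans.
    by apply: frame_sub f1.
  by apply: frame_sub f2.
- by move=> e c1 c2 s s' _ _ _; apply: frame_sub.
- by move=> e c1 c2 s s' _ _ _; apply: frame_sub.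
- by move=> e c s s1 s2 _ _ _ _ f1 _ f2; apply: frame_trans f1 f2.
Qed.

(** What a command cannot touch is read off from its text, so the specification of a phase only
    speaks of what the phase changes. *)
Lemma wp_frame c t s (Q : state -> Prop) : wp c t s Q ->
  wp c t s (fun s' => frame (written_regs c) (written_arrays c) s s' /\ Q s').
Proof. by case=> u [s' [es ut Qs]]; exists u, s'; split=> //; split=> //;
  apply: exec_frame es. Qed.

Lemma wp_weaken c t t' s (Q Q' : state -> Prop) : wp c t s Q -> t <= t' ->
  (forall s', Q s' -> Q' s') -> wp c t' s Q'.
Proof.
case=> u [s' [es ut Qs]] tt QQ; exists u, s'; split=> //; [exact: leq_trans tt|exact: QQ].
Qed.

Fixpoint straight (c : cmd) : bool :=
  match c with
  | Seq c1 c2 | If _ c1 c2 => straight c1 && straight c2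
  | While _ _ => false
  | _ => true
  end.

(** Symbolic execution of loop-free commands; the value on [While] is a dummy, excluded by
    [straight]. *)
Fixpoint run (c : cmd) (s : state) : state :=
  match c with
  | Skip | While _ _ => s
  | Assign x e => set_reg s x (eval s e)
  | Write a i e => set_cell s a (eval s i) (eval s e)
  | Seq c1 c2 => run c2 (run c1 s)
  | If e c1 c2 => if eval s e != 0 then run c1 s else run c2 s
  end.

Fixpoint run_cost (c : cmd) : nat :=
  match c with
  | Skip | While _ _ => 1
  | Assign _ e => (expr_cost e).+1
  | Write _ i e => (expr_cost i + expr_cost e).+1
  | Seq c1 c2 => run_cost c1 + run_cost c2
  | If e c1 c2 => (expr_cost e + maxn (run_cost c1) (run_cost c2)).+1
  end.

Lemma wp_run c t s (Q : state -> Prop) :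
  straight c -> run_cost c <= t -> Q (run c s) -> wp c t s Q.
Proof.
move=> cs ct Qs; suff [u es ut] : exists2 u, exec c s u (run c s) & u <= run_cost c.
  by exists u, (run c s); split=> //; apply: leq_trans ct.
elim: c cs s {t Q ct Qs} => //= [_ s|x e _ s|a i e _ s|c1 IH1 c2 IH2 /andP[s1 s2] s|e c1 IH1
  c2 IH2 /andP[s1 s2] s].
- by exists 1 => //; constructor.
- by eexists; [constructor|].
- by eexists; [constructor|].
- have [u1 e1 l1] := IH1 s1 s; have [u2 e2 l2] := IH2 s2 (run c1 s).
  by exists (u1 + u2); [econstructor; eassumption|apply: leq_add].
have [u1 e1 l1] := IH1 s1 s; have [u2 e2 l2] := IH2 s2 s.
case: (boolP (eval s e != 0)) => h.
  by eexists; [apply: ExecIfTrue; eassumption|rewrite ltnS leq_add2l leq_max l1].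
by eexists; [apply: ExecIfFalse; [apply/eqP;
  rewrite -[_ == _]negbK|eassumption]|rewrite ltnS leq_add2l leq_max l2 orbT].
Qed.

Lemma wp_seq c1 c2 t1 t2 t s (Q : state -> Prop) :
  wp c1 t1 s (fun s1 => wp c2 t2 s1 Q) -> t1 + t2 <= t -> wp (Seq c1 c2) t s Q.
Proof.
case=> u1 [s1 [e1 l1 [u2 [s2 [e2 l2 Qs]]]]] tt.
exists (u1 + u2), s2; split=> //; first by econstructor; eassumption.
by apply: leq_trans tt; apply: leq_add.
Qed.

Lemma wp_if e c1 c2 t s (Q : state -> Prop) :
  (if eval s e != 0 then wp c1 t s Q else wp c2 t s Q) ->
  wp (If e c1 c2) (expr_cost e + t).+1 s Q.
Proof.
case: (boolP (eval s e != 0)) => h [u [s' [e1 l1 Qs]]]; exists (expr_cost e + u).+1, s';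
  split=> //; rewrite ?ltnS ?leq_add2l //; first exact: ExecIfTrue.
by apply: ExecIfFalse => //; apply/eqP; rewrite -[_ == _]negbK.
Qed.

Definition For (x y : nat) (c : cmd) : cmd :=
  While (Sub (Reg y) (Reg x)) (Seq c (Assign x (Add (Reg x) (Const 1)))).

(* The second argument of the invariant bounds the time spent in the body so
   far; each iteration pays 4 more for the test and 4 for the increment. *)
Lemma wp_for_total x y c lo hi t (I : nat -> nat -> state -> Prop) s :
  [&& x != y, x \notin written_regs c & y \notin written_regs c] ->
  regs s x = lo -> regs s y = hi -> lo <= hi -> I lo 0 s ->
  (forall j a s', lo <= j < hi -> regs s' x = j -> regs s' y = hi ->
     frame (rcons (written_regs c) x) (written_arrays c) s s' -> I j a s' ->
     exists d, wp c d s' (fun s'' => I j.+1 (a + d) (set_reg s'' x j.+1))) ->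
  (forall a s', I hi a s' -> a + 8 * (hi - lo) + 4 <= t) ->
  wp (For x y c) t s (fun s' => exists a, I hi a s').
Proof.
case/and3P=> xy xc yc sx sy lohi I0 step tt.
suff loop d : forall j a s', j + d = hi -> lo <= j -> regs s' x = j -> regs s' y = hi ->
    frame (rcons (written_regs c) x) (written_arrays c) s s' -> I j a s' ->
    exists u s'' a', [/\ exec (For x y c) s' u s'', a + u <= a' + 8 * d + 4 & I hi a' s''].
  have [|u [s' [a [e1 l1 Ia]]]] := loop (hi - lo) lo 0 s _ (leqnn _) sx sy (frame_refl _ _ _)
    I0.
    by rewrite subnKC.
  by exists u, s'; split; [|apply: leq_trans l1 (tt _ _ Ia)|exists a].
elim: d => [|d IH] j a s' jd loj xj yhi fr Ij.
  have jhi : j = hi by rewrite -jd addn0.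
  exists 4, s', a; rewrite -jhi; split; rewrite ?muln0 ?addn0 //.
  by apply: ExecWhileFalse; rewrite /= xj yhi jhi subnn.
have jhi : j < hi by rewrite -jd addnS ltnS leq_addr.
have [b /wp_frame[u [s1 [e1 l1 [fr1 I1]]]]] := step j a s' (introT andP (conj loj jhi)) xj
  yhi fr Ij.
have x1 : regs s1 x = j by rewrite (proj1 fr1).
have y1 : regs s1 y = hi by rewrite (proj1 fr1).
have [||||||u' [s2 [a' [e2 l2 Q2]]]] := IH j.+1 (a + b) (set_reg s1 x j.+1);
  rewrite ?addSnnS //.
- exact: leq_trans loj _.
- by rewrite /= eqxx.
- by rewrite /= eq_sym (negPf xy).
- split=> [z|a0 aa i] /=.
    by rewrite mem_rcons inE negb_or => /andP[/negbTE zx zc];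
      rewrite zx (proj1 fr1) // (proj1 fr) // mem_rcons inE zx.
  by rewrite (proj2 fr1) // (proj2 fr).
exists (3 + (u + 4) + u').+1, s2, a'; split=> //; last by move: l1 l2; clear; lia.
apply: (@ExecWhileTrue _ _ _ (set_reg s1 x j.+1)) e2.
  by rewrite /= xj yhi subn_eq0 -ltnNge.
apply: ExecSeq e1 _; have -> : j.+1 = eval s1 (Add (Reg x) (Const 1)) by rewrite /= x1 addn1.
exact: ExecAssign.
Qed.

(** * Running a command on a renamed part of the memory *)

Fixpoint shift_expr K (e : expr) : expr :=
  match e with
  | Const c => Const c
  | Reg x => Reg (K + x)
  | Read a i => Read (K + a) (shift_expr K i)
  | Add e1 e2 => Add (shift_expr K e1) (shift_expr K e2)
  | Sub e1 e2 => Sub (shift_expr K e1) (shift_expr K e2)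
  end.

Fixpoint shift K (c : cmd) : cmd :=
  match c with
  | Skip => Skip
  | Assign x e => Assign (K + x) (shift_expr K e)
  | Write a i e => Write (K + a) (shift_expr K i) (shift_expr K e)
  | Seq c1 c2 => Seq (shift K c1) (shift K c2)
  | If e c1 c2 => If (shift_expr K e) (shift K c1) (shift K c2)
  | While e c => While (shift_expr K e) (shift K c)
  end.

Definition shifted K (s s' : state) : Prop :=
  (forall x, regs s' (K + x) = regs s x) /\
  (forall a i, arrays s' (K + a) i = arrays s a i).

Lemma eval_shift K s s' e : shifted K s s' -> eval s' (shift_expr K e) = eval s e.
Proof. by case=> hr ha; elim: e => //= [a i ->|e1 -> e2 ->|e1 -> e2 ->]. Qed.

Lemma expr_cost_shift K e : expr_cost (shift_expr K e) = expr_cost e.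
Proof. by elim: e => //= [a i ->|e1 -> e2 ->|e1 -> e2 ->]. Qed.

(** Renaming alters neither values nor costs, and [shifted] leaves all names below [K]
    unconstrained. *)
Lemma exec_shift K c s t s1 : exec c s t s1 -> forall s', shifted K s s' ->
  exists2 s1', exec (shift K c) s' t s1' & shifted K s1 s1'.
Proof.
elim=> {c s t s1} /=.
- by move=> s s' ss; exists s' => //; constructor.
- move=> x e s s' ss; eexists; first by rewrite -(expr_cost_shift K e); constructor.
  case: (ss) => hr ha; split=> //= y; rewrite eqn_add2l (eval_shift _ ss); by case: eqP.
- move=> a i e s s' ss; eexists.
    by rewrite -(expr_cost_shift K e) -(expr_cost_shift K i); constructor.
  by case: (ss) => hr ha; split=> //= b j; rewrite eqn_add2l !(eval_shift _ ss) ha.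
- move=> c1 c2 s s1 s2 t1 t2 _ IH1 _ IH2 s' /IH1[s1' e1 /IH2[s2' e2 ss2]].
  by exists s2' => //; econstructor; eassumption.
- move=> e c1 c2 s s1 t h _ IH s' ss; have [s1' e1 ss1] := IH s' ss; exists s1' => //.
  by rewrite -(expr_cost_shift K e); apply: ExecIfTrue; rewrite ?(eval_shift _ ss).
- move=> e c1 c2 s s1 t h _ IH s' ss; have [s1' e1 ss1] := IH s' ss; exists s1' => //.
  by rewrite -(expr_cost_shift K e); apply: ExecIfFalse; rewrite ?(eval_shift _ ss).
- move=> e c s s1 s2 t1 t2 h _ IH1 _ IH2 s' ss; have [s1' e1 ss1] := IH1 s' ss.
  have [s2' e2 ss2] := IH2 s1' ss1; exists s2' => //.
  by rewrite -(expr_cost_shift K e); apply: ExecWhileTrue e1 e2; rewrite ?(eval_shift _ ss).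
move=> e c s h s' ss; exists s' => //.
by rewrite -(expr_cost_shift K e); apply: ExecWhileFalse; rewrite (eval_shift _ ss).
Qed.

(** * Breadth-first search *)

(* [rV] runs over the vertices and [rJ] over the cells of an adjacency list, up
   to [rE]; [rC] and [rU] are counters. *)
Local Notation rN := 0 (only parsing).
Local Notation rK := 1 (only parsing).
Local Notation rV := 2 (only parsing).
Local Notation rJ := 3 (only parsing).
Local Notation rE := 4 (only parsing).
Local Notation rW := 5 (only parsing).
Local Notation rC := 6 (only parsing).
Local Notation rU := 7 (only parsing).

(* [aPar] holds the parent plus one, 0 meaning that the vertex is not visited yet;
   [aOut] and [aIn] hold the weights of the non-tree edges; [aSlot] holds at
   [aBase v + w] the cell of [aAdj] where [w] occurs in the list of [v]; [aNew]
   holds the number of a vertex in the reduced graph. *)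
Local Notation aOff := 0 (only parsing).
Local Notation aAdj := 1 (only parsing).
Local Notation aPar := 2 (only parsing).
Local Notation aQueue := 3 (only parsing).
Local Notation aSize := 4 (only parsing).
Local Notation aOut := 5 (only parsing).
Local Notation aIn := 6 (only parsing).
Local Notation aSlot := 7 (only parsing).
Local Notation aFlag := 8 (only parsing).
Local Notation aNew := 9 (only parsing).
Local Notation aBase := 10 (only parsing).

Definition slots (x : nat) (c : cmd) : cmd :=
  Seq (Assign rJ (Read aOff (Reg x)))
  (Seq (Assign rE (Read aOff (Add (Reg x) (Const 1))))
       (For rJ rE c)).

Definition bfs_body : cmd :=
  Seq (Assign rW (Read aAdj (Reg rJ)))
  (If (Read aPar (Reg rW)) Skip
    (Seq (Write aPar (Reg rW) (Add (Reg rU) (Const 1)))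
    (Seq (Write aQueue (Reg rC) (Reg rW))
         (Assign rC (Add (Reg rC) (Const 1)))))).

Definition bfs : cmd :=
  Seq (Write aPar (Const 0) (Const 1))
  (Seq (Assign rC (Const 1))
       (For rV rN (Seq (Assign rU (Read aQueue (Reg rV))) (slots rU bfs_body)))).

Lemma nth_flatten_take (T : Type) (x0 : T) ss i j : j < size (nth [::] ss i) ->
  nth x0 (flatten ss) (sumn (take i (shape ss)) + j) = nth x0 (nth [::] ss i) j.
Proof.
elim: ss i => [|s ss IH] [|i] //= js; first by rewrite nth_cat js.
by rewrite nth_cat -addnA ltnNge leq_addr /= addKn IH.
Qed.

Lemma wp_for c x y lo hi body t (I : nat -> state -> Prop) s :
  [&& x != y, x \notin written_regs body & y \notin written_regs body] ->
  regs s x = lo -> regs s y = hi -> lo <= hi -> I lo s ->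
  (forall j s', lo <= j < hi -> regs s' x = j -> regs s' y = hi ->
     frame (rcons (written_regs body) x) (written_arrays body) s s' -> I j s' ->
     wp body c s' (fun s'' => I j.+1 (set_reg s'' x j.+1))) ->
  (c + 8) * (hi - lo) + 4 <= t ->
  wp (For x y body) t s (I hi).
Proof.
move=> xyb sx sy lohi I0 step tt.
have W := wp_for_total (I := fun j a s' => a = c * (j - lo) /\ I j s') (t := t) xyb sx sy lohi.
apply: wp_weaken (W _ _ _) (leqnn t) _.
- by rewrite subnn muln0.
- move=> j a s' jlh jx jy fr [-> Ij]; exists c;
    apply: wp_weaken (step _ _ jlh jx jy fr Ij) (leqnn c) _.
  by move=> s'' I'; split=> //; rewrite subSn ?mulnS ?(addnC c) //; case/andP: jlh.
- by move=> a s' [-> _]; apply: leq_trans tt; rewrite -mulnDl.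
by move=> s' [a []].
Qed.

(** * Adjacency lists in memory, loops over them, and correctness of the search *)

Section Phases.
Variables (n k : nat) (G : sgraph n) (L : 'I_n -> seq 'I_n).
Hypothesis G_connected : connected G.
Hypothesis L_lists : adjacency_lists G L.

Definition off i := sumn (take i (shape (list_table L))).

Lemma size_list_table : size (list_table L) = n.
Proof. by rewrite size_map size_enum_ord. Qed.

Lemma off0 : off 0 = 0. Proof. by rewrite /off take0. Qed.

Lemma offS (v : 'I_n) : off v.+1 = off v + size (L v).
Proof.
rewrite /off (take_nth 0); last by rewrite size_map size_list_table.
rewrite sumn_rcons; congr (_ + _).
by rewrite (nth_map [::]) ?size_list_table // (nth_map v) ?size_enum_ord // nth_ord_enum
  size_map.
Qed.

Lemma off_mono : {homo off : i j / i <= j}.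
Proof.
apply: homo_leq => // [i j l|i]; first exact: leq_trans.
case: (ltnP i n) => [lt|ge]; first by rewrite (offS (Ordinal lt)) leq_addr.
by rewrite /off !take_oversize // size_map size_list_table // ltnW.
Qed.

Lemma off_inj (u v : 'I_n) i j : i < size (L u) -> j < size (L v) ->
  off u + i = off v + j -> u = v /\ i = j.
Proof.
move=> iu jv E; have uv : u = v.
  apply: ord_inj; case: (ltngtP u v) => // h; have := off_mono h; rewrite offS.
    by move: E iu; clear; lia.
  by move: E jv; clear; lia.
by split=> //; move: E; rewrite uv => /addnI.
Qed.

Lemma off_sum : off n = #|edges G|.*2.
Proof.
rewrite -card_edges /off take_oversize; last by rewrite size_map size_list_table.
rewrite sumnE big_map big_map big_enum /=.
under eq_bigr => v _ do rewrite size_map.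
rewrite -sum1_card (eq_bigl (fun t => G t.1 t.2)); last by move=> t; rewrite inE.
rewrite -(pair_big_dep xpredT (fun u v => G u v) (fun _ _ => 1)) /=; apply: eq_bigr => v _.
have [uL LG] := L_lists v; rewrite -(card_uniqP uL) -sum1_card.
by apply: eq_bigl => u; rewrite LG.
Qed.

Lemma nth_flatten_table (v : 'I_n) j : j < size (L v) ->
  nth 0 (flatten (list_table L)) (off v + j) = nth 0 (map val (L v)) j.
Proof.
move=> jv; have E : nth [::] (list_table L) v = map val (L v).
  by rewrite (nth_map v) ?size_enum_ord // nth_ord_enum.
by rewrite nth_flatten_take E ?size_map.
Qed.

(** The offsets are those of [L] while the entries are those of [M]: splicing replaces entries but
    keeps the length of every list. *)
Definition stored (M : 'I_n -> seq 'I_n) (s : state) : Prop :=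
  [/\ regs s rN = n, regs s rK = k, forall i, i <= n -> arrays s aOff i = off i
    & forall v i, i < size (M v) -> arrays s aAdj (off v + i) = nth 0 (map val (M v)) i].

Lemma stored_frame M rs aas s s' : frame rs aas s s' -> 
  [&& rN \notin rs, rK \notin rs, aOff \notin aas & aAdj \notin aas] ->
  stored M s -> stored M s'.
Proof.
case=> fr fa /and4P[h0 h1 h2 h3] [s0 s1 s2 s3]; split; rewrite ?fr //.
  by move=> i; rewrite fa //; apply: s2.
by move=> v i; rewrite fa //; apply: s3.
Qed.

Lemma wp_slots M x body c t (v : 'I_n) (I : nat -> state -> Prop) s :
  (forall u, size (M u) = size (L u)) -> stored M s -> regs s x = v ->
  [&& rN \notin written_regs body, rK \notin written_regs body,
      rJ \notin written_regs body, rE \notin written_regs body, x \notin [:: rJ, rE &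
        written_regs body],
      aOff \notin written_arrays body & aAdj \notin written_arrays body] ->
  I 0 (set_reg (set_reg s rJ (off v)) rE (off v.+1)) ->
  (forall i (w : 'I_n) s', i < size (M v) -> nth w (M v) i = w -> stored M s' -> regs s' x =
    v ->
     regs s' rJ = off v + i -> arrays s' aAdj (off v + i) = w ->
     frame [:: rJ, rE & written_regs body] (written_arrays body) s s' ->
     I i s' -> wp body c s' (fun s'' => I i.+1 (set_reg s'' rJ (off v + i).+1))) ->
  (c + 8) * (off v.+1 - off v) + 13 <= t ->
  wp (slots x body) t s (I (size (M v))).
Proof.
move=> SM st xv hw I0 step tt.
have /and5P[nr kr Jr Er /and3P[xr oa aa]] := hw.
case: (st) => [sn sk so sa].
apply: (wp_seq (t1 := 3) (t2 := (c + 8) * (off v.+1 - off v) + 10)); last by move: tt; clear;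
  lia.
apply: wp_run => //=.
apply: (wp_seq (t1 := 6) (t2 := (c + 8) * (off v.+1 - off v) + 4)); last by clear; lia.
apply: wp_run => //=.
move: xr; rewrite !inE !negb_or => /and3P[xJ xE xr].
set s1 := set_reg _ _ _.
have s1E : s1 = set_reg (set_reg s rJ (off v)) rE (off v.+1).
  rewrite /s1 /= xv so ?(ltnW (ltn_ord v)) //; congr set_reg.
  by rewrite (negPf xJ) addn1 so.
rewrite s1E.
have offv : off v.+1 = off v + size (M v) by rewrite SM offS.
have -> : size (M v) = off v.+1 - off v by rewrite offv addKn.
apply: (@wp_for c _ _ (off v) _ _ _ (fun j => I (j - off v))) => //.
- by rewrite Jr Er.
- by rewrite offv leq_addr.
- by rewrite subnn.
move=> j s' /andP[lo hi] Jj Ej fr Ij.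
have jM : j - off v < size (M v) by move: lo hi; rewrite offv; clear; lia.
have [w0 _] : exists w0 : 'I_n, true by exists v.
have jE : off v + (j - off v) = j by rewrite subnKC.
have fr' : frame [:: rJ, rE & written_regs body] (written_arrays body) s s'.
  have [f1 f2] := fr; split=> [y|a aa' i]; last by rewrite f2.
  rewrite !inE !negb_or => /and3P[yJ yE yb]; rewrite f1 /= ?(negPf yJ) ?(negPf yE) //.
  by rewrite mem_rcons inE negb_or yJ.
have st' : stored M s'.
  by apply: stored_frame fr' _ st; rewrite !inE /= nr kr oa aa.
have := step (j - off v) (nth w0 (M v) (j - off v)) s' jM; rewrite jE subSn //; apply=> //.
- by apply: set_nth_default.
- by rewrite (proj1 fr') // !inE !negb_or xJ xE.
by have [_ _ _ h] := st'; rewrite -{1}jE h // (nth_map w0).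
Qed.

(* The order of the visits is only known at the end of the search, hence the
   ghost sequence [q]: a vertex [v] costs at most [c * deg v + c]. *)
Lemma wp_outer_seq c t body (I : seq 'I_n -> state -> Prop) s lo M :
  [&& rV \notin written_regs body, rN \notin written_regs body, rK \notin written_regs body,
      aOff \notin written_arrays body & aAdj \notin written_arrays body] ->
  regs s rV = lo -> lo <= n -> stored M s -> I [::] s ->
  (forall q j s', lo <= j < n -> size q = j - lo -> regs s' rV = j -> stored M s' ->
     frame (rV :: written_regs body) (written_arrays body) s s' -> I q s' ->
     exists v : 'I_n, wp body (c * (off v.+1 - off v) + c) s'
       (fun s'' => I (rcons q v) (set_reg s'' rV j.+1))) ->
  (forall q s', size q = n - lo -> I q s' -> uniq q) ->
  (c + 8) * (n + off n) + 4 <= t ->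
  wp (For rV rN body) t s (fun s' => exists2 q, size q = n - lo & I q s').
Proof.
case/and5P=> bV bN bK bO bA sV lon st Ilo step Iu tt.
have [sn _ _ _] := st.
pose cost (q : seq 'I_n) := \sum_(v <- q) (c * (off v.+1 - off v) + c).
pose J j a s' := exists q, [/\ a = cost q, size q = j - lo & I q s'].
have W := wp_for_total (x := rV) (y := rN) (c := body) (I := J) (t := t) _ sV sn lon.
apply: wp_weaken (W _ _ _ _) (leqnn t) _.
- by rewrite bV bN.
- by exists [::]; rewrite /cost big_nil subnn.
- move=> j a s' /andP[loj jn] jV _ fr [q [-> sq Iq]].
  have [||v wv] := step q j s' (introT andP (conj loj jn)) sq jV _ _ Iq.
  + by apply: stored_frame fr _ st; rewrite !mem_rcons !inE /= bN bK bO bA.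
  + by apply: frame_sub fr => // y; rewrite mem_rcons.
  exists (c * (off v.+1 - off v) + c); apply: wp_weaken wv (leqnn _) _ => s'' Iq'.
  exists (rcons q v); split=> //; last by rewrite size_rcons sq subSn.
  by rewrite /cost -cats1 big_cat big_seq1.
- move=> a s' [q [-> sq Iq]]; apply: leq_trans tt.
  (* Since [q] has no repetition, its cost is at most the sum over all vertices, where the list
     lengths telescope to [off n]. *)
  have : cost q <= \sum_(v : 'I_n) (c * (off v.+1 - off v) + c).
    rewrite /cost big_uniq ?(Iu q s') //= [X in _ <= X](bigID (mem q)) /=; exact: leq_addr.
  rewrite big_split /= sum_nat_const card_ord -big_distrr /=.
  have -> : \sum_(v : 'I_n) (off v.+1 - off v) = off n.
    rewrite -(big_mkord xpredT (fun v => off v.+1 - off v)) telescope_sumn ?off0 ?subn0 //.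
    by move=> i j; apply: off_mono.
  by move: (off n) (cost q); clear; nia.
by move=> s' [a [q [_ sq Iq]]]; exists q.
Qed.

Lemma wp_outer c t body (I : nat -> state -> Prop) s lo M :
  [&& rV \notin written_regs body, rN \notin written_regs body, rK \notin written_regs body,
      aOff \notin written_arrays body & aAdj \notin written_arrays body] ->
  regs s rV = lo -> lo <= n -> stored M s -> I lo s ->
  (forall (v : 'I_n) s', lo <= v -> regs s' rV = v -> stored M s' ->
     frame (rV :: written_regs body) (written_arrays body) s s' -> I v s' ->
     wp body (c * (off v.+1 - off v) + c) s' (fun s'' => I v.+1 (set_reg s'' rV v.+1))) ->
  (c + 8) * (n + off n) + 4 <= t ->
  wp (For rV rN body) t s (I n).
Proof.
move=> hb sV lon st Ilo step tt.
have W := @wp_outer_seq c t body (fun q s' => map val q = iota lo (size q) /\ I (lo + size q)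
  s') s lo M
  hb sV lon st.
apply: wp_weaken (W _ _ _ tt) (leqnn _) _; first by rewrite addn0.
- move=> q j s' /andP[loj jn] sq jV st' fr; rewrite sq subnKC // => -[mq Iq].
  exists (Ordinal jn); apply: wp_weaken (step (Ordinal jn) s' loj jV st' fr Iq) (leqnn _) _
    => s'' I'.
  rewrite size_rcons sq addnS subnKC // map_rcons mq; split=> //.
  by rewrite -addn1 iotaD /= subnKC // cats1.
- by move=> q s' _ [mq _]; rewrite -(map_inj_uniq val_inj) mq iota_uniq.
by move=> s' [q sq [_]]; rewrite sq subnKC.
Qed.

Variable r : 'I_n.
Hypothesis r0 : r = 0 :> nat.

(** [q] lists the visited vertices in the order of discovery, so a parent precedes its children;
    [index _ q] later serves as the position function of the rooted tree. *)
Definition queue_inv (q : seq 'I_n) (s : state) : Prop :=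
  [/\ uniq q /\ r \in q, regs s rC = size q,
      forall i, i < size q -> arrays s aQueue i = nth r q i,
      forall v : 'I_n, v \notin q -> arrays s aPar v = 0
    & arrays s aPar r = r.+1 /\ forall v : 'I_n, v \in q -> v != r -> exists u,
        [/\ arrays s aPar v = (u : 'I_n).+1, u \in q, index u q < index v q & G v u]].

Definition closed_upto (q : seq 'I_n) h := forall v u, index v q < h -> G v u -> u \in q.

Lemma queue_inv_visited q s (v : 'I_n) : queue_inv q s -> (arrays s aPar v != 0) = (v \in q).
Proof.
case=> _ _ _ out [pr inq]; case: (boolP (v \in q)) => [vq|/out->//].
by case: (eqVneq v r) => [->|/(inq v vq)[u [->]]] //; rewrite pr.
Qed.

Lemma queue_inv_push q s (w v : 'I_n) : queue_inv q s -> w \notin q -> v \in q -> G w v ->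
  queue_inv (rcons q w) (set_reg (set_cell (set_cell s aPar w v.+1) aQueue (size q) w) rC
    (size q).+1).
Proof.
move=> [[uq rq] cq Qq out [pr inq]] wq vq Gwv; split=> /=.
- by rewrite rcons_uniq wq uq mem_rcons inE rq orbT.
- by rewrite size_rcons.
- move=> i; rewrite size_rcons ltnS leq_eqVlt nth_rcons => /orP[/eqP->|iq].
    by rewrite eqxx ltnn.
  by rewrite (ltn_eqF iq) iq Qq.
- move=> u; rewrite mem_rcons inE negb_or => /andP[uw uq']; rewrite out //.
  by rewrite val_eqE (negPf uw).
split; first by rewrite val_eqE; case: eqP => [rw|_]; rewrite ?pr //; rewrite -rw rq in wq.
move=> u; rewrite mem_rcons inE => /orP[/eqP->|uq'] ur.
  exists v; rewrite eqxx mem_rcons inE vq orbT -!cats1 !index_cat vq (negPf wq); split=> //.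
  by apply: leq_trans (_ : size q <= _); rewrite ?index_mem ?leq_addr.
rewrite val_eqE; case: eqP => [uw|_]; first by rewrite -uw uq' in wq.
have [x [E xq lt Gux]] := inq u uq' ur; exists x; split=> //;
  first by rewrite mem_rcons inE xq orbT.
by rewrite -!cats1 !index_cat xq uq'.
Qed.

Lemma wp_bfs s : stored L s -> (forall i, arrays s aPar i = 0) -> arrays s aQueue 0 = 0 ->
  regs s rV = 0 ->
  wp bfs (100 * (n + off n) + 100) s (fun s' => exists q par, 
    [/\ uniq q /\ size q = n, forall i, i < n -> arrays s' aQueue i = nth r q i,
        forall v : 'I_n, arrays s' aPar v = (par v : 'I_n).+1, par r = r
      & forall v, v != r -> G v (par v) /\ index (par v) q < index v q]).
Proof.
move=> st P0 Q0 sV.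
apply: (wp_seq (t1 := 3) (t2 := 100 * (n + off n) + 97)); last by clear; lia.
apply: wp_run => //=.
apply: (wp_seq (t1 := 2) (t2 := 100 * (n + off n) + 95)); last by clear; lia.
apply: wp_run => //=.
set s1 := set_reg _ _ _.
have st1 : stored L s1 by case: st.
(* [p] is the processed part of the queue and [q] the whole queue. *)
pose I p s' := exists q, [/\ queue_inv q s', p = take (size p) q & closed_upto q (size p)].
have W := @wp_outer_seq 60 (100 * (n + off n) + 95) (Seq (Assign rU (Read aQueue (Reg rV)))
  (slots rU bfs_body)) I s1 0 L isT sV (leq0n n) st1.
apply: wp_weaken (W _ _ _ _) (leqnn _) _; last 1 first.
- move=> s' [p sp [q [[[uq rq] cq Qq out [pr inq]] pq _]]].
  have sq : size q = n.
    have := max_card (mem q); rewrite (card_uniqP uq) card_ord => qn.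
    have : size p <= size q by rewrite pq size_take; case: ltnP => // /ltnW.
    by rewrite sp subn0 => nq; apply/eqP; rewrite eqn_leq qn.
  have allq (v : 'I_n) : v \in q.
    apply: contraT => vq; have uv : uniq (v :: q) by rewrite /= vq.
    by have := max_card (mem (v :: q)); rewrite (card_uniqP uv) card_ord /= sq ltnn.
  pose par v : 'I_n := insubd r (arrays s' aPar v).-1.
  have parE (v u : 'I_n) : arrays s' aPar v = (u : 'I_n).+1 -> par v = u.
    by rewrite /par => -> /=; rewrite valKd.
  exists q, par; split=> //; first by move=> i hi; apply: Qq; rewrite sq.
  - move=> v; case: (eqVneq v r) => [->|vr]; first by rewrite (parE _ _ pr) pr.
    by have [u [E _ _ _]] := inq v (allq v) vr; rewrite (parE _ _ E) E.
  - exact: parE pr.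
  move=> v vr; have [u [E _ lt Gvu]] := inq v (allq v) vr; by rewrite (parE _ _ E).
- exists [:: r]; split=> //=; split=> //=.
  + by split=> //; rewrite mem_head.
  + by case=> // _; rewrite Q0 r0.
  + move=> v; rewrite inE => vr.
    have -> : (v == 0 :> nat) = false by rewrite -r0 val_eqE; apply/negbTE.
    exact: P0.
  + by rewrite r0 /=; split=> // v; rewrite inE => /eqP->; rewrite eqxx.
- move=> p h s' /andP[_ hn]; rewrite subn0 => sp sv st' fr [q [Iq pq cl]].
  have sq : h <= size q by rewrite -sp {1}pq size_take; case: ltnP => // /ltnW.
  (* The queue cannot run empty early: if all its members have been processed, it is closed under
     adjacency and contains all [n] vertices. *)
  have hq : h < size q.
    rewrite ltn_neqAle sq andbT; apply/eqP => E.
    have CG := connected_onP G_connected.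
    have : [set u | u \in q] = setT.
      apply: (CG _ r); rewrite ?subsetT //; first by rewrite inE; case: Iq => [[]].
      by move=> b c; rewrite !inE => bq; apply: cl; rewrite sp E index_mem.
    move/setP => qT; move: hn; rewrite E ltnNge => /negP[].
    case: Iq => [[uq _] _ _ _ _]; rewrite -(card_uniqP uq);
      apply: leq_trans (_ : #|'I_n| <= _); first by rewrite card_ord.
    by apply/subset_leq_card/subsetP=> u _; have := qT u; rewrite !inE.
  pose v := nth r q h; exists v.
  apply: (wp_seq (t1 := 3) (t2 := 60 * (off v.+1 - off v) + 50)); last by clear; lia.
  apply: wp_run => //=.
  have vE : arrays s' aQueue (regs s' rV) = v by rewrite sv; case: Iq => _ _ ->.
  rewrite vE.
  set s2 := set_reg _ _ _.
  pose J i (s3 : state) := exists q, [/\ queue_inv q s3, h < size q, p = take h q, nth r q h = v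
     & closed_upto q h /\ {subset take i (L v) <= q}].
  have s2U : regs s2 rU = v by [].
  have st2 : stored L s2 by case: st'.
  apply: (wp_weaken (t := 26 * (off v.+1 - off v) + 13) (Q := J (size (L v)))); last first.
  + move=> s3 [q' [Iq' vq1 pq' nq [cl' sub]]]; exists q'; split=> //=.
      by rewrite size_rcons sp (take_nth r) // -pq' nq.
    rewrite size_rcons sp => x y.
    have [[uq' _] _ _ _ _] := Iq'; rewrite ltnS leq_eqVlt => /orP[/eqP E|]; last by apply: cl'.
    have xq : x \in q' by rewrite -index_mem E.
    have -> : x = v by rewrite -nq -E nth_index.
    by have [_ LG] := L_lists v; rewrite -LG -{1}(take_size (L v)); apply: sub.
  + by clear; lia.
  apply: (@wp_slots L rU bfs_body 18 _ v J) => //.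
    exists q; split=> //; first by rewrite -{1}sp.
    by rewrite -sp; split=> // x; rewrite take0.
  move=> i w s3 iL nw st3 s3U s3J adj fr3 [q' [Iq' vq1 pq' nq [cl' sub]]].
  apply: wp_run => //=; rewrite s3J adj /= (queue_inv_visited w Iq').
  have Gvw : G v w by have [_ <-] := L_lists v; rewrite -nw mem_nth.
  case: (boolP (w \in q')) => wq.
    exists q'; split=> //; split=> //.
    by move=> x; rewrite (take_nth w) // nw mem_rcons inE => /orP[/eqP->|/sub].
  have vq' : v \in q' by rewrite -nq mem_nth.
  have cq : regs s3 rC = size q' by case: Iq'.
  have Gwv : G w v by rewrite adjacent_sym.
  have [IP IC IQ IO [IR IV]] := queue_inv_push Iq' wq vq' Gwv.
  exists (rcons q' w); split.
  + split=> //=.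
    * by rewrite cq addn1 -IC.
    * by move=> i' hi; rewrite cq; apply: IQ.
    * by move=> u hu; rewrite s3U addn1; apply: IO.
    * by rewrite s3U addn1.
  + by rewrite size_rcons ltnW.
  + by rewrite -cats1 takel_cat // ltnW.
  + by rewrite nth_rcons vq1.
  split.
    move=> x y; rewrite -cats1 index_cat mem_cat; case: ifP => xq hx Gxy;
      first by rewrite (cl' x y).
    by move: hx; rewrite ltnNge (leq_trans (ltnW vq1)) // leq_addr.
  move=> x; rewrite (take_nth w) // nw !mem_rcons !inE => /orP[->//|/sub->]; exact: orbT.
- move=> p s' sp [q [[[uq _] _ _ _ _] -> _]]; exact: take_uniq.
by clear; lia.
Qed.

End Phases.

(** * Suppressible vertices *)

Definition neq (e1 e2 : expr) : expr := Add (Sub e1 e2) (Sub e2 e1).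

Lemma neqE a b : (a - b + (b - a) != 0) = (a != b).
Proof. by rewrite addn_eq0 !subn_eq0 -eqn_leq. Qed.

Definition for_vertices (body : cmd) : cmd := Seq (Assign rV (Const 0)) (For rV rN body).

(** The two tests discard tree edges. Doubling [rC] by adding it to itself gives a fresh power of
    two to each remaining list entry, that is, to each direction of a non-tree edge. *)
Definition weigh_body : cmd :=
  Seq (Assign rW (Read aAdj (Reg rJ)))
  (If (neq (Read aPar (Reg rW)) (Add (Reg rV) (Const 1)))
    (If (neq (Read aPar (Reg rV)) (Add (Reg rW) (Const 1)))
      (Seq (Write aOut (Reg rV) (Add (Read aOut (Reg rV)) (Reg rC)))
      (Seq (Write aIn (Reg rW) (Add (Read aIn (Reg rW)) (Reg rC)))
           (Assign rC (Add (Reg rC) (Reg rC)))))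
      Skip)
    Skip).

(** The value 1 in [aSize] prepares the subtree sizes, which are summed together with the
    weights. *)
Definition weigh : cmd :=
  Seq (Assign rC (Const 1))
      (for_vertices (Seq (Write aSize (Reg rV) (Const 1)) (slots rV weigh_body))).

Section Weights.
Variables (n k : nat) (G : sgraph n) (L : 'I_n -> seq 'I_n).
Hypothesis L_lists : adjacency_lists G L.
Variables (par : 'I_n -> 'I_n).

Lemma wp_for_vertices c t body (I : nat -> state -> Prop) s M :
  [&& rV \notin written_regs body, rN \notin written_regs body, rK \notin written_regs body,
      aOff \notin written_arrays body & aAdj \notin written_arrays body] ->
  stored k L M s -> I 0 (set_reg s rV 0) ->
  (forall (v : 'I_n) s', regs s' rV = v -> stored k L M s' ->
     frame (rV :: written_regs body) (written_arrays body) s s' -> I v s' ->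
     wp body (c * (off L v.+1 - off L v) + c) s' (fun s'' => I v.+1 (set_reg s'' rV v.+1))) ->
  (c + 8) * (n + off L n) + 6 <= t ->
  wp (for_vertices body) t s (I n).
Proof.
move=> hb st I0 step tt.
apply: (wp_seq (t1 := 2) (t2 := (c + 8) * (n + off L n) + 4)); last by move: tt; clear; lia.
apply: wp_run => //=.
apply: (wp_outer (L := L) (k := k) (c := c) (lo := 0) (M := M)) => //.
move=> v s' _ sv st' fr Iv; apply: step => //; apply: (frame_trans _ fr).
by split=> // x; rewrite inE negb_or => /andP[/negbTE /= ->].
Qed.

(** Each weighed direction contributes its power of two with coefficient 1, 0 or -1 to the
    difference of the two sums, and the next weight [rC] exceeds that difference in absolute value.
    So the difference vanishes only if every coefficient does. With one weight per edge, the two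
    directions of a crossing edge would cancel. *)
Definition balance (T : {set 'I_n}) (done : rel 'I_n) (s : state) : Prop :=
  let o := \sum_(x in T) arrays s aOut x in
  let i := \sum_(x in T) arrays s aIn x in
  [/\ o < i + regs s rC, i < o + regs s rC
    & o = i <-> forall a b, done a b -> nontree G par a b -> (a \in T) = (b \in T)].

Lemma sum_set_cell (T : {set 'I_n}) (f : nat -> nat) (v : 'I_n) c :
  \sum_(x in T) (if x == v :> nat then f v + c else f x) = \sum_(x in T) f x + (v \in T) * c.
Proof.
transitivity (\sum_(x in T) (f x + (if x == v then c else 0))).
  by apply: eq_bigr => x _; rewrite val_eqE; case: eqP => [->|]; rewrite ?addn0.
rewrite big_split /= -big_mkcondr /=; congr (_ + _).
rewrite (eq_bigl (fun x => (v \in T) && (x == v))); last first.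
  by move=> x; case: (eqVneq x v) => [->|]; rewrite ?andbF.
by case: (v \in T); rewrite /= ?big_pred1_eq ?mul1n ?big_pred0.
Qed.

(** The new weight exceeds the old difference, so it cannot compensate it: the sums agree exactly if
    they agreed before and the new edge does not cross the border of [T]. *)
Lemma balance_push T done done' s s' (v w : 'I_n) : balance T done s ->
  nontree G par v w ->
  (forall a b, done' a b = done a b || ((a == v) && (b == w))) ->
  regs s' rC = regs s rC + regs s rC ->
  (forall x : 'I_n, arrays s' aOut x =
     if x == v :> nat then arrays s aOut v + regs s rC else arrays s aOut x) ->
  (forall x : 'I_n, arrays s' aIn x =
     if x == w :> nat then arrays s aIn w + regs s rC else arrays s aIn x) ->
  balance T done' s'.
Proof.
move=> [oi io eq] nt dE cE oE iE; rewrite /balance cE.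
rewrite (eq_bigr _ (fun x _ => oE x)) (eq_bigr _ (fun x _ => iE x)).
rewrite !sum_set_cell; move: oi io eq.
move: (\sum_(x in T) _) (\sum_(x in T) _) (regs s rC) => i o c oi io eq.
have E : o + (v \in T) * c = i + (w \in T) * c <-> o = i /\ (v \in T) = (w \in T).
  by case: (v \in T); case: (w \in T); move: oi io; rewrite ?mul1n ?mul0n; clear;
     split=> [|[]] // *; try (split=> //); lia.
split.
- by move: oi io; case: (v \in T); case: (w \in T); clear; lia.
- by move: oi io; case: (v \in T); case: (w \in T); clear; lia.
rewrite E eq; split=> [[h vw] a b|h].
  by rewrite dE => /orP[|/andP[/eqP-> /eqP->]] //; apply: h.
split=> [a b ab|]; first by apply: h; rewrite dE ab.
by apply: h => //; rewrite dE !eqxx orbT.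
Qed.

Lemma wp_weigh s : stored k L L s -> 
  (forall v : 'I_n, arrays s aPar v = (par v).+1) ->
  (forall i, arrays s aOut i = 0) -> (forall i, arrays s aIn i = 0) ->
  wp weigh (100 * (n + off L n) + 100) s (fun s' =>
    (forall v : 'I_n, arrays s' aSize v = 1) /\
    forall T : {set 'I_n},
      (\sum_(x in T) arrays s' aOut x == \sum_(x in T) arrays s' aIn x) <->
      (forall a b, nontree G par a b -> (a \in T) = (b \in T))).
Proof.
move=> st parE out0 in0.
apply: (wp_seq (t1 := 2) (t2 := 100 * (n + off L n) + 6)); last by clear; lia.
apply: wp_run => //=.
set s1 := set_reg _ _ _.
have st1 : stored k L L s1 by case: st.
pose I j s' := (forall v : 'I_n, v < j -> arrays s' aSize v = 1) /\
  forall T, balance T (fun a _ => a < j) s'.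
apply: (wp_weaken (t := 100 * (n + off L n) + 6) (Q := I n)) => //; last first.
  move=> s' [S1 B]; split=> [v|T]; first exact: S1.
  have [_ _ E] := B T; split=> [/eqP/E h a b|h]; first exact: h.
  by apply/eqP/E => a b _; apply: h.
apply: (wp_for_vertices (c := 80) (I := I) _ st1) => //; last 1 first.
- by clear; lia.
- split=> // T; split=> /=; rewrite !big1 // => x _; rewrite ?out0 ?in0 //.
move=> v s' sv st' fr [S1 B].
have par' x : arrays s' aPar x = arrays s aPar x by rewrite (proj2 fr).
apply: (wp_seq (t1 := 3) (t2 := 80 * (off L v.+1 - off L v) + 50)); last by clear; lia.
apply: wp_run => //=.
set s2 := set_cell _ _ _ _.
have st2 : stored k L L s2 by case: st'.
pose J i (s3 : state) := forall T, balance T (fun a b => (a < v) || (a == v) && (b \in take i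
  (L v))) s3.
apply: (wp_weaken (t := 80 * (off L v.+1 - off L v) + 50)
  (Q := fun s3 => (forall i, arrays s3 aSize i = arrays s2 aSize i) /\ J (size (L v)) s3)) =>
    //; last first.
  move=> s3 [S3 JL]; split=> /= [x|T].
    rewrite ltnS leq_eqVlt => /orP[/eqP E|xv]; rewrite S3 /= sv; first by rewrite E eqxx.
    by rewrite (ltn_eqF xv) S1.
  have [oi io E] := JL T; split=> //; rewrite E; split=> h a b dab nt; apply: h => //.
    move: dab; rewrite ltnS leq_eqVlt val_eqE => /orP[/eqP av|->//]; case/and3P: nt => Gab _ _.
    by rewrite av in Gab *; rewrite eqxx take_size (proj2 (L_lists v)) Gab orbT.
  by case/orP: dab => [/ltnW|/andP[/eqP-> _]].
have W : wp (slots rV weigh_body) (80 * (off L v.+1 - off L v) + 50) s2 (J (size (L v))).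
  apply: (wp_slots (L := L) (c := 60) (k := k) (M := L) (v := v) (I := J)) => //; last 1 first.
  - by clear; lia.
  - move=> T; have [oi io E] := B T; split=> //=; rewrite E; split=> h a b dab; apply: h.
      by move: dab; rewrite take0 andbF orbF.
    by rewrite dab.
  move=> i w s3 iL nw st3 s3V s3J adj fr3 JI.
  have Gvw : G v w by have [_ <-] := L_lists v; rewrite -nw mem_nth.
  have par3 (x : 'I_n) : arrays s3 aPar x = (par x).+1 by rewrite (proj2 fr3) //= par'.
  apply: wp_run => //=.
  rewrite s3J adj !neqE s3V !par3 !addn1 !eqSS !val_eqE.
  have skip s4 : regs s4 rC = regs s3 rC -> (forall a x, arrays s4 a x = arrays s3 a x) ->
      ~~ nontree G par v w -> J i.+1 s4.
    move=> cE aE nt T; have [oi io E] := JI T; rewrite /balance cE.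
    have S a : \sum_(x in T) arrays s4 a x = \sum_(x in T) arrays s3 a x by apply: eq_bigr.
    rewrite !S; split=> //; rewrite E; split=> h a b dab nab; apply: h => //.
      move: dab; rewrite (take_nth w) // nw mem_rcons inE => /orP[->//|/andP[/eqP av
        /orP[/eqP bw|->]]].
        by rewrite av bw (negPf nt) in nab.
      by rewrite av eqxx orbT.
    by move: dab; rewrite (take_nth w) // mem_rcons inE => /orP[->//|/andP[-> ->]];
      rewrite !orbT.
  rewrite /nontree Gvw /= in skip.
  case: ifP => [pw|/negbFE pw]; last by apply: skip; rewrite // pw andbF.
  case: ifP => [pv|/negbFE pv]; last by apply: skip; rewrite // pv.
  move=> T; apply: (balance_push (JI T) (v := v) (w := w)) => //=.
    by rewrite /nontree Gvw pv.
  move=> a b; rewrite (take_nth w) // nw mem_rcons inE.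
  by case: (a < v) => //=; case: (a == v); rewrite ?andbF //= orbC.
apply: wp_weaken (wp_frame W) (leqnn _) _ => s3 [[_ fa] HJ]; split=> // i.
by rewrite fa.
Qed.
End Weights.

(** * Sums over subtrees *)

Definition subtree_sums_body : cmd :=
  Seq (Assign rW (Read aQueue (Sub (Reg rN) (Reg rV))))
  (Seq (Assign rU (Sub (Read aPar (Reg rW)) (Const 1)))
  (Seq (Write aSize (Reg rU) (Add (Read aSize (Reg rU)) (Read aSize (Reg rW))))
  (Seq (Write aOut (Reg rU) (Add (Read aOut (Reg rU)) (Read aOut (Reg rW))))
       (Write aIn (Reg rU) (Add (Read aIn (Reg rU)) (Read aIn (Reg rW))))))).

(** With [rV] running from 1, the queue is read backwards from position [n - 1] to position 1:
    children before parents, and never the root, which is at position 0. *)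
Definition subtree_sums : cmd :=
  Seq (Assign rV (Const 1)) (For rV rN subtree_sums_body).

Section SubtreeSums.
Variables (n : nat) (G : sgraph n) (r : 'I_n) (par : 'I_n -> 'I_n) (q : seq 'I_n).
Hypothesis q_uniq : uniq q.
Hypothesis q_size : size q = n.
Hypothesis par_root : par r = r.
Hypothesis par_index : forall v, v != r -> index (par v) q < index v q.

(** Content of the cell of [v] when step [j] begins: its own value and the complete subtree sums of
    the children already treated, those at queue positions beyond [n - j]. *)
Let sum_below (f : 'I_n -> nat) (v : 'I_n) (j : nat) :=
  f v + \sum_(u | [&& u != r, par u == v & n - j < index u q]) \sum_(x in desc par u) f x.

Lemma mem_queue v : v \in q.
Proof.
apply: contraT => vq; have uv : uniq (v :: q) by rewrite /= vq.
by have := max_card (mem (v :: q)); rewrite (card_uniqP uv) card_ord /= q_size ltnn.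
Qed.

(** All children of [v] come later in the queue, so they have been added when the backward pass
    reaches [v]. *)
Lemma sum_below_self f v : sum_below f v (n - index v q) = \sum_(x in desc par v) f x.
Proof.
rewrite (sum_desc par_root par_index) /sum_below; congr (_ + _); apply: eq_bigl => u.
case: (eqVneq u r) => //= ur; case: (eqVneq (par u) v) => //= pu.
by rewrite subKn; [rewrite -pu par_index|rewrite ltnW // -[X in _ < X]q_size index_mem
  mem_queue].
Qed.

Lemma sum_belowS f v j (w : 'I_n) : 0 < j -> j < n -> index w q = n - j ->
  sum_below f v j.+1 = sum_below f v j + (par w == v) * \sum_(x in desc par w) f x.
Proof.
move=> j0 jn wj; rewrite /sum_below -addnA; congr (_ + _).
(* Every other vertex has its parent in front of it, so the root is the vertex at position 0,
   whereas [w] is at position [n - j], which is positive. *)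
have wr : w != r.
  apply/negP=> /eqP wr; pose v0 := nth r q 0.
  have i0 : index v0 q = 0 by rewrite index_uniq // q_size (leq_ltn_trans _ jn).
  case: (eqVneq v0 r) => [v0r|/par_index]; last by rewrite i0.
  by move: i0; rewrite v0r -wr wj; move: jn; clear; lia.
rewrite (bigID (fun u => u == w)) /= addnC; congr (_ + _).
  apply: eq_bigl => u; case: (eqVneq u w) => [->|uw] /=.
    by rewrite wj ltnn !andbF.
  rewrite andbT; congr [&& _, _ & _].
  have : index u q != n - j by rewrite -wj; apply: contra_neq uw => E;
    rewrite -(nth_index r (mem_queue u)) E nth_index ?mem_queue.
  by move: (index u q) j0 jn => m; clear; lia.
rewrite (eq_bigl (fun u => (par w == v) && (u == w))); last first.
  move=> u; case: (eqVneq u w) => [->|]; rewrite ?andbF // wr wj !andbT /=.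
  by case: (par w == v) => //=; move: j0 jn; clear; lia.
case: (par w == v); last by rewrite big_pred0.
rewrite mul1n; exact: big_pred1_eq.
Qed.

Lemma wp_subtree_sums s : regs s rN = n ->
  (forall i, i < n -> arrays s aQueue i = nth r q i) ->
  (forall v : 'I_n, arrays s aPar v = (par v).+1) ->
  wp subtree_sums (100 * n + 100) s (fun s' => forall a, a \in [:: aSize; aOut; aIn] ->
    forall v : 'I_n, arrays s' a v = \sum_(x in desc par v) arrays s a x).
Proof.
move=> sN Qq parE.
have n0 : 0 < n := leq_ltn_trans (leq0n r) (ltn_ord r).
apply: (wp_seq (t1 := 2) (t2 := 100 * n + 98)); last by clear; lia.
apply: wp_run => //=; set s1 := set_reg _ _ _.
pose I j s' := forall a, a \in [:: aSize; aOut; aIn] ->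
  forall v : 'I_n, arrays s' a v = sum_below (fun x => arrays s a x) v j.
apply: (wp_weaken (t := 100 * n + 98) (Q := I n)) => //; last first.
  move=> s' H a ain v; rewrite H // -sum_below_self /sum_below; congr (_ + _).
  apply: eq_bigl => u; case: (eqVneq u r) => //= ur; case: (eqVneq (par u) v) => //= pu.
  rewrite subnn subKn; last by rewrite ltnW // -[X in _ < X]q_size index_mem mem_queue.
  by rewrite -pu par_index // (leq_ltn_trans (leq0n _) (par_index ur)).
apply: (wp_for (c := 50) (lo := 1)) => //; last by clear; lia.
  move=> a ain v; rewrite /sum_below big_pred0 ?addn0 //= => u.
  have : index u q < n by rewrite -[X in _ < X]q_size index_mem mem_queue.
  by move=> h; rewrite (_ : n - 1 < index u q = false) ?andbF //; apply/negbTE; move: h;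
    clear; lia.
move=> j s' /andP[j0 jn] sj sN' fr Ij.
pose w := nth r q (n - j).
have nj : n - j < n by rewrite ltn_subrL j0.
have wj : index w q = n - j by rewrite index_uniq // q_size.
have Qw : arrays s' aQueue (n - j) = w by rewrite (proj2 fr) //= Qq.
have Pw : arrays s' aPar w = (par w).+1 by rewrite (proj2 fr) //= parE.
have wr : par w != w.
  apply/negP=> /eqP pw; case: (eqVneq w r) => [wr|/par_index]; last by rewrite pw ltnn.
  pose v0 := nth r q 0; have i0 : index v0 q = 0 by rewrite index_uniq // q_size.
  case: (eqVneq v0 r) => [v0r|/par_index]; last by rewrite i0.
  by move: i0; rewrite v0r -wr wj; move: jn; clear; lia.
apply: wp_run => //= a ain v.
have upd : arrays s' a (par w) + arrays s' a w = sum_below (fun x => arrays s a x) (par w) j.+1.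
  rewrite !Ij // (sum_belowS _ _ j0 jn wj) eqxx mul1n -(sum_below_self _ w) wj subKn //;
    exact: ltnW.
have old : v != par w -> arrays s' a v = sum_below (fun x => arrays s a x) v j.+1.
  by move=> vw; rewrite Ij // (sum_belowS _ _ j0 jn wj) eq_sym (negPf vw) addn0.
rewrite sN' sj Qw Pw subn1 /= !val_eqE.
by move: ain; rewrite !inE => /or3P[]/eqP ?; subst a => /=;
  case: (eqVneq v (par w)) => [->|vw]; rewrite ?upd ?old.
Qed.
End SubtreeSums.

(** The base [v * n] is accumulated by additions, as the machine has no multiplication. Only one
    cell of the table is written per list entry, which keeps the time linear although the addresses
    range up to [n * n]. *)
Definition index_slots : cmd :=
  Seq (Assign rC (Const 0))
      (for_vertices
        (Seq (Write aBase (Reg rV) (Reg rC))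
        (Seq (Assign rC (Add (Reg rC) (Reg rN)))
             (slots rV (Write aSlot (Add (Read aBase (Reg rV)) (Read aAdj (Reg rJ))) (Reg
               rJ)))))).

Definition slots_indexed n (A : {set 'I_n}) (L : 'I_n -> seq 'I_n) (o : nat -> nat) (s :
  state) : Prop :=
  forall v w : 'I_n, v \in A -> w \in L v -> arrays s aSlot (v * n + w) = o v + index w (L v).

Lemma pair_code_inj n (u v w x : 'I_n) : u * n + v = w * n + x -> u = w /\ v = x.
Proof.
move=> E; have n0 : 0 < n := leq_ltn_trans (leq0n u) (ltn_ord u).
have uw : u = w.
  by apply: ord_inj; have := congr1 (divn^~ n) E; rewrite !divnMDl // !divn_small // !addn0.
by split=> //; move: E; rewrite uw => /addnI/ord_inj.
Qed.

Section IndexSlots.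
Variables (n k : nat) (G : sgraph n) (L : 'I_n -> seq 'I_n).
Hypothesis L_lists : adjacency_lists G L.

Lemma wp_index_slots s : stored k L L s ->
  wp index_slots (100 * (n + off L n) + 100) s (fun s' =>
    (forall v : 'I_n, arrays s' aBase v = v * n) /\ slots_indexed setT L (off L) s').
Proof.
move=> st.
apply: (wp_seq (t1 := 2) (t2 := 100 * (n + off L n) + 6)); last by clear; lia.
apply: wp_run => //=; set s1 := set_reg _ _ _.
have st1 : stored k L L s1 by case: st.
pose I j s' := [/\ regs s' rC = j * n, forall v : 'I_n, v < j -> arrays s' aBase v = v * n
  & slots_indexed [set v : 'I_n | v < j] L (off L) s'].
apply: (wp_weaken (t := 100 * (n + off L n) + 6) (Q := I n)) => //; last first.
  move=> s' [_ B S]; split=> [v|v w _ wL]; first exact: B.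
  by apply: S => //; rewrite inE.
apply: (wp_for_vertices (c := 80) (I := I) _ st1) => //; last 1 first.
- by clear; lia.
- by split=> // v w; rewrite inE.
move=> v s' sv st' fr [C B S].
apply: (wp_seq (t1 := 3) (t2 := 80 * (off L v.+1 - off L v) + 70)); last by clear; lia.
apply: wp_run => //=; rewrite sv C.
apply: (wp_seq (t1 := 4) (t2 := 80 * (off L v.+1 - off L v) + 66)); last by clear; lia.
apply: wp_run => //=.
set s2 := set_reg _ _ _.
have st2 : stored k L L s2 by case: st'.
have Bv (x : 'I_n) : x < v.+1 -> arrays s2 aBase x = x * n.
  by rewrite /s2 /= ltnS leq_eqVlt; case: eqP => [->|_ /= /B].
pose J i s3 := forall u w : 'I_n, (u < v) && (w \in L u) || (u == v) && (w \in take i (L v)) ->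
  arrays s3 aSlot (u * n + w) = off L u + index w (L u).
have W : wp (slots rV (Write aSlot (Add (Read aBase (Reg rV)) (Read aAdj (Reg rJ))) (Reg rJ)))
   (80 * (off L v.+1 - off L v) + 66) s2 (J (size (L v))).
  apply: (wp_slots (L := L) (c := 60) (k := k) (M := L) (v := v) (I := J)) => //; last 1 first.
  - by clear; lia.
  - by move=> u w; rewrite take0 andbF orbF => /andP[uv wL]; apply: S; rewrite ?inE.
  move=> i w s3 iL nw st3 s3V s3J adj fr3 JI.
  apply: wp_run => //= u x hux; rewrite s3V s3J adj (proj2 fr3) // Bv //=.
  have Lv : uniq (L v) by case: (L_lists v).
  case: eqP => [/pair_code_inj[-> ->]|ne]; first by rewrite -nw index_uniq.
  apply: JI; move: hux; rewrite (take_nth w) // nw mem_rcons inE.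
  case/orP=> [->//|/andP[/eqP uv /orP[/eqP xw|->]]]; first by rewrite uv xw in ne.
  by rewrite uv eqxx orbT.
apply: wp_weaken (wp_frame W) (leqnn _) _ => s3 [[f3 fa] HJ]; split=> /=.
- by have [sn _ _ _] := st'; rewrite f3 //= C sn mulSn addnC.
- by move=> x xv; rewrite fa // Bv.
move=> u w; rewrite inE ltnS leq_eqVlt val_eqE => /orP[/eqP uv|uv] wL; apply: HJ.
  by rewrite uv eqxx take_size -uv wL orbT.
by rewrite uv wL.
Qed.
End IndexSlots.

Lemma run_seq c1 c2 s : run (Seq c1 c2) s = run c2 (run c1 s). Proof. by []. Qed.

Lemma run_if e c1 c2 s :
  run (If e c1 c2) s = if eval s e != 0 then run c1 s else run c2 s.
Proof. by []. Qed.

(** The nested tests form a conjunction: [rW] is a child of [rV], no non-tree edge leaves its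
    subtree, and both sides have more than [k] vertices. *)
Definition flag_test (e : expr) : cmd :=
  Seq (Assign rW e)
  (If (neq (Read aPar (Reg rW)) (Add (Reg rV) (Const 1))) Skip
  (If (neq (Read aOut (Reg rW)) (Read aIn (Reg rW))) Skip
  (If (Sub (Read aSize (Reg rW)) (Reg rK))
    (If (Sub (Reg rN) (Add (Add (Read aSize (Reg rW)) (Reg rK)) (Const 1)))
      (Write aFlag (Reg rV) (Const 1)) Skip)
    Skip))).

Definition flag_body : cmd :=
  Seq (Assign rJ (Read aOff (Reg rV)))
  (If (neq (Sub (Read aOff (Add (Reg rV) (Const 1))) (Reg rJ)) (Const 2)) Skip
    (Seq (flag_test (Read aAdj (Reg rJ)))
         (flag_test (Read aAdj (Add (Reg rJ) (Const 1)))))).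

Definition flag : cmd := for_vertices flag_body.

Section Flag.
Variables (n k : nat) (G : sgraph n) (L : 'I_n -> seq 'I_n).
Hypothesis L_lists : adjacency_lists G L.
Variables (r : 'I_n) (par : 'I_n -> 'I_n) (pos : 'I_n -> nat).
Hypothesis par_root : par r = r.
Hypothesis par_adj : forall v, v != r -> G v (par v).
Hypothesis par_pos : forall v, v != r -> pos (par v) < pos v.

Definition good_child (s : state) (v c : 'I_n) : bool :=
  [&& par c == v, arrays s aOut c == arrays s aIn c, k < arrays s aSize c
    & arrays s aSize c + k + 1 < n].

Definition suppressible_test (s : state) (v : 'I_n) : bool :=
  (size (L v) == 2) && has (good_child s v) (L v).

Lemma run_flag_test s e (v c : 'I_n) : regs s rN = n -> regs s rK = k -> regs s rV = v ->
  arrays s aPar c = (par c).+1 -> eval s e = c ->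
  run (flag_test e) s = if good_child s v c then set_cell (set_reg s rW c) aFlag v 1
                        else set_reg s rW c.
Proof.
move=> sn sk sv pc ec; rewrite /= ec !neqE sv sn sk pc !addn1 eqSS val_eqE /good_child.
case: (par c == v) => //=; case: (_ == _) => //=.
by rewrite !addn1 !subn_eq0 -!ltnNge; case: (k < _) => //=; case: (_ < n).
Qed.

Lemma wp_flag s : stored k L L s -> (forall v : 'I_n, arrays s aPar v = (par v).+1) ->
  (forall i, arrays s aFlag i = 0) ->
  wp flag (200 * (n + off L n) + 100) s (fun s' =>
    forall v : 'I_n, (arrays s' aFlag v != 0) = suppressible_test s v).
Proof.
move=> st parE flag0.
pose I j s' := forall v : 'I_n, (arrays s' aFlag v != 0) = (v < j) && suppressible_test s v.
apply: (wp_weaken (t := 200 * (n + off L n) + 100) (Q := I n)) => //; last first.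
  by move=> s' H v; rewrite H ltn_ord.
apply: (wp_for_vertices (c := 192) (I := I) _ st) => //; last 1 first.
- by clear; lia.
- by move=> v; rewrite /= flag0.
move=> v s' sv st' fr H; have [sn sk so sa] := st'.
have par' (c : 'I_n) : arrays s' aPar c = (par c).+1 by rewrite (proj2 fr).
(* The test reads neither the flags nor the registers just assigned, so trying one neighbour does
   not disturb the test of the other. *)
have good' c x : good_child (set_cell (set_reg (set_reg s' rJ (off L v)) rW c) aFlag v 1) v x
  = good_child s v x.
  by rewrite /good_child /= !(proj2 fr).
have good'' x : good_child (set_reg s' rJ (off L v)) v x = good_child s v x.
  by rewrite /good_child /= !(proj2 fr).
have good3 c x : good_child (set_reg (set_reg s' rJ (off L v)) rW c) v x = good_child s v x.
  by rewrite /good_child /= !(proj2 fr).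
apply: (wp_run (t := 192 * (off L v.+1 - off L v) + 192)) => //; first by rewrite /=; clear;
  lia.
have final b : b = suppressible_test s v -> forall s'',
   (forall x, arrays s'' aFlag x = if b && (x == v) then 1 else arrays s' aFlag x) ->
   I v.+1 (set_reg s'' rV v.+1).
  move=> -> s'' E x; rewrite /= E val_eqE ltnS leq_eqVlt val_eqE.
  case: (eqVneq x v) => [->|xv]; rewrite ?andbT ?andbF //= ?H //.
  by case: ifP => // _; rewrite H ltnn.
rewrite /flag_body run_seq [run (Assign _ _) _]/= sv so ?(ltnW (ltn_ord v)) //.
set s1 := set_reg s' rJ _.
have E : eval s1 (neq (Sub (Read aOff (Add (Reg rV) (Const 1))) (Reg rJ)) (Const 2)) != 0 =
  (size (L v) != 2).
  by rewrite neqE /= sv addn1 so // offS addKn.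
rewrite run_if E run_seq.
case: (boolP (size (L v) == 2)) => sz; last by apply: (final false);
  rewrite // /suppressible_test (negPf sz).
have [a [b Lv]] : exists a b, L v = [:: a; b] by case: (L v) sz => [|a [|b []]] // _;
  exists a, b.
have adj0 : arrays s' aAdj (off L v) = a by rewrite -[off L v]addn0 sa Lv.
have adj1 : arrays s' aAdj (off L v + 1) = b by rewrite sa Lv.
have T1 : run (flag_test (Read aAdj (Reg rJ))) s1 =
    if good_child s v a then set_cell (set_reg s1 rW a) aFlag v 1 else set_reg s1 rW a.
  by rewrite (run_flag_test (v := v) (c := a)) //= ?good''.
have T2 s2 : s2 = set_cell (set_reg s1 rW a) aFlag v 1 \/ s2 = set_reg s1 rW a ->
   run (flag_test (Read aAdj (Add (Reg rJ) (Const 1)))) s2 =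
    if good_child s v b then set_cell (set_reg s2 rW b) aFlag v 1 else set_reg s2 rW b.
  by case=> ->; rewrite (run_flag_test (v := v) (c := b)) //= ?good' ?good3.
apply: (final (good_child s v a || good_child s v b)).
  by rewrite /suppressible_test Lv /= orbF.
move=> x; rewrite T1 T2; last by case: ifP; auto.
by case: (good_child s v a); case: (good_child s v b) => //=; case: eqP.
Qed.

Lemma suppressible_testP s (v : 'I_n) :
  (forall c : 'I_n, arrays s aSize c = #|desc par c|) ->
  (forall c : 'I_n, (arrays s aOut c == arrays s aIn c) <->
     forall a b, nontree G par a b -> (a \in desc par c) = (b \in desc par c)) ->
  suppressible_test s v <-> suppressible G setT k v.
Proof.
move=> sizeE balE; rewrite (suppressible_child par_root par_adj par_pos) /suppressible_test.
have [uL LG] := L_lists v; split.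
  case/andP=> /eqP sz /hasP[c cL /and4P[/eqP pc /balE bal kc cn]]; rewrite sizeE in kc cn.
  have [d [cd LE]] : exists d, c != d /\ L v =i [:: c; d].
    case E: (L v) sz uL cL => [|a [|b []]] //= _; rewrite !inE andbT => ab.
    by case/orP=> /eqP->; [exists b|exists a]; split=> // [|x];
      rewrite 1?eq_sym // !inE // orbC.
  by exists c, d; split=> // b; rewrite -LG LE !inE.
case=> c [d [Gv cd pc /balE bal [kc cn]]].
have LE : L v =i [:: c; d] by move=> b; rewrite LG Gv !inE.
have ucd : uniq [:: c; d] by rewrite /= inE cd.
apply/andP; split; first by rewrite (perm_size (uniq_perm uL ucd LE)).
by apply/hasP; exists c; rewrite ?LE ?mem_head // /good_child pc eqxx bal sizeE kc cn.
Qed.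
End Flag.

(** * The reduced graph *)

(** In the list of each neighbour, the cell that held [v] receives the other neighbour, and the slot
    table learns where the ends of the new edge are stored. The list of [v] stays in memory, but [v]
    leaves the current vertex set. *)
Definition splice_body : cmd :=
  If (Read aFlag (Reg rV))
    (Seq (Assign rW (Read aAdj (Read aOff (Reg rV))))
    (Seq (Assign rU (Read aAdj (Add (Read aOff (Reg rV)) (Const 1))))
    (Seq (Assign rJ (Read aSlot (Add (Read aBase (Reg rW)) (Reg rV))))
    (Seq (Assign rE (Read aSlot (Add (Read aBase (Reg rU)) (Reg rV))))
    (Seq (Write aAdj (Reg rJ) (Reg rU))
    (Seq (Write aAdj (Reg rE) (Reg rW))
    (Seq (Write aSlot (Add (Read aBase (Reg rW)) (Reg rU)) (Reg rJ))
         (Write aSlot (Add (Read aBase (Reg rU)) (Reg rW)) (Reg rE)))))))))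
    Skip.

Definition splice : cmd := for_vertices splice_body.

Section Replace.
Variable T : eqType.
Implicit Types (l : seq T) (v w b : T).

Definition replace v b l := [seq if z == v then b else z | z <- l].

Lemma mem_replace v b l w : v \in l -> (w \in replace v b l) = (w == b) || (w != v) && (w \in
  l).
Proof.
move=> vl; apply/mapP/orP => [[z zl ->]|[/eqP->|/andP[wv wl]]].
- by case: (eqVneq z v) => [_|zv]; [left|right; rewrite zv].
- by exists v; rewrite ?eqxx.
- by exists w; rewrite ?(negPf wv).
Qed.

Lemma replace_uniq v b l : uniq l -> b \notin l -> uniq (replace v b l).
Proof.
move=> ul bl; rewrite map_inj_in_uniq // => x y xl yl.
case: (eqVneq x v) => [->|_]; case: (eqVneq y v) => [->|_] // E.
  by rewrite E yl in bl.
by rewrite -E xl in bl.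
Qed.

(** The new neighbour inherits the cell of [v], which is what the machine enters into the slot
    table. *)
Lemma index_replace v b l : b \notin l -> index b (replace v b l) = index v l.
Proof.
elim: l => //= z l IH; rewrite inE negb_or eq_sym => /andP[zb bl].
by case: (eqVneq z v) => [_|zv]; rewrite ?eqxx ?(negPf zb) ?IH.
Qed.

Lemma index_replace_other v b l w : w != v -> w != b -> index w (replace v b l) = index w l.
Proof.
move=> wv wb; elim: l => //= z l ->; case: (eqVneq z v) => [->|] //=.
by rewrite (eq_sym b) (negPf wb) (eq_sym v) (negPf wv).
Qed.
End Replace.

Lemma mem_pair_uniq (T : eqType) (s : seq T) x y : x != y -> uniq s -> s =i [:: x; y] ->
  s = [:: x; y] \/ s = [:: y; x].
Proof.
move=> xy us E; have sz : size s = 2.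
  by rewrite (perm_size (_ : perm_eq s [:: x; y])) // uniq_perm //= inE xy.
case: s us E sz => [|a [|b []]] // us E _; move: us; rewrite /= inE andbT.
have aE : (a == x) || (a == y) by have := E a; rewrite !inE eqxx.
have bE : (b == x) || (b == y) by have := E b; rewrite !inE eqxx orbT.
by case/orP: aE => /eqP->; case/orP: bE => /eqP->; rewrite ?eqxx; auto.
Qed.

Section Splice.
Variables (n k : nat) (G : sgraph n) (L : 'I_n -> seq 'I_n) (S : {set 'I_n}).

Lemma off_eqE (u v : 'I_n) i j : i < size (L u) -> j < size (L v) ->
  (off L u + i == off L v + j) = (u == v) && (i == j).
Proof.
move=> iu jv; apply/eqP/andP => [/(off_inj iu jv)[-> ->]|[/eqP-> /eqP->]] //; by rewrite !eqxx.
Qed.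

Lemma pair_code_eqE (u v w x : 'I_n) : (u * n + v == w * n + x) = (u == w) && (v == x).
Proof.
by apply/eqP/andP => [/pair_code_inj[-> ->]|[/eqP-> /eqP->]] //; rewrite !eqxx.
Qed.

Lemma nth_replace (v b : 'I_n) l i : uniq l -> v \in l -> i < size l ->
  nth 0 (map val (replace v b l)) i = if i == index v l then val b else nth 0 (map val l) i.
Proof.
move=> ul vl il; rewrite -map_comp !(nth_map v) //=.
case: (eqVneq i (index v l)) => [->|ne]; first by rewrite nth_index // eqxx.
by case: eqP => // E; rewrite -E index_uniq // eqxx in ne.
Qed.

Definition lists_on (A : {set 'I_n}) (e : rel 'I_n) (M : 'I_n -> seq 'I_n) : Prop :=
  forall v, v \in A -> uniq (M v) /\ forall u, (u \in M v) = e v u.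

Definition splice_lists (M : 'I_n -> seq 'I_n) (v a b u : 'I_n) : seq 'I_n :=
  if u == a then replace v b (M a) else if u == b then replace v a (M b) else M u.

Lemma splice_lists_on A e M v a b : graph_on e A -> lists_on A e M ->
  v \in A -> M v = [:: a; b] -> ~~ e a b ->
  lists_on (A :\ v) (suppress e v a b) (splice_lists M v a b).
Proof.
move=> [es ei eA] ML vA Mv eab u; rewrite !inE => /andP[uv uA].
have evE w : e v w = (w == a) || (w == b) by rewrite -(proj2 (ML v vA)) Mv !inE.
have ab : a != b by have := proj1 (ML v vA); rewrite Mv /= inE andbT.
have eva : e v a by rewrite evE eqxx.
have evb : e v b by rewrite evE eqxx orbT.
have aA : a \in A by apply: (eA a v); rewrite es.
have bA : b \in A by apply: (eA b v); rewrite es.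
have [ua ma] := ML a aA; have [ub mb] := ML b bA.
have va : v \in M a by rewrite ma es.
have vb : v \in M b by rewrite mb es.
have av : a != v by apply: contraTneq eva => ->; rewrite ei.
have bv : b != v by apply: contraTneq evb => ->; rewrite ei.
rewrite /splice_lists /suppress; case: (eqVneq u a) => [->|ne_ua].
  split; first by rewrite replace_uniq // ma.
  move=> w; rewrite mem_replace // ma av /= (negPf ab) /= orbF orbC.
  by case: (eqVneq w b) => [->|wb]; rewrite ?bv ?orbT ?orbF.
case: (eqVneq u b) => [->|ne_ub].
  split; first by rewrite replace_uniq // mb es.
  move=> w; rewrite mem_replace // mb bv /= orbC.
  by case: (eqVneq w a) => [->|wb]; rewrite ?av ?orbT ?orbF.
have [uu mu] := ML u uA; split=> // w; rewrite mu uv /= orbF.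
case: (eqVneq w v) => [->|//]; by rewrite es evE (negPf ne_ua) (negPf ne_ub).
Qed.

(** The current vertex set, adjacency relation and lists are ghost data; the offsets remain those of
    the input lists [L]. *)
Definition spliced (i : nat) (s : state) : Prop :=
  exists (A : {set 'I_n}) e M, [/\ A = [set v : 'I_n | ~~ ((v < i) && (v \in S))] /\ reduct G
    k S e A,
    lists_on A e M, forall v, size (M v) = size (L v), stored k L M s
    & slots_indexed A M (off L) s].

Lemma wp_splice s : (forall v : 'I_n, (arrays s aFlag v != 0) = (v \in S)) ->
  (forall v : 'I_n, arrays s aBase v = v * n) -> spliced 0 s ->
  wp splice (100 * n + 100) s (spliced n).
Proof.
move=> flagE baseE I0.
have sn : regs s rN = n by case: I0 => A [e [M [_ _ _ [] ]]].
apply: (wp_seq (t1 := 2) (t2 := 100 * n + 98)); last by clear; lia.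
apply: wp_run => //=; set s1 := set_reg _ _ _.
apply: (wp_for (c := 60) (lo := 0) (I := spliced)) => //; last 1 first.
- by clear; lia.
move=> j s' /andP[_ jn] sj sN' fr [A [e [M [[AE RA] LM SM st SI]]]].
pose v := Ordinal jn; have vA : v \in A by rewrite AE inE /= ltnn.
have flagj : (arrays s' aFlag j != 0) = (v \in S) by rewrite (proj2 fr) //= (flagE v).
have base' (x : 'I_n) : arrays s' aBase x = x * n by rewrite (proj2 fr) //= baseE.
have [_ sk so sa] := st.
apply: wp_run => //=; rewrite sj flagj; case: (boolP (v \in S)) => vS; last first.
  exists A, e, M; split=> //; split=> //; rewrite AE; apply/setP=> x;
    rewrite !inE /= [in RHS]ltnS [in RHS]leq_eqVlt.
  case: eqP => // xj; have -> : x = v by apply: ord_inj; exact: xj.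
  by rewrite (negPf vS) ?andbF.
have [[Ge Ce] _ sides _ _] := RA.
have vS' : v \in A :&: S by rewrite inE vA.
have [X [x [y [Sv _ _]]]] := sides v vS'.
have [xv yv xy exy [xA yA _]] := splits_facts Ge Sv; have [_ _ _ ev _] := Sv.
have [es _ _] := Ge; have [uv mv] := LM v vA.
(* The list of [v] may contain the two neighbours in either order. *)
have [a [b [Mv abxy]]] : exists a b, M v = [:: a; b] /\ ((a = x /\ b = y) \/ (a = y /\ b = x)).
  have E : M v =i [:: x; y] by move=> z; rewrite mv ev !inE.
  by case: (mem_pair_uniq xy uv E) => ->; [exists x, y|exists y, x]; auto.
have [ab av bv [aA bA eab]] : [/\ a != b, a != v, b != v & [/\ a \in A, b \in A & ~~ e a b]].
  by case: abxy => [[-> ->]|[-> ->]]; rewrite ?(eq_sym y x) ?[e y x]es exy.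
have eva : e v a by rewrite -mv Mv mem_head.
have evb : e v b by rewrite -mv Mv !inE eqxx orbT.
have va : v \in M a by rewrite (proj2 (LM a aA)) es.
have vb : v \in M b by rewrite (proj2 (LM b bA)) es.
have bMa : b \notin M a by rewrite (proj2 (LM a aA)).
have aMb : a \notin M b by rewrite (proj2 (LM b bA)) es.
have adj0 : arrays s' aAdj (off L j) = a by rewrite -[off L j]addn0 (sa v) Mv.
have adj1 : arrays s' aAdj (off L j + 1) = b by rewrite (sa v) Mv.
rewrite so ?(ltnW jn) // adj0 adj1 !base' (SI a v) // (SI b v) //=.
have [ia ib] : index v (M a) < size (L a) /\ index v (M b) < size (L b).
  by rewrite -!SM !index_mem.
exists (A :\ v), (suppress e v a b), (splice_lists M v a b); split.
- split; last exact: reduct_step RA vS' eva evb ab.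
  rewrite AE; apply/setP=> z; rewrite !inE /= -val_eqE /= [in RHS]ltnS [in RHS]leq_eqVlt.
  case: eqP => //= zj; have -> : z = v by apply: ord_inj; exact: zj.
  by rewrite vS.
- exact: splice_lists_on.
- move=> u; rewrite /splice_lists; case: (eqVneq u a) => [->|_]; first by rewrite size_map.
  by case: (eqVneq u b) => [->|_] //; rewrite size_map.
- split=> //= u i hi; have ui : i < size (L u).
    move: hi; rewrite /splice_lists; case: (eqVneq u a) => [->|_]; first by rewrite size_map SM.
    by case: (eqVneq u b) => [->|_]; rewrite ?size_map SM.
  have [uMa _] := LM a aA; have [uMb _] := LM b bA.
  rewrite !(off_eqE ui) //; move: hi; rewrite /splice_lists; case: (eqVneq u a) => [->|_] /=.
    by rewrite (negPf ab) size_map => hi; rewrite nth_replace //=; case: eqP => // _;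
      rewrite sa.
  case: (eqVneq u b) => [->|_] /= hi; last by rewrite sa.
  by rewrite size_map in hi; rewrite nth_replace //=; case: eqP => // _; rewrite sa.
move=> u w; rewrite !inE /= !pair_code_eqE => /andP[uv' uA] wM.
move: wM; rewrite /splice_lists; case: (eqVneq u a) => [->|ua] /=.
  rewrite (negPf ab) /= mem_replace // => wM; case: (eqVneq w b) => [->|wb] /=.
    by rewrite index_replace.
  move: wM; rewrite (negPf wb) /= => /andP[wv wM].
  by rewrite index_replace_other // SI.
case: (eqVneq u b) => [->|ub] /=.
  rewrite mem_replace // => wM; case: (eqVneq w a) => [->|wa] /=.
    by rewrite index_replace.
  move: wM; rewrite (negPf wa) /= => /andP[wv wM].
  by rewrite index_replace_other // SI.
by move=> wM; rewrite SI.
Qed.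
End Splice.

(** * Renumbering and output of the reduced graph *)

Definition renumber : cmd :=
  Seq (Assign rC (Const 0))
      (for_vertices
        (If (Read aFlag (Reg rV)) Skip
          (Seq (Write aNew (Reg rV) (Reg rC)) (Assign rC (Add (Reg rC) (Const 1)))))).

(* The registers and arrays from 20 on are those of the renamed copy of the
   given program. *)
Definition emit_vertex : cmd :=
  Seq (Write (20 + aOff) (Read aNew (Reg rV)) (Reg rU))
      (slots rV
        (Seq (Write (20 + aAdj) (Reg rU) (Read aNew (Read aAdj (Reg rJ))))
             (Assign rU (Add (Reg rU) (Const 1))))).

(** The input format has one offset more than there are vertices; the last write supplies it and
    thereby closes the last list. *)
Definition emit : cmd :=
  Seq (Assign rU (Const 0))
  (Seq (for_vertices (If (Read aFlag (Reg rV)) Skip emit_vertex))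
       (Write (20 + aOff) (Reg rC) (Reg rU))).

Section Output.
Variables (n k : nat) (L M : 'I_n -> seq 'I_n) (S : {set 'I_n}).
Hypothesis M_size : forall v, size (M v) = size (L v).

Let kept j := [seq u <- take j (enum 'I_n) | u \notin S].

Lemma keptS (v : 'I_n) : kept v.+1 = if v \in S then kept v else rcons (kept v) v.
Proof.
rewrite /kept (take_nth v) ?size_enum_ord // nth_ord_enum filter_rcons.
by case: (v \in S).
Qed.

Lemma kept_all : kept n = enum (~: S).
Proof.
rewrite /kept take_oversize ?size_enum_ord // enumT /enum_mem.
by apply: eq_filter => v; rewrite !inE.
Qed.

(** Hence a counter of the kept vertices met so far yields the numbering by [enum (~: S)]. *)
Lemma index_kept (v : 'I_n) : v \notin S -> index v (enum (~: S)) = size (kept v).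
Proof.
move=> vS; have vk : v \notin kept v.
  rewrite mem_filter vS /=; apply/negP=> /(nthP v)[i];
    rewrite size_take size_enum_ord ltn_ord => iv.
  by rewrite nth_take // => /(congr1 val) /=; rewrite nth_enum_ord ?(ltn_trans iv) // => E;
    rewrite E ltnn in iv.
have -> : enum (~: S) = rcons (kept v) v ++ [seq u <- drop v.+1 (enum 'I_n) | u \notin S].
  have := keptS v; rewrite (negPf vS) => <-.
  by rewrite -filter_cat cat_take_drop -kept_all /kept take_oversize ?size_enum_ord.
by rewrite -cats1 -catA index_cat (negPf vk) /= eqxx addn0.
Qed.

Lemma wp_renumber s : stored k L M s ->
  (forall v : 'I_n, (arrays s aFlag v != 0) = (v \in S)) ->
  wp renumber (100 * (n + off L n) + 100) s (fun s' => regs s' rC = #|~: S| /\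
    forall v : 'I_n, v \notin S -> arrays s' aNew v = index v (enum (~: S))).
Proof.
move=> st flagE.
apply: (wp_seq (t1 := 2) (t2 := 100 * (n + off L n) + 98)); last by clear; lia.
apply: wp_run => //=; set s1 := set_reg _ _ _.
have st1 : stored k L M s1 by case: st.
pose I j s' := regs s' rC = size (kept j) /\
  forall v : 'I_n, v < j -> v \notin S -> arrays s' aNew v = index v (enum (~: S)).
apply: (wp_weaken (t := 100 * (n + off L n) + 98) (Q := I n)) => //; last first.
  by move=> s' [C N]; split=> [|v]; [rewrite C kept_all -cardE|apply: N].
apply: (wp_for_vertices (c := 60) (I := I) _ st1) => //; last 1 first.
- by clear; lia.
- by split=> //; rewrite /kept take0.
move=> v s' sv st' fr [C N].
apply: wp_run => //=; first by clear; lia.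
have -> : (arrays s' aFlag (regs s' rV) != 0) = (v \in S) by rewrite sv (proj2 fr) //= flagE.
rewrite /I keptS; case: (boolP (v \in S)) => vS /=.
  split=> // x; rewrite ltnS leq_eqVlt val_eqE => /orP[/eqP->|]; [by rewrite vS|exact: N].
rewrite size_rcons C addn1; split=> // x; rewrite ltnS leq_eqVlt sv.
by case: eqP => [/ord_inj-> _ _|_ /=]; [rewrite index_kept|apply: N].
Qed.

Let new w := index w (enum (~: S)).
Let table j := [seq [seq new w | w <- M u] | u <- kept j].

Let table_all := [seq [seq new w | w <- M u] | u <- enum (~: S)].

(** The cells are described for all indices, including the zeros beyond the end, because the given
    program must find exactly the memory of [input_state]. *)
Lemma wp_emit s : stored k L M s ->
  (forall v : 'I_n, (arrays s aFlag v != 0) = (v \in S)) ->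
  (forall v : 'I_n, v \notin S -> arrays s aNew v = new v) ->
  (forall v w : 'I_n, v \notin S -> w \in M v -> w \notin S) ->
  regs s rC = #|~: S| -> (forall i, arrays s 20 i = 0) -> (forall i, arrays s 21 i = 0) ->
  wp emit (100 * (n + off L n) + 100) s (fun s' => 
    [/\ regs s' rU = size (flatten table_all),
        forall i, arrays s' 20 i = if i <= #|~: S| then sumn (take i (shape table_all)) else 0
      & forall i, arrays s' 21 i = nth 0 (flatten table_all) i]).
Proof.
move=> st flagE newE MS cS z20 z21.
apply: (wp_seq (t1 := 2) (t2 := 100 * (n + off L n) + 98)); last by clear; lia.
apply: wp_run => //=; set s1 := set_reg _ _ _.
have st1 : stored k L M s1 by case: st.
pose I j s' := [/\ regs s' rU = size (flatten (table j)),
  forall i, arrays s' 20 i = if i < size (kept j) then sumn (take i (shape (table j))) else 0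
  & forall i, arrays s' 21 i = nth 0 (flatten (table j)) i].
apply: (wp_seq (t1 := 100 * (n + off L n) + 90) (t2 := 3)); last by clear; lia.
have W : wp (for_vertices (If (Read aFlag (Reg rV)) Skip emit_vertex)) (100 * (n + off L n) +
  90) s1 (I n).
  apply: (wp_for_vertices (c := 80) (I := I) _ st1) => //; last 1 first.
  - by clear; lia.
  - by rewrite /I /table /kept take0 /=; split=> // i; rewrite ?z20 ?z21 ?nth_nil.
  move=> v s' sv st' fr [U O A].
  apply: (wp_weaken (t := (2 + (80 * (off L v.+1 - off L v) + 70)).+1)
    (Q := fun s'' => I v.+1 (set_reg s'' rV v.+1))) => //; last by clear; lia.
  apply: wp_if => /=.
  have -> : (arrays s' aFlag (regs s' rV) != 0) = (v \in S) by rewrite sv (proj2 fr) //= flagE.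
  have new' w : w \notin S -> arrays s' aNew w = new w by move=> wS;
    rewrite (proj2 fr) //= newE.
  case: (boolP (v \in S)) => vS.
    apply: wp_run => //=; first by clear; lia.
    by rewrite /I /table keptS vS.
  apply: (wp_seq (t1 := 4) (t2 := 80 * (off L v.+1 - off L v) + 66)); last by clear; lia.
  apply: wp_run => //=; rewrite sv new' // U.
  set s2 := set_cell _ _ _ _.
  have st2 : stored k L M s2 by case: st'.
  pose J i s3 := regs s3 rU = size (flatten (table v)) + i /\
    forall x, arrays s3 21 x = nth 0 (flatten (table v) ++ take i [seq new w | w <- M v]) x.
  have W : wp (slots rV (Seq (Write (20 + aAdj) (Reg rU) (Read aNew (Read aAdj (Reg rJ))))
             (Assign rU (Add (Reg rU) (Const 1))))) (80 * (off L v.+1 - off L v) + 66) s2 (J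
               (size (M v))).
    apply: (wp_slots (L := L) (c := 60) (k := k) (M := M) (v := v) (I := J)) => //;
      last 1 first.
    - by clear; lia.
    - by split=> /= [|x]; rewrite ?U ?addn0 // take0 cats0.
    move=> i w s3 iM nw st3 s3V s3J adj fr3 [U3 A3].
    have wS : w \notin S by apply: (MS v) => //; rewrite -nw mem_nth.
    apply: wp_run => //=; split=> /=; first by rewrite U3 addn1 addnS.
    move=> x; rewrite s3J adj (proj2 fr3) // [arrays s2 _ _]/= new' // U3 A3.
    rewrite (take_nth 0) ?size_map // (nth_map w) // nw -cats1 catA [in RHS]nth_cat.
    rewrite [size (_ ++ _)]size_cat size_takel ?size_map ?(ltnW iM) //;
      case: ltngtP => // [gt|->].
      rewrite nth_default; last by rewrite size_cat size_takel ?size_map ?(ltnW iM) // ltnW.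
      by rewrite nth_default // subn_gt0.
    by rewrite subnn.
  apply: wp_weaken (wp_frame W) (leqnn _) _ => s3 [[f3 fa] [U3 A3]].
  have tabS : table v.+1 = rcons (table v) [seq new w | w <- M v].
    by rewrite /table keptS (negPf vS) map_rcons.
  rewrite /I tabS; split=> /=.
  - by rewrite U3 flatten_rcons size_cat size_map.
  - move=> i; rewrite fa //= O keptS (negPf vS) size_rcons /new index_kept // [in RHS]ltnS
      [in RHS]leq_eqVlt.
    rewrite /shape map_rcons -/(shape _).
    have sz : size (shape (table v)) = size (kept v) by rewrite !size_map.
    case: eqP => [->|_] /=; first by rewrite -cats1 take_size_cat // size_flatten.
    by case: ifP => // iv; rewrite -cats1 takel_cat // sz ltnW.
  - by move=> i; rewrite A3 take_oversize ?size_map // flatten_rcons.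
apply: wp_weaken (wp_frame W) (leqnn _) _ => s' [[fr fa] [U O A]].
apply: wp_run => //=.
have sk : size (kept n) = #|~: S| by rewrite kept_all -cardE.
have tE : table_all = table n by rewrite /table kept_all.
rewrite tE; split=> //= i; rewrite fr //= cS U O sk.
have sz : size (shape (table n)) = #|~: S| by rewrite !size_map.
rewrite [in RHS]leq_eqVlt; case: eqP => [->|_] //=.
by rewrite -sz take_size size_flatten.
Qed.
End Output.

(** * The reduced graph as a graph on ordinals *)

Section KernelGraph.
Variables (n : nat) (K : {set 'I_n}) (e : rel 'I_n) (M : 'I_n -> seq 'I_n).
Hypothesis e_graph : graph_on e K.
Hypothesis e_connected : connected_on e K.
Hypothesis M_lists : lists_on K e M.

Let val_adj : rel 'I_#|K| := fun u v => e (enum_val u) (enum_val v).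

Lemma kernel_sym : symmetric val_adj.
Proof. by move=> u v; case: e_graph => es _ _; apply: es. Qed.

Lemma kernel_irr : irreflexive val_adj.
Proof. by move=> u; case: e_graph => _ ei _; apply: ei. Qed.

Definition kernel_graph : sgraph #|K| := SGraph kernel_sym kernel_irr.

(** The default [u] of [insubd] is never taken, since neighbours of members of [K] lie in [K]. *)
Definition kernel_lists (u : 'I_#|K|) : seq 'I_#|K| :=
  [seq insubd u (index w (enum K)) | w <- M (enum_val u)].

Lemma kernel_lists_in (u : 'I_#|K|) w : w \in M (enum_val u) -> w \in K.
Proof.
have [_ Mu] := M_lists (enum_valP u); rewrite Mu; case: e_graph => es _ eK.
by rewrite es; apply: eK.
Qed.

Lemma val_insub_index (u : 'I_#|K|) w : w \in K -> val (insubd u (index w (enum K))) = index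
  w (enum K).
Proof.
move=> wK; have iK : index w (enum K) < #|K| by rewrite cardE index_mem mem_enum.
by rewrite val_insubd iK.
Qed.

Lemma enum_val_insub (u : 'I_#|K|) w : w \in K -> enum_val (insubd u (index w (enum K))) = w.
Proof.
move=> wK; rewrite (enum_val_nth w) -[nat_of_ord _]/(val _) val_insub_index // nth_index //.
by rewrite mem_enum.
Qed.

Lemma kernel_adjacency : adjacency_lists kernel_graph kernel_lists.
Proof.
move=> u; have [uM Mu] := M_lists (enum_valP u); split.
  rewrite map_inj_in_uniq // => x y /kernel_lists_in xK /kernel_lists_in yK E.
  by rewrite -(enum_val_insub u xK) E enum_val_insub.
move=> v; rewrite /= /val_adj -Mu; apply/mapP/idP => [[w wM ->]|vM].
  by rewrite enum_val_insub // (kernel_lists_in wM).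
exists (enum_val v) => //; apply: val_inj; rewrite val_insub_index ?enum_valP //.
by rewrite {1}(enum_val_nth (enum_val v)) index_uniq ?enum_uniq // -cardE.
Qed.

(** Identifies the table written by [emit] with the one that [input_state] derives from
    [kernel_lists]. *)
Lemma kernel_list_table :
  list_table kernel_lists = [seq [seq index w (enum K) | w <- M u] | u <- enum K].
Proof.
have E : [seq enum_val u | u <- enum 'I_#|K|] = enum K.
  case: (set_0Vmem K) => [K0|[w wK]].
    have K0' : #|K| = 0 by rewrite K0 cards0.
    have -> : enum K = [::] by apply: size0nil; rewrite -cardE.
    by apply/size0nil; rewrite size_map size_enum_ord.
  apply: (eq_from_nth (x0 := w)); first by rewrite size_map size_enum_ord -cardE.
  move=> i; rewrite size_map size_enum_ord => iK;
    rewrite (nth_map (Ordinal iK)) ?size_enum_ord //.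
  by rewrite (enum_val_nth w) nth_enum_ord.
transitivity [seq [seq index w (enum K) | w <- M (enum_val u)] | u <- enum 'I_#|K|]; last first.
  by rewrite (map_comp (fun u => [seq index w (enum K) | w <- M u]) enum_val) E.
apply: eq_map => u /=; rewrite /kernel_lists -map_comp.
by apply/eq_in_map => w /kernel_lists_in wK; exact: (val_insub_index u wK).
Qed.

Lemma kernel_connected : K != set0 -> connected kernel_graph.
Proof.
move=> K0; split; first by rewrite card_gt0.
move=> u v; pose C := [set enum_val w | w in [pred w | connect kernel_graph u w]].
have CE : C = K.
  apply: (e_connected (a := enum_val u)).
  - by apply/subsetP=> _ /imsetP[w _ ->]; apply: enum_valP.
  - by apply/imsetP; exists u; rewrite ?inE.
  move=> _ c /imsetP[w uw ->] ec; case: e_graph => es _ eK.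
  have cK : c \in K by apply: (eK c (enum_val w)); rewrite es.
  apply/imsetP; exists (enum_rank_in cK c); last by rewrite enum_rankK_in.
  by rewrite inE in uw *; apply: connect_trans uw (connect1 _);
    rewrite /= /val_adj enum_rankK_in.
have : enum_val v \in C by rewrite CE enum_valP.
by case/imsetP=> w; rewrite inE => uw /enum_val_inj ->.
Qed.

Lemma kernel_arrangeable k : arrangeable kernel_graph setT k <-> arrangeable e K k.
Proof.
apply: (@arrangeable_imset _ _ (@enum_val _ (mem K))) => //; first exact: enum_val_inj.
apply/setP=> w; apply/idP/imsetP => [wK|[u _ ->]]; last exact: enum_valP.
by exists (enum_rank_in wK w); rewrite ?inE // enum_rankK_in.
Qed.
End KernelGraph.

(** Together with at most [5 * k + 2] vertices this gives at most [6 * k + 1] edges. *)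
Lemma edges_lt n (G : sgraph n) k : 0 < n -> arrangeable G setT k -> #|edges G| < n + k.
Proof.
move=> n0 [p pI pk].
have GG := sgraph_graph_on G.
have E : #|edges G| = #|forward_edges G p|.
  apply: double_inj; rewrite -card_edges; apply: handshake.
  - exact: adjacent_sym.
  - exact: adjacent_irr.
  by move=> a b _; apply: pI; rewrite inE.
have T0 : [set: 'I_n] != set0 by apply/set0Pn; exists (Ordinal n0); rewrite inE.
have := card_forward_edges GG pI T0; rewrite -E cardsT card_ord => h.
by apply: leq_trans h _; rewrite leq_add2l.
Qed.

(** The answer is no if the reduced graph has more than [5 * k + 2] vertices, or at least [n' + k]
    edges for [n'] vertices. The second test is doubled on both sides because [rU] holds the total
    length of the lists, twice the number of edges. Otherwise [P] is run on the copy. *)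
Definition finish (P : cmd) : cmd :=
  If (Sub (Reg rC) (Add (Add (Add (Add (Add (Reg rK) (Reg rK)) (Reg rK)) (Reg rK)) (Reg rK))
    (Const 2)))
    (Assign rN (Const 0))
  (If (Sub (Add (Reg rU) (Const 2)) (Add (Add (Reg rC) (Reg rC)) (Add (Reg rK) (Reg rK))))
    (Assign rN (Const 0))
    (Seq (Assign (20 + rN) (Reg rC))
    (Seq (Assign (20 + rK) (Reg rK))
    (Seq (shift 20 P)
         (Assign rN (Reg (20 + rN))))))).

Definition reduce : cmd :=
  Seq bfs (Seq weigh (Seq subtree_sums (Seq index_slots (Seq flag (Seq splice (Seq renumber
    emit)))))).

Lemma input_stored k n (L : 'I_n -> seq 'I_n) : stored k L L (input_state k L).
Proof.
split=> //= [i in_|v i iL]; first by rewrite in_.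
exact: nth_flatten_table.
Qed.

(** [connected] asks for at least one vertex. If some vertex is suppressible, each of its sides has
    more than [k] vertices outside [S]. *)
Lemma kept_nonempty n (G : sgraph n) k (S : {set 'I_n}) : connected G ->
  (forall v, v \in S <-> suppressible G setT k v) -> ~: S != set0.
Proof.
move=> CG HS; have [n0 _] := CG.
have R := reduct_init (sgraph_graph_on G) (connected_onP CG) HS.
pose v := Ordinal n0; case: (boolP (v \in S)) => vS; last by apply/set0Pn; exists v;
  rewrite inE.
case: R => _ _ sides _ _; have [|X [x [y [_ kX _]]]] := sides v; first by rewrite !inE.
have /card_gt0P[z] : 0 < #|X :\: S| by apply: leq_ltn_trans kX.
by rewrite inE => /andP[zS _]; apply/set0Pn; exists z; rewrite inE.
Qed.

Definition reduced k n (G : sgraph n) (s' : state) : Prop :=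
  exists n' (G' : sgraph n') (L' : 'I_n' -> seq 'I_n'),
  [/\ connected G', adjacency_lists G' L',
      (ola_plus G' <= k) = (ola_plus G <= k) /\ (ola_plus G <= k -> n' <= 5 * k + 2),
      [/\ regs s' rN = n, regs s' rK = k, regs s' rC = n' & regs s' rU = #|edges G'|.*2]
    & (forall i, arrays s' 20 i = arrays (input_state k L') 0 i) /\
      (forall i, arrays s' 21 i = arrays (input_state k L') 1 i)].

Lemma wp_reduce k n (G : sgraph n) (L : 'I_n -> seq 'I_n) :
  connected G -> adjacency_lists G L ->
  wp reduce (2000 * (n + #|edges G|.*2)) (input_state k L) (reduced k G).
Proof.
move=> CG LG; have [n0 _] := CG; set s0 := input_state k L.
have st0 : stored k L L s0 := input_stored k L.
have [r r0] : exists r : 'I_n, r = 0 :> nat by exists (Ordinal n0).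
rewrite -(off_sum LG); set N := n + off L n.
have [nN N0] : n <= N /\ 0 < N by rewrite /N; move: n0; clear; lia.
(* As [N] is positive, additive constants are absorbed. The shares of the eight phases, 200, 200,
   200, 200, 300, 200, 200 and 500, add up to 2000. *)
have t200 : 100 * N + 100 <= 200 * N by move: N0; clear; lia.
have t200n : 100 * n + 100 <= 200 * N by move: nN N0; clear; lia.
have t300 : 200 * N + 100 <= 300 * N by move: N0; clear; lia.
apply: (wp_seq (t1 := 200 * N) (t2 := 1800 * N)); last by clear; lia.
apply: wp_weaken (wp_frame (wp_bfs CG LG r0 st0 _ _ _)) (t200) _ => // s1.
case=> F1 [q [par [[uq sq] Qq parE par_r tree]]].
have st1 := stored_frame F1 isT st0.
have par_adj v : v != r -> G v (par v) by case/tree.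
have par_index v : v != r -> index (par v) q < index v q by case/tree.
apply: (wp_seq (t1 := 200 * N) (t2 := 1600 * N)); last by clear; lia.
apply: wp_weaken (wp_frame (wp_weigh LG st1 parE _ _)) (t200) _; try by move=> i;
  rewrite (proj2 F1).
move=> s2 [F2 [size1 bal]]; have st2 := stored_frame F2 isT st1.
apply: (wp_seq (t1 := 200 * N) (t2 := 1400 * N)); last by clear; lia.
have acc := wp_subtree_sums (s := s2) uq sq par_r par_index.
apply: wp_weaken (wp_frame (acc _ _ _)) (t200n) _.
- by case: st2.
- by move=> i hi; rewrite (proj2 F2) // Qq.
- by move=> v; rewrite (proj2 F2).
move=> {acc} s3 [F3 acc]; have st3 := stored_frame F3 isT st2.
apply: (wp_seq (t1 := 200 * N) (t2 := 1200 * N)); last by clear; lia.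
apply: wp_weaken (wp_frame (wp_index_slots LG st3)) (t200) _ => s4 [F4 [baseE slotE]].
have st4 := stored_frame F4 isT st3.
apply: (wp_seq (t1 := 300 * N) (t2 := 900 * N)); last by clear; lia.
have par4 (v : 'I_n) : arrays s4 aPar v = (par v).+1.
  by rewrite (proj2 F4) // (proj2 F3) // (proj2 F2).
apply: wp_weaken (wp_frame (wp_flag st4 par4 _)) (t300) _.
  by move=> i; rewrite (proj2 F4) // (proj2 F3) // (proj2 F2) // (proj2 F1).
move=> s5 [F5 flagE]; have st5 := stored_frame F5 isT st4.
(* The set is read off from the machine's own test; [HS] then identifies it with the suppressible
   vertices of [G]. *)
pose S := [set v | suppressible_test k L par s4 v].
have HS v : v \in S <-> suppressible G setT k v.
  rewrite inE; apply: (@suppressible_testP n k G L LG r par (index^~ q) par_r par_adj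
    par_index) => c.
    rewrite (proj2 F4) // acc // -sum1_card; apply: eq_bigr => x _; exact: size1.
  by rewrite !(proj2 F4) // !acc // bal.
have {}flagE (v : 'I_n) : (arrays s5 aFlag v != 0) = (v \in S) by rewrite flagE inE.
apply: (wp_seq (t1 := 200 * N) (t2 := 700 * N)); last by clear; lia.
apply: wp_weaken (wp_frame (wp_splice (k := k) (G := G) (L := L) (S := S) flagE _ _)) (t200n) _.
- by move=> v; rewrite (proj2 F5) // baseE.
- have AT : [set v : 'I_n | ~~ ((v < 0) && (v \in S))] = setT by apply/setP=> v; rewrite !inE.
  exists setT, G, L; split=> //.
  + by rewrite AT; split=> //; apply: reduct_init (sgraph_graph_on G) (connected_onP CG) HS.
  + by move=> v w _ wL; rewrite (proj2 F5) // slotE ?inE.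
move=> s6 [F6 [A [e [M [[AE RA] LM SM st6 _]]]]].
have {}AE : A = ~: S by rewrite AE; apply/setP=> v; rewrite !inE ltn_ord.
subst A; have [[Ge Ce] _ _ eqA _] := RA.
have flag6 (v : 'I_n) : (arrays s6 aFlag v != 0) = (v \in S) by rewrite (proj2 F6).
apply: (wp_seq (t1 := 200 * N) (t2 := 500 * N)); last by clear; lia.
apply: wp_weaken (wp_frame (wp_renumber st6 flag6)) (t200) _ => s7 [F7 [c7 newE]].
have st7 := stored_frame F7 isT st6.
have flag7 (v : 'I_n) : (arrays s7 aFlag v != 0) = (v \in S) by rewrite (proj2 F7).
have t500 : 100 * N + 100 <= 500 * N by move: N0; clear; lia.
apply: wp_weaken (wp_frame (wp_emit SM st7 flag7 newE _ c7 _ _)) (t500) _.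
- by move=> v w vS; rewrite -!in_setC in vS *; rewrite (proj2 (LM v vS));
    case: Ge => es _ eA; rewrite es; apply: eA.
- by move=> i; do !rewrite (proj2 F7, proj2 F6, proj2 F5, proj2 F4, proj2 F3, proj2 F2, proj2
    F1) //.
- by move=> i; do !rewrite (proj2 F7, proj2 F6, proj2 F5, proj2 F4, proj2 F3, proj2 F2, proj2
    F1) //.
move=> s8 [F8 [U8 O8 A8]].
have KA := kernel_adjacency Ge LM.
exists #|~: S|, (kernel_graph Ge), (kernel_lists M).
have tabE := kernel_list_table Ge LM.
have ola : (ola_plus (kernel_graph Ge) <= k) = (ola_plus G <= k).
  apply/idP/idP => [/ola_plus_arrangeable/kernel_arrangeable/eqA/ola_plus_arrangeable //|].
  by move=> /ola_plus_arrangeable/eqA/(kernel_arrangeable Ge)/ola_plus_arrangeable.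
split=> //.
- exact: (kernel_connected Ge Ce (kept_nonempty CG HS)).
- split=> // /ola_plus_arrangeable/eqA; apply: reduct_small RA _.
  by rewrite -setI_eq0 setIC setICr.
- have st8 := stored_frame F8 isT st7; case: st8 => r0' r1' _ _; split=> //.
    by rewrite (proj1 F8).
  rewrite U8 -(off_sum KA) /off tabE size_flatten take_oversize //.
  by rewrite /shape !size_map -cardE.
split=> i; first by rewrite O8 /= tabE.
by rewrite A8 /= tabE.
Qed.

Lemma wp_finish P k n (G : sgraph n) t s :
  0 < k ->
  (forall n m : nat, n <= 5 * k + 2 -> m <= 6 * k + 1 -> decides_within P k n m t) ->
  reduced k G s ->
  (forall x, 2 <= x -> regs s (20 + x) = 0) ->
  (forall a i, 2 <= a -> arrays s (20 + a) i = 0) ->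
  wp (finish P) (100 + t) s (fun s' => (regs s' rN != 0) = (ola_plus G <= k)).
Proof.
move=> k0 HP [n' [G' [L' [CG' LG' [olaE small] [sn sk sc su] [O A]]]]] reg0 arr0.
have [n'0 _] := CG'.
rewrite /finish; apply: wp_weaken (wp_if (t := 80 + t) (Q := _) _) _ (fun _ => id);
  last by rewrite /=; clear; lia.
rewrite /= sc sk; case: ifP => big.
  apply: wp_run => //=.
  by apply/esym/negbTE/negP=> /small h; move: big h; clear; lia.
apply: wp_weaken (wp_if (t := 60 + t) (Q := _) _) _ (fun _ => id); last by rewrite /=; clear;
  lia.
rewrite /= su sc sk; case: ifP => dense.
  apply: wp_run => //=.
  apply/esym/negbTE/negP; rewrite -olaE => /ola_plus_arrangeable h.
  by have := edges_lt n'0 h; move: dense; clear; lia.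
have n'k : n' <= 5 * k + 2 by move: big; clear; lia.
have m'k : #|edges G'| <= 6 * k + 1 by move: dense n'k; rewrite -addnn; clear; lia.
have [u [s1 [e1 ut ans]]] := HP _ _ n'k m'k G' L' CG' (erefl _) LG'.
apply: (wp_seq (t1 := 2) (t2 := 58 + t)); last by clear; lia.
apply: wp_run => //.
apply: (wp_seq (t1 := 2) (t2 := 56 + t)); last by clear; lia.
apply: wp_run => //.
set s2 := run _ _.
(* Registers 20 and 21 have just been assigned, arrays 20 and 21 come from [emit], and the rest of
   the copy is still zero: [P] sees a fresh input. *)
have sh : shifted 20 (input_state k L') s2.
  split=> [[|[|x]]|[|[|a]] i] //=; rewrite ?sc ?sk //; [exact: reg0|exact: arr0].
have [s3 e3 [r3 _]] := exec_shift e1 sh.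
apply: (wp_seq (t1 := u) (t2 := 10)); last by move: ut; clear; lia.
exists u, s3; split=> //; apply: wp_run => //=.
by rewrite -[20]/(20 + 0) r3 ans.
Qed.

Theorem theorem2p11 :
  exists C : nat, forall P : cmd, exists Q : cmd,
  forall (k t : nat), 0 < k ->
    (forall n m : nat, n <= 5 * k + 2 -> m <= 6 * k + 1 ->
       decides_within P k n m t) ->
    forall n m : nat, decides_within Q k n m (C * (m + n + t)).
Proof.
(* The reduction takes [2000 * (n + 2 * m)] and the end [100 + t]; the constant 100 is absorbed
   because [n] is positive. *)
exists 4200 => P; exists (Seq reduce (finish P)) => k t k0 HP n m G L CG mE LG.
have [n0 _] := CG.
have [u [s' [es ut ans]]] : wp (Seq reduce (finish P)) (4200 * (m + n + t)) (input_state k L)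
    (fun s' => (regs s' rN != 0) = (ola_plus G <= k)); last by exists u, s'.
apply: (wp_seq (t1 := 2000 * (n + #|edges G|.*2)) (t2 := 100 + t)); last first.
  by rewrite mE -addnn; move: n0; clear; lia.
apply: wp_weaken (wp_frame (wp_reduce k CG LG)) (leqnn _) _ => s [[fr fa] red].
apply: wp_finish k0 HP red _ _ => [x x2|a i a2].
  rewrite fr; first by case: x x2 => [|[|x]].
  have : all (fun y => y < 20) (written_regs reduce) by [].
  by move/allP => h; apply/negP=> /h; rewrite ltnNge leq_addr.
rewrite fa; first by case: a a2 => [|[|a]].
(* The bound is 22 for arrays but 20 for registers: [emit] has filled arrays 20 and 21, while
   registers 20 and 21 are assigned only in [finish]. *)
have : all (fun y => y < 22) (written_arrays reduce) by [].
by move/allP => h; apply/negP=> /h; move: a2; clear; lia.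
Qed.
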